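(* Let $S$ be the unit sphere of $\mathbb{C}^n$. Fix $(p,q)\in Q$ with $p>q$, and let $\Omega^\infty(p,q)$ be the smallest $L^\infty(S)$-algebra pattern containing $(p,q)$. (1) If $n\ge 3$, then $\Omega^\infty(p,q)=G(p,q)$. (2) If $n=2$, then $\Omega^\infty(p,q)$ is obtained from $G(p,q)$ by deleting the points $(mp-1,mq-1)$ for $m=2,3,4,\ldots$, and the points $(2p-j,2q-j)$ for $j$ odd.
   Context: $\sigma$ is the unique rotation-invariant (i.e. $O(2n)$-invariant) Borel probability measure on $S$, and $L^p(S)=L^p(S,\sigma)$ (complex-valued). The weak*-topology on $L^\infty(S)$ is the one it carries as the dual of $L^1(S)$, via the functionals $f\mapsto\int_S fg\,d\sigma$, $g\in L^1(S)$. $Q$ is the set of pairs $(p,q)$ of nonnegative integers. For $(p,q)\in Q$, $H(p,q)$ is the space of restrictions to $S$ of harmonic polynomials on $\mathbb{C}^n$ that are homogeneous of degree $p$ in $z_1,\dots,z_n$ and homogeneous of degree $q$ in $\bar z_1,\dots,\bar z_n$. For $\Omega\subset Q$, $E_\Omega$ is the set of all finite sums of elements of the spaces $H(p,q)$ with $(p,q)\in\Omega$, and $\overline{E}_\Omega^{*}$ is its weak*-closure in $L^\infty(S)$. $\Omega$ is an $L^\infty(S)$-algebra pattern if $\overline{E}_\Omega^{*}$ is an algebra, i.e. a linear subspace closed under pointwise multiplication (it need not contain the constants). ''Smallest'' refers to inclusion of subsets of $Q$. For $(p,q)\in Q$ with $0\le q<p$, $G(p,q)$ is the set consisting of $(p,q)$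 and all points $(mp-j,mq-j)$ where $m=2,3,4,\ldots$ and $0\le j\le mq$. *)

(* Defs.v *)
From HB Require Import structures.
From mathcomp Require Import all_boot all_order all_algebra.
From mathcomp Require Import complex.
From mathcomp Require Import all_classical all_reals all_analysis.
From mathcomp Require Import -(notations) mpoly.

Set Implicit Arguments.
Unset Strict Implicit.
Unset Printing Implicit Defensive.

Import Order.TTheory GRing.Theory Num.Theory.
Import numFieldNormedType.Exports.

Local Open Scope classical_set_scope.
Local Open Scope ring_scope.
Local Open Scope complex_scope.

(* C^n is realised as the row space R^(n + n): the first n entries are the real
   parts of z_1, ..., z_n and the last n entries their imaginary parts.  Since
   a measurableType has to be pointed, the sphere is only built for the
   positive dimensions n.+1. *)

Definition zcoord (R : realType) (n : nat) (x : 'rV[R]_(n + n)) (j : 'I_n) :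
  R[i] := x 0 (lshift n j) +i* x 0 (rshift n j).

Definition sphere_set (R : realType) (n : nat) : set 'rV[R]_(n.+1 + n.+1) :=
  [set x | \sum_k x 0 k ^+ 2 = 1].

Definition sphere (R : realType) (n : nat) : Type := set_type (@sphere_set R n).

Definition sphere_val (R : realType) (n : nat) (x : sphere R n) :
  'rV[R]_(n.+1 + n.+1) := set_val x.

Lemma sphere_nonempty (R : realType) (n : nat) :
  (delta_mx 0 0 : 'rV[R]_(n.+1 + n.+1)) \in @sphere_set R n.
Proof.
rewrite inE /sphere_set /= (bigD1 0)//= mxE !eqxx expr1n big1 ?addr0// => k k0.
by rewrite mxE eqxx /= (negbTE k0) expr0n.
Qed.

HB.instance Definition _ (R : realType) (n : nat) :=
  Topological.copy (sphere R n) (set_type (@sphere_set R n)).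
HB.instance Definition _ (R : realType) (n : nat) :=
  isPointed.Build (sphere R n) (SigSub (sphere_nonempty R n)).

Definition borel_sphere (R : realType) (n : nat) :=
  g_sigma_algebraType (@open (sphere R n)).

(* O(2n) acts on rows by right multiplication; the set on the left-hand side
   is the preimage of A under the rotation U. *)
Definition rotation_invariant (R : realType) (n : nat)
    (sigma : probability (borel_sphere R n) R) : Prop :=
  forall (U : 'M[R]_(n.+1 + n.+1)) (A : set (borel_sphere R n)),
    U *m U^T = 1%:M -> measurable A ->
    sigma [set x | exists2 y, A y & sphere_val y = sphere_val x *m U] =
    sigma A.

Section complex_valued_functions.
Context (d : measure_display) (T : measurableType d) (R : realType).
Variable mu : {measure set T -> \bar R}.
Implicit Types f g : T -> R[i].

Definition cmeasurable f : Prop :=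
  measurable_fun setT (fun x => complex.Re (f x)) /\
  measurable_fun setT (fun x => complex.Im (f x)).

Definition cLp (r : \bar R) f : Prop :=
  cmeasurable f /\ finite_norm mu r (fun x => Normc.normc (f x)).

Definition cintegral f : R[i] :=
  (\int[mu]_x complex.Re (f x)) +i* (\int[mu]_x complex.Im (f x)).

(* Functions are not quotiented by almost everywhere equality: the closure
   below is saturated for it.  The closure is expressed through the basic
   neighbourhoods of f for the functionals f |-> \int f g with g in L^1. *)
Definition weakstar_closure (A : set (T -> R[i])) : set (T -> R[i]) :=
  [set f | cLp +oo%E f /\
    forall (k : nat) (g : 'I_k -> T -> R[i]) (e : R),
      (forall i, cLp 1%E (g i)) -> 0 < e ->
      exists2 h, A h & forall i,
        Normc.normc (cintegral (fun x => h x * g i x) -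
                     cintegral (fun x => f x * g i x)) < e].

Definition is_algebra (A : set (T -> R[i])) : Prop :=
  [/\ A (fun=> 0),
      forall f g, A f -> A g -> A (fun x => f x + g x),
      forall (c : R[i]) f, A f -> A (fun x => c * f x) &
      forall f g, A f -> A g -> A (fun x => f x * g x)].

End complex_valued_functions.

Section harmonic.
Context (R : realType) (n : nat).

(* 'D_v is a total operator; the Laplacian is only used on polynomials. *)
Definition laplacian (u : 'rV[R]_(n + n) -> R) (x : 'rV[R]_(n + n)) : R :=
  \sum_(k < n + n) 'D_(delta_mx 0 k) ('D_(delta_mx 0 k) u) x.

Definition harmonic (f : 'rV[R]_(n + n) -> R[i]) : Prop :=
  forall x, laplacian (fun y => complex.Re (f y)) x = 0 /\
            laplacian (fun y => complex.Im (f y)) x = 0.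

(* The first n variables of P stand for z_1, ..., z_n and the last n ones for
   their conjugates. *)
Definition bihomogeneous (p q : nat) (P : mpoly (n + n) R[i]) : Prop :=
  forall m, m \in msupp P ->
    (\sum_(j < n) m (lshift n j) = p)%N /\ (\sum_(j < n) m (rshift n j) = q)%N.

Definition zeval (P : mpoly (n + n) R[i]) (x : 'rV[R]_(n + n)) : R[i] :=
  meval (fun k => match fintype.split k with
                        | inl j => zcoord x j
                        | inr j => conjc (zcoord x j)
                        end) P.

End harmonic.

Section patterns.
Context (R : realType) (n : nat).
Variable sigma : probability (borel_sphere R n) R.

Definition Hspace (p q : nat) : set (borel_sphere R n -> R[i]) :=
  [set h | exists P : mpoly (n.+1 + n.+1) R[i],
    [/\ bihomogeneous p q P, harmonic (zeval P) &
        forall x, h x = zeval P (sphere_val x)]].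

Definition Espace (Om : set (nat * nat)) : set (borel_sphere R n -> R[i]) :=
  [set f | exists (k : nat) (h : 'I_k -> borel_sphere R n -> R[i]),
    (forall i, exists2 pq, Om pq & Hspace pq.1 pq.2 (h i)) /\
    forall x, f x = \sum_(i < k) h i x].

Definition algebra_pattern (Om : set (nat * nat)) : Prop :=
  is_algebra (weakstar_closure sigma (Espace Om)).

Definition smallest_algebra_pattern (pq : nat * nat) (Om : set (nat * nat)) :
    Prop :=
  [/\ algebra_pattern Om, Om pq &
      forall Om', algebra_pattern Om' -> Om' pq -> Om `<=` Om'].

End patterns.

(* The point (m p - j, m q - j) is written additively, as natural number
   subtraction is truncated. *)
Definition Gset (p q : nat) : set (nat * nat) :=
  [set x | x = (p, q) \/
    exists m j, [/\ (2 <= m)%N, (j <= m * q)%N,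
                    (x.1 + j = m * p)%N & (x.2 + j = m * q)%N]].

Definition Gset_deleted (p q : nat) : set (nat * nat) :=
  [set x | (exists m, [/\ (2 <= m)%N, (x.1 + 1 = m * p)%N &
                          (x.2 + 1 = m * q)%N]) \/
           (exists j, [/\ odd j, (x.1 + j = 2 * p)%N & (x.2 + j = 2 * q)%N])].

(* Main.v *)
(* The integral I of polynomials over the sphere is a linear functional with
   I(1) = 1 and I(|z|^2 P) = I(P) that kills the infinitesimal unitary rotations
   z_i d/dz_j - conj(z_j) d/d(conj z_i); everything about products of the spaces
   H(a,b) is derived from these properties alone.  A polynomial bihomogeneous of
   degree (a,b) is a sum of |z|^(2j) h_j with h_j harmonic of degree (a-j,b-j),
   and I is nondegenerate between H(a,b) and H(b,a).  Hence Omega is an algebra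
   pattern iff it contains (a+c-j,b+d-j) as soon as it contains (a,b) and (c,d)
   and some product of elements of H(a,b) and H(c,d) has a nonzero j-th
   component.  The weak*-closure plays no role, since the projections are given
   by integration against bounded functions.

   The j-th component of P is nonzero when j is the last exponent for which the
   j-th iterate of the complex Laplacian does not kill P.  If n >= 3, monomials
   in three distinct coordinates realise all j <= min(a,d) + min(b,c), which is
   enough to generate G(p,q).  If n = 2, the trilinear form I(f g h) is
   determined by f = z_1^a conj(z_2)^b and g = z_2^c conj(z_1)^d, because the
   H(a,b) are irreducible under sl_2.  For those, the odd components vanish when
   (a,b) = (c,d), and the first one vanishes when a d = b c: these are the
   deleted points, and explicit products give all the other ones. *)
Require Import Defs.
From HB Require Import structures.
From mathcomp Require Import all_boot all_order all_algebra.
From mathcomp Require Import complex.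
From mathcomp Require Import all_classical all_reals all_analysis.
From mathcomp Require Import measurable_realfun ess_sup_inf.
From mathcomp Require Import ring lra zify.
From mathcomp Require Import -(notations) mpoly.

Set Implicit Arguments.
Unset Strict Implicit.
Unset Printing Implicit Defensive.

Import Order.TTheory GRing.Theory Num.Theory.
Local Open Scope ring_scope.

(** * Weighted and bihomogeneous polynomials *)

(** The hypothesis on [sigma] concerns finite orthogonal matrices, whereas the algebra uses
    infinitesimal rotations. The passage is algebraic: invariance along a rational curve of
    rotations, cleared of denominators, is an identity between polynomials in the parameter, and its
    coefficient of degree 1 is the infinitesimal statement. Nondegeneracy is algebraic too: for
    harmonic [h] of positive degree, I(h conj(h)) is a positive multiple of the sum of the same
    integrals for the first derivatives in z or in conj(z), down to constants, where I(1) = 1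
    decides. Call (m p - t, m q - t) a point of level m and shift t; levels are climbed by
    multiplying with H(p,q). For n = 2 the deletions thin out level 2, so some points of level 3
    lose the neighbours that would give them as a zeroth or a largest component. They come instead
    from the first component of a pair of non-proportional bidegrees, or from the component just
    below the largest one. From level 3 on only the shift 1 is missing, and the induction never
    starts from it. *)

Section WeightedHomogeneity.
Context (C : numFieldType) (k : nat).
Implicit Types (P Q : mpoly k C) (w : 'I_k -> nat) (m : multinom k).

Lemma mpolyX_mderiv (v : 'I_k) m :
  mpolyX C (mnm1 v) * mderiv v (mpolyX C m) = (m v)%:R *: mpolyX C m.
Proof.
rewrite mderivX -scalerAr -mpolyXD; case: (posnP (m v)) => [->|mv].
  by rewrite !scale0r.
congr (_ *: mpolyX _ _); apply/mnmP => i; rewrite mnmDE mnmBE mnm1E.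
by case: eqP => [<-|_] /=; lia.
Qed.

Definition weight w m : nat := \sum_v w v * m v.

Definition euler w P : mpoly k C :=
  \sum_v (w v)%:R *: (mpolyX C (mnm1 v) * mderiv v P).

Lemma euler_is_linear w : linear (euler w).
Proof.
move=> c P Q; rewrite /euler scaler_sumr -big_split /=; apply: eq_bigr => v _.
by rewrite mderivD mderivZ mulrDr -scalerAr !scalerDr !scalerA mulrC.
Qed.
HB.instance Definition _ w :=
  GRing.isLinear.Build C (mpoly k C) (mpoly k C) *:%R (euler w)
    (euler_is_linear w).

Lemma eulerZ w c P : euler w (c *: P) = c *: euler w P.
Proof. exact: linearZ. Qed.

Lemma eulerX w m : euler w (mpolyX C m) = (weight w m)%:R *: mpolyX C m.
Proof.
rewrite /euler /weight natr_sum scaler_suml; apply: eq_bigr => v _.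
by rewrite mpolyX_mderiv scalerA natrM.
Qed.

Lemma mcoeff_euler w P m :
  mcoeff m (euler w P) = (weight w m)%:R * mcoeff m P.
Proof.
rewrite (mpolyE P) (raddf_sum (euler w)) !(raddf_sum (mcoeff m)) mulr_sumr.
apply: eq_bigr => m' _; rewrite /= eulerZ eulerX scalerA !mcoeffZ !mcoeffX.
by case: eqP => [->|_]; rewrite ?mulr1 ?mulr0// mulrC.
Qed.

(* Euler's equation; see [whomP] for the description by monomials. *)
Definition whom w (a : nat) P := euler w P = a%:R *: P.

(** Euler's equation multiplies each coefficient by its weight; in characteristic 0 the weight can
    be read off a nonzero coefficient. *)
Lemma whomP w a P :
  whom w a P <-> forall m, m \in msupp P -> weight w m = a.
Proof.
split=> [wP m|wP].
  rewrite mcoeff_msupp => Pm0; apply/eqP; rewrite -(eqr_nat C); apply/eqP.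
  by apply: (mulIf Pm0); rewrite -mcoeff_euler wP mcoeffZ.
apply/mpolyP => m; rewrite mcoeff_euler mcoeffZ.
have [/wP -> //|/memN_msupp_eq0 ->] := boolP (m \in msupp P).
by rewrite !mulr0.
Qed.

Lemma eulerM w P Q : euler w (P * Q) = euler w P * Q + P * euler w Q.
Proof.
rewrite /euler mulr_suml mulr_sumr -big_split /=; apply: eq_bigr => v _.
rewrite mderivM mulrDr scalerDr -!scalerAl -scalerAr.
by congr (_ *: _ + _ *: _); ring.
Qed.

Lemma euler_mderiv w v P :
  euler w (mderiv v P) = mderiv v (euler w P) - (w v)%:R *: mderiv v P.
Proof.
apply/mpolyP => m; rewrite mcoeffB mcoeffZ !(mcoeff_euler, mcoeff_mderiv).
have -> : weight w (mnm_add m (mnm1 v)) = (weight w m + w v)%N.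
  rewrite /weight -(eq_bigr _ (fun i _ => esym (congr1 _ (mnmDE _ _ _)))).
  under eq_bigr do rewrite mulnDr.
  rewrite big_split /=; congr addn.
  rewrite (bigD1 v) //= mnm1E eqxx muln1 big1 ?addn0// => i iv.
  by rewrite mnm1E eq_sym (negbTE iv) muln0.
by rewrite !mulrnAr natrD mulrDl mulrnDl addrK.
Qed.

Lemma whom0 w a : whom w a 0.
Proof. by rewrite /whom linear0 scaler0. Qed.

Lemma whomD w a P Q : whom w a P -> whom w a Q -> whom w a (P + Q).
Proof. by rewrite /whom linearD /= scalerDr => -> ->. Qed.

Lemma whomZ w a c P : whom w a P -> whom w a (c *: P).
Proof. by rewrite /whom linearZ /= => ->; rewrite !scalerA mulrC. Qed.

Lemma whomB w a P Q : whom w a P -> whom w a Q -> whom w a (P - Q).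
Proof. by move=> wP wQ; rewrite -scaleN1r; apply/whomD/whomZ. Qed.

Lemma whom_sum w a (T : Type) (r : seq T) (B : pred T) (F : T -> mpoly k C) :
  (forall i, B i -> whom w a (F i)) -> whom w a (\sum_(i <- r | B i) F i).
Proof. by move=> wF; apply: big_ind => //; [exact: whom0|exact: whomD]. Qed.

Lemma whomM w a b P Q : whom w a P -> whom w b Q -> whom w (a + b) (P * Q).
Proof.
rewrite /whom eulerM => -> ->.
by rewrite -scalerAl -scalerAr -scalerDl natrD.
Qed.

Lemma weightU w v : weight w (mnm1 v) = w v.
Proof.
rewrite /weight (bigD1 v) //= mnm1E eqxx muln1 big1 ?addn0// => i iv.
by rewrite mnm1E eq_sym (negbTE iv) muln0.
Qed.

Lemma whomX w m : whom w (weight w m) (mpolyX C m).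
Proof. exact: eulerX. Qed.

Lemma whomXU w v : whom w (w v) (mpolyX C (mnm1 v)).
Proof. by rewrite -[X in whom _ X _](weightU w v); exact: whomX. Qed.

Lemma whom1 w : whom w 0 1.
Proof.
rewrite -mpolyX0; have <- : weight w mnm0 = 0%N; last exact: whomX.
by rewrite /weight big1// => i _; rewrite mnm0E muln0.
Qed.

Lemma whomXn w a P j : whom w a P -> whom w (j * a) (P ^+ j).
Proof.
move=> wP; elim: j => [|j IH]; first by rewrite mul0n expr0; exact: whom1.
by rewrite exprS mulSn; exact: whomM.
Qed.

(** The truncated subtraction is harmless: if [a < w v], the variable [v] does not occur in [P], the
    derivative is 0, and 0 is homogeneous of every degree. *)
Lemma whom_mderiv w a v P : whom w a P -> whom w (a - w v) (mderiv v P).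
Proof.
move=> wP; have [le_v|lt_v] := leqP (w v) a.
  by rewrite /whom euler_mderiv wP mderivZ -scalerBl natrB.
suff -> : mderiv v P = 0 by exact: whom0.
have /whomP {}wP := wP; apply/mpolyP => m; rewrite mcoeff_mderiv mcoeff0.
rewrite memN_msupp_eq0 ?mul0rn//; apply/negP => /wP Em; move: lt_v; rewrite -Em.
rewrite ltnNge => /negP; apply; rewrite /weight (bigD1 v)//= mnmDE mnm1E eqxx.
by nia.
Qed.

Lemma whom_mderiv0 w v P : (0 < w v)%N -> whom w 0 P -> mderiv v P = 0.
Proof.
move=> wv /whomP wP; apply/mpolyP => m; rewrite mcoeff_mderiv mcoeff0.
rewrite memN_msupp_eq0 ?mul0rn//; apply/negP => /wP.
by rewrite /weight (bigD1 v)//= mnmDE mnm1E eqxx; nia.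
Qed.

End WeightedHomogeneity.

Section BihomogeneousPolynomials.
Context (C : numFieldType) (N : nat).
Implicit Types (P Q h : mpoly (N + N) C) (i : 'I_N) (a b c d j : nat).

Definition zvar i : mpoly (N + N) C := mpolyX C (mnm1 (lshift N i)).
Definition bvar i : mpoly (N + N) C := mpolyX C (mnm1 (rshift N i)).
Definition dz i P := mderiv (lshift N i) P.
Definition db i P := mderiv (rshift N i) P.
HB.instance Definition _ i := GRing.Linear.copy (dz i) (mderiv (lshift N i)).
HB.instance Definition _ i := GRing.Linear.copy (db i) (mderiv (rshift N i)).

Definition zw (v : 'I_(N + N)) : nat := (v < N)%N.
Definition bw (v : 'I_(N + N)) : nat := (N <= v)%N.
Definition bihom a b P := whom zw a P /\ whom bw b P.

(* The Laplacian of C^N is [4 * box]. *)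
Definition box P := \sum_i dz i (db i P).
Definition r2 := \sum_i zvar i * bvar i.

Lemma zwl i : zw (lshift N i) = 1%N. Proof. by rewrite /zw /= ltn_ord. Qed.
Lemma zwr i : zw (rshift N i) = 0%N.
Proof. by rewrite /zw /= ltnNge leq_addr. Qed.
Lemma bwl i : bw (lshift N i) = 0%N. Proof. by rewrite /bw /= leqNgt ltn_ord. Qed.
Lemma bwr i : bw (rshift N i) = 1%N. Proof. by rewrite /bw /= leq_addr. Qed.

Lemma weight_zw m : weight zw m = \sum_j m (lshift N j).
Proof.
rewrite /weight big_split_ord /= [X in (_ + X)%N]big1 ?addn0.
  by apply: eq_bigr => i _; rewrite zwl mul1n.
by move=> i _; rewrite zwr.
Qed.

Lemma weight_bw m : weight bw m = \sum_j m (rshift N j).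
Proof.
rewrite /weight big_split_ord /= big1 ?add0n.
  by apply: eq_bigr => i _; rewrite bwr mul1n.
by move=> i _; rewrite bwl.
Qed.

Lemma bihomP a b P : bihom a b P <-> forall m, m \in msupp P ->
  \sum_(j < N) m (lshift N j) = a /\ \sum_(j < N) m (rshift N j) = b.
Proof.
rewrite /bihom !whomP; split=> [[Pa Pb] m mP|Pab].
  by rewrite -weight_zw -weight_bw Pa// Pb.
by split=> m /Pab [Pa Pb]; rewrite ?weight_zw ?weight_bw.
Qed.

Lemma bihom0 a b : bihom a b 0. Proof. by split; exact: whom0. Qed.

Lemma bihomB a b P Q : bihom a b P -> bihom a b Q -> bihom a b (P - Q).
Proof. by move=> [? ?] [? ?]; split; exact: whomB. Qed.

Lemma bihomZ a b x P : bihom a b P -> bihom a b (x *: P).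
Proof. by move=> [? ?]; split; exact: whomZ. Qed.

Lemma bihom_sum a b (T : Type) (r : seq T) (B : pred T) F :
  (forall t, B t -> bihom a b (F t)) -> bihom a b (\sum_(t <- r | B t) F t).
Proof. by move=> F_; split; apply: whom_sum => t /F_ []. Qed.

Lemma bihomM a b c d P Q :
  bihom a b P -> bihom c d Q -> bihom (a + c) (b + d) (P * Q).
Proof. by move=> [? ?] [? ?]; split; exact: whomM. Qed.

Lemma bihomXn a b P j : bihom a b P -> bihom (j * a) (j * b) (P ^+ j).
Proof. by move=> [? ?]; split; exact: whomXn. Qed.

Lemma bihom_zvar i : bihom 1 0 (zvar i).
Proof.
by split; [have := whomXU C zw (lshift N i); rewrite zwl
          |have := whomXU C bw (lshift N i); rewrite bwl].
Qed.

Lemma bihom_bvar i : bihom 0 1 (bvar i).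
Proof.
by split; [have := whomXU C zw (rshift N i); rewrite zwr
          |have := whomXU C bw (rshift N i); rewrite bwr].
Qed.

Lemma bihom_dz a b i P : bihom a b P -> bihom a.-1 b (dz i P).
Proof.
move=> [/(whom_mderiv (lshift N i)) ? /(whom_mderiv (lshift N i)) ?].
by split; [rewrite -subn1 -[1%N](zwl i)|rewrite -[b]subn0 -[0%N](bwl i)].
Qed.

Lemma bihom_db a b i P : bihom a b P -> bihom a b.-1 (db i P).
Proof.
move=> [/(whom_mderiv (rshift N i)) ? /(whom_mderiv (rshift N i)) ?].
by split; [rewrite -[a]subn0 -[0%N](zwr i)|rewrite -subn1 -[1%N](bwr i)].
Qed.

Lemma bihom_dz0 b i P : bihom 0 b P -> dz i P = 0.
Proof. by move=> [? _]; apply: (@whom_mderiv0 _ _ zw); rewrite ?zwl. Qed.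

Lemma bihom_db0 a i P : bihom a 0 P -> db i P = 0.
Proof. by move=> [_ ?]; apply: (@whom_mderiv0 _ _ bw); rewrite ?bwr. Qed.

Lemma bihom_box a b P : bihom a b P -> bihom a.-1 b.-1 (box P).
Proof. by move=> ?; apply: bihom_sum => i _; exact/bihom_dz/bihom_db. Qed.

Lemma bihom_box0 a b P : minn a b = 0%N -> bihom a b P -> box P = 0.
Proof.
move=> ab0 Pab; apply: big1 => i _.
have [a0|b0] : a = 0%N \/ b = 0%N by lia.
  by apply: (@bihom_dz0 b.-1); rewrite -a0; exact: bihom_db.
by rewrite (@bihom_db0 a) ?linear0// -b0.
Qed.

Lemma bihom_r2 : bihom 1 1 r2.
Proof.
apply: bihom_sum => i _; exact: (bihomM (bihom_zvar i) (bihom_bvar i)).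
Qed.

Lemma bihom_iter_box a b P j : bihom a b P -> bihom (a - j) (b - j) (iter j box P).
Proof.
move=> Pab; elim: j => [|j IH]; first by rewrite !subn0.
by rewrite iterS !subnS; exact: bihom_box.
Qed.

Lemma iter_box0 a b P j :
  bihom a b P -> (minn a b < j)%N -> iter j box P = 0.
Proof.
case: j => // j Pab lt_j.
by apply: (bihom_box0 _ (bihom_iter_box j Pab)); lia.
Qed.

Lemma dzM i P Q : dz i (P * Q) = dz i P * Q + P * dz i Q.
Proof. exact: mderivM. Qed.
Lemma dbM i P Q : db i (P * Q) = db i P * Q + P * db i Q.
Proof. exact: mderivM. Qed.
Lemma dzD i P Q : dz i (P + Q) = dz i P + dz i Q. Proof. exact: linearD. Qed.
Lemma dbD i P Q : db i (P + Q) = db i P + db i Q. Proof. exact: linearD. Qed.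
Lemma dzB i P Q : dz i (P - Q) = dz i P - dz i Q. Proof. exact: linearB. Qed.
Lemma dbB i P Q : db i (P - Q) = db i P - db i Q. Proof. exact: linearB. Qed.
Lemma dzZ i (c : C) P : dz i (c *: P) = c *: dz i P. Proof. exact: linearZ. Qed.
Lemma dbZ i (c : C) P : db i (c *: P) = c *: db i P. Proof. exact: linearZ. Qed.
Lemma dz_db i (j : 'I_N) P : dz i (db j P) = db j (dz i P).
Proof. exact: mderiv_comm. Qed.
Lemma dz_dz i (j : 'I_N) P : dz i (dz j P) = dz j (dz i P).
Proof. exact: mderiv_comm. Qed.
Lemma db_db i (j : 'I_N) P : db i (db j P) = db j (db i P).
Proof. exact: mderiv_comm. Qed.

Lemma mderivXU (u v : 'I_(N + N)) :
  mderiv u (mpolyX C (mnm1 v)) = (v == u)%:R.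
Proof.
rewrite mderivX mnm1E; case: eqP => [->|_]; last by rewrite scale0r.
by rewrite scale1r -mpolyX0; congr mpolyX; apply/mnmP => k;
  rewrite mnmBE mnm0E subnn.
Qed.

Lemma dz_zvar i (j : 'I_N) : dz i (zvar j) = (j == i)%:R.
Proof. by rewrite /dz mderivXU (inj_eq (@lshift_inj _ _)). Qed.
Lemma dz_bvar i (j : 'I_N) : dz i (bvar j) = 0.
Proof. by rewrite /dz mderivXU eq_rlshift. Qed.
Lemma db_zvar i (j : 'I_N) : db i (zvar j) = 0.
Proof. by rewrite /db mderivXU eq_lrshift. Qed.
Lemma db_bvar i (j : 'I_N) : db i (bvar j) = (j == i)%:R.
Proof. by rewrite /db mderivXU (inj_eq (@rshift_inj _ _)). Qed.

Lemma euler_zw P : euler zw P = \sum_i zvar i * dz i P.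
Proof.
rewrite /euler big_split_ord /= [X in _ + X]big1 ?addr0.
  by apply: eq_bigr => i _; rewrite zwl scale1r.
by move=> i _; rewrite zwr scale0r.
Qed.

Lemma euler_bw P : euler bw P = \sum_i bvar i * db i P.
Proof.
rewrite /euler big_split_ord /= big1 ?add0r.
  by apply: eq_bigr => i _; rewrite bwr scale1r.
by move=> i _; rewrite bwl scale0r.
Qed.

Lemma sum_zdz a P : whom zw a P -> \sum_i zvar i * dz i P = a%:R *: P.
Proof. by rewrite -euler_zw. Qed.
Lemma sum_bdb b P : whom bw b P -> \sum_i bvar i * db i P = b%:R *: P.
Proof. by rewrite -euler_bw. Qed.

Lemma box_is_linear : linear box.
Proof.
move=> c P Q; rewrite /box scaler_sumr -big_split /=; apply: eq_bigr => i _.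
by rewrite !linearP.
Qed.
HB.instance Definition _ :=
  GRing.isLinear.Build C (mpoly (N + N) C) (mpoly (N + N) C) *:%R box
    box_is_linear.

Lemma boxZ (c : C) P : box (c *: P) = c *: box P. Proof. exact: linearZ. Qed.
Lemma boxB P Q : box (P - Q) = box P - box Q. Proof. exact: linearB. Qed.

Lemma dz_box i P : dz i (box P) = box (dz i P).
Proof.
rewrite /box raddf_sum; apply: eq_bigr => j _ /=.
by rewrite (dz_dz i j) (dz_db i j).
Qed.

Lemma db_box i P : db i (box P) = box (db i P).
Proof.
rewrite /box raddf_sum; apply: eq_bigr => j _ /=.
by rewrite -(dz_db j i) (db_db i j).
Qed.

Lemma boxM P Q : box (P * Q) = box P * Q + P * box Q +
  \sum_i (dz i P * db i Q + db i P * dz i Q).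
Proof.
rewrite /box mulr_suml mulr_sumr -!big_split /=; apply: eq_bigr => i _.
by rewrite dbM linearD /= !dzM; ring.
Qed.

Lemma box_zvarM i P : box (zvar i * P) = zvar i * box P + db i P.
Proof.
rewrite boxM [box (zvar i)]big1 ?mul0r ?add0r => [|k _]; last first.
  by rewrite db_zvar linear0.
congr (_ + _); rewrite (bigD1 i)//= big1 ?addr0 => [|k ki].
  by rewrite dz_zvar db_zvar eqxx mul1r mul0r addr0.
by rewrite dz_zvar db_zvar eq_sym (negbTE ki) !mul0r addr0.
Qed.

Lemma box_bvarM i P : box (bvar i * P) = bvar i * box P + dz i P.
Proof.
rewrite boxM [box (bvar i)]big1 ?mul0r ?add0r => [|k _]; last first.
  by rewrite dz_db dz_bvar linear0.
congr (_ + _); rewrite (bigD1 i)//= big1 ?addr0 => [|k ki].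
  by rewrite dz_bvar db_bvar eqxx mul1r mul0r add0r.
by rewrite dz_bvar db_bvar eq_sym (negbTE ki) !mul0r addr0.
Qed.

Lemma dz_r2 i : dz i r2 = bvar i.
Proof.
rewrite /r2 raddf_sum (bigD1 i) //= dzM dz_zvar dz_bvar eqxx mul1r mulr0 addr0.
rewrite big1 ?addr0// => j ji.
by rewrite dzM dz_zvar dz_bvar (negbTE ji) mul0r mulr0 addr0.
Qed.

Lemma db_r2 i : db i r2 = zvar i.
Proof.
rewrite /r2 raddf_sum (bigD1 i) //= dbM db_zvar db_bvar eqxx mul0r mulr1 add0r.
rewrite big1 ?addr0// => j ji.
by rewrite dbM db_zvar db_bvar (negbTE ji) mul0r mulr0 addr0.
Qed.

Lemma box_r2M P :
  box (r2 * P) = r2 * box P + N%:R *: P + (euler zw P + euler bw P).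
Proof.
rewrite boxM euler_zw euler_bw -big_split /= (addrC (box r2 * P)).
congr (_ + _ + _); last by apply: eq_bigr => i _; rewrite dz_r2 db_r2 addrC.
rewrite [X in X * P](_ : _ = N%:R) ?scaler_nat ?mulr_natl//.
rewrite /box (eq_bigr (fun=> 1)) ?sumr_const ?card_ord// => i _.
by rewrite db_r2 dz_zvar eqxx.
Qed.

Lemma box_r2M_bihom a b P : bihom a b P ->
  box (r2 * P) = r2 * box P + (N + a + b)%:R *: P.
Proof.
by move=> [Pa Pb]; rewrite box_r2M Pa Pb -!scalerDl -addrA -!scalerDl !natrD addrA.
Qed.

(** The commutator of [box] and [r2] is [N] plus the total degree; the values [N + a + b + 2 i] for
    [i <= j] add up to the factor. *)
Lemma box_r2Xn a b j h : bihom a b h -> box h = 0 ->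
  box (r2 ^+ j.+1 * h) = (j.+1 * (N + a + b + j))%:R *: (r2 ^+ j * h).
Proof.
move=> hab h0; elim: j => [|j IH].
  by rewrite expr1 (box_r2M_bihom hab) h0 mulr0 add0r mul1n addn0 expr0 mul1r.
rewrite exprS -mulrA.
rewrite (box_r2M_bihom (bihomM (bihomXn j.+1 bihom_r2) hab)) {}IH.
rewrite -scalerAr mulrA -exprS -scalerDl -natrD.
by congr (_%:R *: _); nia.
Qed.

(** Induction on [minn a b]: decompose [box P] and lift each term through [box] by dividing by the
    factor of [box_r2Xn], which [0 < N] keeps nonzero. What remains of [P] is harmonic and becomes
    component 0. *)
Lemma harmonic_decomposition a b P : (0 < N)%N -> bihom a b P ->
  exists h : nat -> mpoly (N + N) C,
  [/\ forall j, box (h j) = 0,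
      forall j, (j <= minn a b)%N -> bihom (a - j) (b - j) (h j) &
      P = \sum_(j < (minn a b).+1) r2 ^+ j * h j].
Proof.
move=> N0; move: {2}(minn a b) (leqnn (minn a b)) => k.
elim: k a b P => [|k IH] a b P kab Pab; have [ab0|ab0] := posnP (minn a b);
  rewrite ?ab0 //.
- exists (fun j => if j == 0%N then P else 0); split; last 2 first.
  + by case=> [_|//]; rewrite !subn0.
  + by rewrite big_ord1 expr0 mul1r.
  by move=> [|j] /=; rewrite ?linear0//; exact: (bihom_box0 _ Pab).
- by rewrite ltnNge kab in ab0.
- exists (fun j => if j == 0%N then P else 0); split; last 2 first.
  + by case=> [_|//]; rewrite !subn0.
  + by rewrite big_ord1 expr0 mul1r.
  by move=> [|j] /=; rewrite ?linear0//; exact: (bihom_box0 _ Pab).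
have [|h [h_harm h_hom hP]] := IH a.-1 b.-1 (box P) _ (bihom_box Pab).
  by lia.
pose mu j := (j.+1 * (N + (a.-1 - j) + (b.-1 - j) + j))%:R : C.
have mu0 j : mu j != 0 by rewrite pnatr_eq0 muln_eq0 /=; lia.
pose Q := \sum_(j < (minn a.-1 b.-1).+1) (mu j)^-1 *: (r2 ^+ j.+1 * h j).
have boxQ : box Q = box P.
  rewrite /Q raddf_sum hP /=; apply: eq_bigr => j _; rewrite linearZ /=.
  have jm : (j <= minn a.-1 b.-1)%N by rewrite -ltnS.
  by rewrite (box_r2Xn _ (h_hom _ jm))// scalerA mulVf ?scale1r// mu0.
exists (fun j => if j is j'.+1 then (mu j')^-1 *: h j' else P - Q); split.
- by move=> [|j]; [rewrite linearB /= boxQ subrr|rewrite linearZ /= h_harm scaler0].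
- move=> [_|j jab].
    rewrite !subn0; apply: bihomB => //; apply: bihom_sum => j _; apply: bihomZ.
    have jm : (j <= minn a.-1 b.-1)%N by rewrite -ltnS.
    have := bihomM (bihomXn j.+1 bihom_r2) (h_hom _ jm); rewrite !muln1.
    by congr bihom; lia.
  have jm : (j <= minn a.-1 b.-1)%N by lia.
  by apply: bihomZ; have := h_hom _ jm; congr bihom; lia.
have -> : minn a b = (minn a.-1 b.-1).+1 by lia.
rewrite big_ord_recl /= expr0 mul1r -[LHS](subrK Q); congr (_ + _).
by apply: eq_bigr => j _; rewrite -scalerAr.
Qed.

End BihomogeneousPolynomials.

Arguments zw {N} v.
Arguments bw {N} v.
Arguments box {C N} P.

(** Induction along multiplication by one variable, so that derivations and ring morphisms need only
    be compared on variables. *)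
Lemma mpoly_ring_ind (R : nzRingType) (k : nat) (K : mpoly k R -> Prop) :
  K 1 -> (forall P Q, K P -> K Q -> K (P + Q)) -> (forall c P, K P -> K (c *: P)) ->
  (forall v P, K P -> K (mpolyX R (mnm1 v) * P)) -> forall P, K P.
Proof.
move=> K1 KD KZ KM P; rewrite (mpolyE P); apply: (big_ind K) => //.
  by rewrite -(scale0r 1); exact: KZ.
move=> m _; apply: KZ; move: {2}(mdeg m) (erefl (mdeg m)) => d.
elim: d m => [|d IH] m dm.
  by move: dm => /eqP; rewrite mdeg_eq0 => /eqP ->; rewrite mpolyX0.
have [v mv] : exists v, m v != 0%N.
  apply/existsP; rewrite -negb_forall; apply/negP => /forallP m0; move: dm.
  by rewrite mdegE big1// => i _; apply/eqP/m0.
have -> : m = mnm_add (mnm1 v) (mnm_sub m (mnm1 v)).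
  by rewrite addmC submK// lep1mP.
rewrite mpolyXD; apply/KM/IH; apply/eqP; rewrite -eqSS -dm.
by rewrite -(submK (m := mnm1 v) (m' := m)) ?lep1mP// mdegD mdeg1 addn1 addmK.
Qed.

(** * Complex conjugation of formal polynomials *)

Section Conjugation.
Context (C : numClosedFieldType) (N : nat).
Implicit Types (P Q h : mpoly (N + N) C) (i : 'I_N) (a b : nat).

Definition bar_var (v : 'I_(N + N)) : mpoly (N + N) C :=
  match fintype.split v with inl j => bvar C j | inr j => zvar C j end.

Definition bar P : mpoly (N + N) C :=
  mmap (@mpolyC (N + N) C \o Num.conj) bar_var P.
HB.instance Definition _ := GRing.RMorphism.copy bar
  (mmap (@mpolyC (N + N) C \o Num.conj) bar_var).

Lemma barZ c P : bar (c *: P) = c^* *: bar P.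
Proof. by rewrite /bar mmapZ /= mul_mpolyC. Qed.

Lemma bar_zvar i : bar (zvar C i) = bvar C i.
Proof. by rewrite /bar /zvar mmapX mmap1U /bar_var (unsplitK (inl i)). Qed.

Lemma bar_bvar i : bar (bvar C i) = zvar C i.
Proof. by rewrite /bar /bvar mmapX mmap1U /bar_var (unsplitK (inr i)). Qed.

Lemma mpolyX_zb_ind (K : mpoly (N + N) C -> Prop) :
  K 1 -> (forall P Q, K P -> K Q -> K (P + Q)) -> (forall c P, K P -> K (c *: P)) ->
  (forall i P, K P -> K (zvar C i * P)) -> (forall i P, K P -> K (bvar C i * P)) ->
  forall P, K P.
Proof.
move=> K1 KD KZ Kz Kb; apply: mpoly_ring_ind => // v P KP.
by rewrite -(splitK v); case: (fintype.split v) => i /=; [exact: Kz|exact: Kb].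
Qed.

Lemma barK : involutive bar.
Proof.
apply: mpolyX_zb_ind => [|P Q IP IQ|c P IP|i P IP|i P IP].
- by rewrite !rmorph1.
- by rewrite !rmorphD /= IP IQ.
- by rewrite !barZ conjCK IP.
- by rewrite !rmorphM /= bar_zvar bar_bvar IP.
- by rewrite !rmorphM /= bar_bvar bar_zvar IP.
Qed.

Lemma bar_dz i P : bar (dz i P) = db i (bar P).
Proof.
move: P; apply: mpolyX_zb_ind => [|P Q IP IQ|c P IP|j P IP|j P IP].
- by rewrite rmorph1 /dz /db -mpolyC1 !mderivC rmorph0.
- by rewrite !(rmorphD, linearD) /= IP IQ.
- by rewrite barZ !linearZ /= barZ IP.
- rewrite dzM dz_zvar rmorphD !rmorphM /= bar_zvar dbM db_bvar IP.
  by rewrite rmorph_nat.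
- rewrite dzM dz_bvar rmorphD !rmorphM /= bar_bvar dbM db_zvar IP.
  by rewrite rmorph0.
Qed.

Lemma bar_db i P : bar (db i P) = dz i (bar P).
Proof. by rewrite -[in LHS](barK P) -bar_dz barK. Qed.

Lemma bar_box P : bar (box P) = box (bar P).
Proof.
by rewrite /box rmorph_sum; apply: eq_bigr => i _; rewrite /= bar_dz bar_db dz_db.
Qed.

Lemma bar_bihom a b P : bihom a b P -> bihom b a (bar P).
Proof.
rewrite /bihom /whom !(euler_zw, euler_bw) => -[Pa Pb]; split.
- transitivity (bar (\sum_i bvar C i * db i P)); last first.
    by rewrite Pb barZ conjC_nat.
  by rewrite rmorph_sum; apply: eq_bigr => i _; rewrite /= rmorphM /= bar_bvar bar_db.
- transitivity (bar (\sum_i zvar C i * dz i P)); last first.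
    by rewrite Pa barZ conjC_nat.
  by rewrite rmorph_sum; apply: eq_bigr => i _; rewrite /= rmorphM /= bar_zvar bar_dz.
Qed.

End Conjugation.

(** * Invariant functionals on polynomials *)

Section InvariantFunctional.
Context (C : numClosedFieldType) (N : nat) (I : {linear mpoly (N + N) C -> C^o}).
Implicit Types (P Q h g : mpoly (N + N) C) (i : 'I_N) (a b c d j : nat).
Hypothesis N0 : (0 < N)%N.
Hypothesis I_inv : forall i (j : 'I_N) P,
  I (zvar C i * dz j P - bvar C j * db i P) = 0.
Hypothesis I_r2 : forall P, I (r2 C N * P) = I P.
Hypothesis I1 : I 1 = 1.

Lemma I_sum (T : Type) (r : seq T) (B : pred T) F :
  I (\sum_(t <- r | B t) F t) = \sum_(t <- r | B t) I (F t).
Proof. exact: raddf_sum. Qed.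

Lemma I_scale x P : I (x *: P) = x * I P. Proof. exact: linearZ. Qed.

(** Summing the invariance over [i = j] gives the diagonal rotation, which acts on [P] as the scalar
    [a - b]. *)
Lemma I_unbalanced a b P : bihom a b P -> a != b -> I P = 0.
Proof.
move=> [Pa Pb] ab.
have : \sum_i I (zvar C i * dz i P - bvar C i * db i P) = 0 by apply: big1.
rewrite -I_sum sumrB (sum_zdz Pa) (sum_bdb Pb) -scalerBl I_scale => /eqP.
by rewrite mulf_eq0 subr_eq0 eqr_nat (negbTE ab) => /eqP.
Qed.

(** Apply the invariance to [zvar C j * P] and sum over [j]: the first terms add up to [N + a] times
    [zvar C i * P], the second ones to [r2 * db i P], which integrates like [db i P]. *)
Lemma I_db a i P : whom zw a P -> I (db i P) = (N + a)%:R * I (zvar C i * P).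
Proof.
move=> Pa; have : \sum_j I (zvar C i * dz j (zvar C j * P) -
    bvar C j * db i (zvar C j * P)) = 0 by apply: big1.
rewrite -I_sum sumrB -mulr_sumr.
under eq_bigr do rewrite dzM dz_zvar eqxx mul1r.
rewrite big_split /= sumr_const card_ord (sum_zdz Pa) mulrDr -scalerAr mulrnAr.
under eq_bigr do rewrite dbM db_zvar mul0r add0r mulrA [_ * zvar _ _]mulrC.
rewrite -mulr_suml -/(r2 C N) -scaler_nat -scalerDl -natrD linearB /= I_r2.
by rewrite I_scale => /eqP; rewrite subr_eq0 => /eqP.
Qed.

Lemma I_dz b i P : whom bw b P -> I (dz i P) = (N + b)%:R * I (bvar C i * P).
Proof.
move=> Pb; have : \sum_j I (zvar C j * dz i (bvar C j * P) -
    bvar C i * db j (bvar C j * P)) = 0 by apply: big1.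
rewrite -I_sum sumrB -mulr_sumr.
under eq_bigr do rewrite dzM dz_bvar mul0r add0r mulrA.
rewrite [X in - (bvar C i * X)](eq_bigr (fun j : 'I_N => P + bvar C j * db j P)); last first.
  by move=> j _; rewrite dbM db_bvar eqxx mul1r.
rewrite big_split /= sumr_const card_ord (sum_bdb Pb) [bvar C i * _]mulrDr.
rewrite -scalerAr mulrnAr.
rewrite -mulr_suml -/(r2 C N) -scaler_nat -scalerDl -natrD linearB /= I_r2.
by rewrite I_scale => /eqP; rewrite subr_eq0 => /eqP.
Qed.

(* [box (P * h)] integrates to zero up to the two first-order terms, and each
   of these is a multiple of [I (P * h)] by Euler's identity. *)
Lemma I_box a b c d P h : bihom a b P -> bihom c d h -> box h = 0 ->
  (a + c = b + d)%N ->
  I (box P * h) = (N + a + c).-1%:R * (a%:R - d%:R) * I (P * h).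
Proof.
move=> [Pa Pb] [hc hd] h0 abcd.
have E1 : \sum_i I (db i (dz i P * h)) = (N + a + c).-1%:R * a%:R * I (P * h).
  transitivity (\sum_i (N + (a.-1 + c))%:R * I (zvar C i * dz i P * h)).
    apply: eq_bigr => i _; rewrite (@I_db (a.-1 + c)) ?mulrA//.
    apply: whomM => //; rewrite -subn1 -[1%N](zwl i); exact: whom_mderiv.
  rewrite -mulr_sumr -I_sum -mulr_suml (sum_zdz Pa) -scalerAl I_scale mulrA.
  case: (a) => [|a']; first by rewrite !(mul0r, mulr0).
  by congr (_%:R * _ * _); lia.
have E2 : \sum_i I (dz i (P * db i h)) = (N + a + c).-1%:R * d%:R * I (P * h).
  transitivity (\sum_i (N + (b + d.-1))%:R * I (P * (bvar C i * db i h))).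
    apply: eq_bigr => i _; rewrite (@I_dz (b + d.-1)) ?[bvar C i * _]mulrCA//.
    apply: whomM => //; rewrite -subn1 -[1%N](bwr i); exact: whom_mderiv.
  rewrite -mulr_sumr -I_sum -mulr_sumr (sum_bdb hd) -scalerAr I_scale mulrA.
  move: abcd; case: (d) => [|d'] abcd; first by rewrite !(mul0r, mulr0).
  by congr (_%:R * _ * _); lia.
rewrite mulrBr mulrBl -E1 -E2 -!I_sum -linearB; congr (I _).
rewrite -sumrB.
under eq_bigr do rewrite dbM dzM addrKA.
rewrite sumrB -mulr_suml -mulr_sumr -/(box h) h0 mulr0 subr0; congr (_ * _).
by apply: eq_bigr => i _; rewrite dz_db.
Qed.

(** By [I_box], [I (P * h)] is proportional to [I (box P * h)], with a factor that [a < d] makes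
    nonzero. Applying [box] preserves [a < d] and ends in 0. *)
Lemma I_low_degree a b c d P h : bihom a b P -> bihom c d h -> box h = 0 ->
  (a + c = b + d)%N -> (a < d)%N -> I (P * h) = 0.
Proof.
elim: a b P => [|a IH] b P Pab hcd h0 abcd ad.
  have := I_box Pab hcd h0 abcd.
  rewrite (bihom_box0 _ Pab) ?min0n// mul0r linear0 => /esym/eqP.
  rewrite !mulf_eq0 subr_eq0 !pnatr_eq0 eqr_nat.
  by case/orP => [/orP[]|] /eqP //; lia.
have := I_box Pab hcd h0 abcd.
suff -> : I (box P * h) = 0.
  move=> /esym/eqP; rewrite !mulf_eq0 subr_eq0 !pnatr_eq0 eqr_nat.
  by case/orP => [/orP[]|] /eqP //; lia.
case: b Pab abcd => [|b] Pab abcd.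
  by rewrite (bihom_box0 _ Pab) ?minn0// mul0r linear0.
by apply: (IH b) => //; [exact: (bihom_box Pab)|lia|lia].
Qed.

(** With [box P = 0], [I_box] says that the integral or its numerical factor is 0. The factor
    vanishes only if [a = d], hence [b = c], or if [N = 1] and all degrees are 0, which is again the
    excluded case. *)
Lemma I_orthogonal a b c d P h : bihom a b P -> bihom c d h -> box P = 0 ->
  box h = 0 -> (a, b) != (d, c) -> I (P * h) = 0.
Proof.
move=> Pab hcd P0 h0; have [abcd|] := eqVneq (a + c)%N (b + d)%N; last first.
  by move=> ne _; apply: I_unbalanced ne; exact: bihomM.
move=> ne; have := I_box Pab hcd h0 abcd.
rewrite P0 mul0r linear0 => /esym/eqP.
rewrite !mulf_eq0 subr_eq0 pnatr_eq0 eqr_nat => /orP[/orP[|]|] /eqP //.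
  move=> E; have [a0 c0] : a = 0%N /\ c = 0%N by lia.
  have [b0 d0] : b = 0%N /\ d = 0%N by lia.
  by rewrite a0 b0 c0 d0 eqxx in ne.
by move=> E; move: ne; rewrite xpair_eqE E eqxx /=; lia.
Qed.

(** Integration by parts: since [box h = 0], the sum over [i] of [I (db i h * bar (db i h))] is, by
    [I_dz] and Euler's identity, a positive multiple of [I (h * bar h)]. The derivatives have lower
    degree and are not all 0, so induction leads to constants and [I 1 = 1]. For [a > 0] the same is
    done with [dz] and [I_db]. *)
Lemma I_bar_gt0 a b h : bihom a b h -> box h = 0 -> h != 0 -> 0 < I (h * bar h).
Proof.
move: {2}(a + b)%N (erefl (a + b)%N) => s.
elim: s a b h => [|s IH] a b h abs hab h0 hn0.
  have hC : h = mpolyC _ (mcoeff mnm0 h).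
    apply/mpolyP => m; rewrite mcoeffC; case: eqP => [->|m0]; rewrite ?mulr1 ?mulr0//.
    apply: memN_msupp_eq0; apply/negP => /(proj1 (bihomP _ _ _) hab).
    have [-> ->] : a = 0%N /\ b = 0%N by lia.
    move=> [/eqP m1 /eqP m2]; apply: m0; apply/mnmP => v; rewrite mnm0E.
    move: m1 m2; rewrite !sum_nat_eq0 => /forallP m1 /forallP m2.
    rewrite -(splitK v); case: (fintype.split v) => i /=; apply/eqP.
      exact: (implyP (m1 i)).
    exact: (implyP (m2 i)).
  set x := mcoeff mnm0 h in hC.
  have x0 : x != 0 by apply: contraNneq hn0 => x0; rewrite hC x0 mpolyC0.
  have -> : h = x *: 1 by rewrite {1}hC -mpolyC1 -mul_mpolyC -mpolyCM mulr1.
  rewrite barZ rmorph1 -scalerAl mul1r scalerA I_scale I1 mulr1 -normCK.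
  by rewrite exprn_gt0// normr_gt0.
have pos (F : 'I_N -> mpoly (N + N) C) : (exists i, F i != 0) ->
    (forall i, F i != 0 -> 0 < I (F i * bar (F i))) ->
    0 < I (\sum_i F i * bar (F i)).
  move=> [i0 Fi0] Fpos; rewrite I_sum (bigD1 i0)//=.
  apply: ltr_wpDr; last exact: Fpos.
  apply: sumr_ge0 => i _; have [->|/Fpos/ltW//] := eqVneq (F i) 0.
  by rewrite mul0r linear0.
case: a hab abs => [|a] [ha hb] abs.
  case: b hb abs => // b hb abs.
  have ex : exists i, db i h != 0.
    apply/existsP; rewrite -negb_forall; apply: contra hn0 => /forallP dh.
    have := sum_bdb hb; rewrite big1 => [/esym/eqP|i _]; last first.
      by rewrite (eqP (dh i)) mulr0.
    by rewrite scaler_eq0 pnatr_eq0.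
  have /(pos (fun i => db i h) ex) : forall i, db i h != 0 ->
      0 < I (db i h * bar (db i h)).
    move=> i; apply: (IH 0%N b); [lia|exact: (bihom_db i (conj ha hb))|].
    by rewrite -db_box h0 linear0.
  suff -> : I (\sum_i db i h * bar (db i h)) = (N + b)%:R * b.+1%:R * I (h * bar h).
    by rewrite pmulr_rgt0// -natrM ltr0n muln_gt0 addn_gt0 N0.
  transitivity (I (\sum_i dz i (db i h * bar h))).
    congr (I _); under [RHS]eq_bigr do rewrite dzM.
    rewrite big_split /= -mulr_suml -/(box h) h0 mul0r add0r.
    by apply: eq_bigr => i _; rewrite bar_db.
  rewrite I_sum; transitivity (\sum_i (N + b)%:R * I (bvar C i * db i h * bar h)).
    apply: eq_bigr => i _ /=; rewrite (@I_dz b) ?mulrA// -[b]addn0.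
    apply: whomM; first exact: (bihom_db i (conj ha hb)).2.
    exact: (bar_bihom (conj ha hb)).2.
  by rewrite -mulr_sumr -I_sum -mulr_suml (sum_bdb hb) -scalerAl I_scale mulrA.
have ex : exists i, dz i h != 0.
  apply/existsP; rewrite -negb_forall; apply: contra hn0 => /forallP dh.
  have := sum_zdz ha; rewrite big1 => [/esym/eqP|i _]; last first.
    by rewrite (eqP (dh i)) mulr0.
  by rewrite scaler_eq0 pnatr_eq0.
have /(pos (fun i => dz i h) ex) : forall i, dz i h != 0 ->
    0 < I (dz i h * bar (dz i h)).
  move=> i; apply: (IH a b); [lia|exact: (bihom_dz i (conj ha hb))|].
  by rewrite -dz_box h0 linear0.
suff -> : I (\sum_i dz i h * bar (dz i h)) =
    (N + (a + b))%:R * a.+1%:R * I (h * bar h).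
  by rewrite pmulr_rgt0// -natrM ltr0n muln_gt0 addn_gt0 N0.
transitivity (I (\sum_i db i (dz i h * bar h))).
  congr (I _); under [RHS]eq_bigr do rewrite dbM.
  rewrite big_split /= -mulr_suml.
  rewrite (_ : \sum_i db i (dz i h) = 0); last first.
    by rewrite -[RHS]h0; apply: eq_bigr => i _; rewrite dz_db.
  by rewrite mul0r add0r; apply: eq_bigr => i _; rewrite bar_dz.
rewrite I_sum.
transitivity (\sum_i (N + (a + b))%:R * I (zvar C i * dz i h * bar h)).
  apply: eq_bigr => i _ /=; rewrite (@I_db (a + b)) ?mulrA//.
  apply: whomM; first exact: (bihom_dz i (conj ha hb)).1.
  exact: (bar_bihom (conj ha hb)).1.
by rewrite -mulr_sumr -I_sum -mulr_suml (sum_zdz ha) -scalerAl I_scale mulrA.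
Qed.

Lemma I_r2Xn j P : I (r2 C N ^+ j * P) = I P.
Proof. by elim: j => [|j IH]; rewrite ?expr0 ?mul1r// exprS -mulrA I_r2. Qed.

(** The powers of [r2] are invisible to [I], and all other components are orthogonal to a [g] of
    this bidegree. *)
Lemma I_component a b P (h : nat -> mpoly (N + N) C) j g :
  (forall j, box (h j) = 0) ->
  (forall j, (j <= minn a b)%N -> bihom (a - j) (b - j) (h j)) ->
  P = \sum_(j < (minn a b).+1) r2 C N ^+ j * h j ->
  (j <= minn a b)%N -> bihom (b - j) (a - j) g -> box g = 0 ->
  I (P * g) = I (h j * g).
Proof.
move=> h0 hab -> jab gab g0.
have jlt : (j < (minn a b).+1)%N by rewrite ltnS.
rewrite mulr_suml I_sum (bigD1 (Ordinal jlt)) //= -mulrA I_r2Xn.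
rewrite big1 ?addr0// => i ij; rewrite -mulrA I_r2Xn.
have iab : (i <= minn a b)%N by rewrite -ltnS.
apply: (I_orthogonal (hab _ iab) gab) => //.
have {}ij : nat_of_ord i != j by apply: contra ij => /eqP ij; apply/eqP/val_inj.
by rewrite xpair_eqE; lia.
Qed.

(** The test polynomial is [bar (h j)], with which a nonzero [h j] would pair positively. *)
Lemma component_eq0 a b P (h : nat -> mpoly (N + N) C) j :
  (forall j, box (h j) = 0) ->
  (forall j, (j <= minn a b)%N -> bihom (a - j) (b - j) (h j)) ->
  P = \sum_(j < (minn a b).+1) r2 C N ^+ j * h j ->
  (j <= minn a b)%N ->
  (forall g, bihom (b - j) (a - j) g -> box g = 0 -> I (P * g) = 0) ->
  h j = 0.
Proof.
move=> h0 hab hP jab Pg0; apply/eqP; apply/negPn/negP => hj.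
have := I_bar_gt0 (hab _ jab) (h0 j) hj.
rewrite -(I_component h0 hab hP jab) ?Pg0 ?ltxx//; try exact: bar_bihom (hab _ jab).
  by rewrite -bar_box h0 rmorph0.
by rewrite -bar_box h0 rmorph0.
Qed.

(* The [j]-th harmonic component of [P], of bidegree [(a - j, b - j)], is
   nonzero, as tested by duality ([component_eq0]). *)
Definition has_component a b j P :=
  [/\ (j <= a)%N, (j <= b)%N &
  exists g, [/\ bihom (b - j) (a - j) g, box g = 0 & I (P * g) != 0]].

(** The test polynomial is the conjugate of [iter j box P]. By [I_box] each [box] applied to [P]
    multiplies the pairing by a scalar; after [j] of them the pairing is positive, so it was nonzero
    at the start. *)
Lemma has_top_component a b j P : bihom a b P ->
  iter j box P != 0 -> box (iter j box P) = 0 -> has_component a b j P.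
Proof.
move=> Pab Pj0 boxPj.
have jab : (j <= minn a b)%N.
  by rewrite leqNgt; apply: contra Pj0 => /(iter_box0 Pab)/eqP.
have jPab := bihom_iter_box j Pab.
split; [lia|lia|exists (bar (iter j box P)); split].
- exact: bar_bihom.
- by rewrite -bar_box boxPj rmorph0.
have := I_bar_gt0 jPab boxPj Pj0; set g := bar _ => pos.
have gab : bihom (b - j) (a - j) g by exact: bar_bihom.
have g0 : box g = 0 by rewrite -bar_box boxPj rmorph0.
apply/eqP => Pg0; suff : I (iter j box P * g) = 0 by move=> E; rewrite E ltxx in pos.
elim: {1 3}j (leqnn j) => [//|i IH] ij.
rewrite iterS (I_box (bihom_iter_box i Pab) gab g0); last by lia.
by rewrite IH ?mulr0// ltnW.
Qed.

(** The variables for z and conj(z) are evaluated independently, at a point of the complex quadric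
    [r2 = 0]; there every component but the zeroth is multiplied by 0. *)
Lemma has_zeroth_component a b P (v : 'I_(N + N) -> C) : bihom a b P ->
  meval v (r2 C N) = 0 -> meval v P != 0 -> has_component a b 0 P.
Proof.
move=> Pab v0 Pv; split=> //.
have [h [h0 hab hP]] := harmonic_decomposition N0 Pab.
have hh : h 0%N != 0.
  apply: contraNneq Pv => E; rewrite hP raddf_sum; apply/eqP; apply: big1 => -[j jlt] _ /=.
  rewrite mevalM rmorphXn /= v0; case: j jlt => [|j] _; last by rewrite expr0n mul0r.
  by rewrite E meval0 mulr0.
have h00 := hab 0%N (leq0n _).
have bh : box (bar (h 0%N)) = 0 by rewrite -bar_box h0 rmorph0.
have bh0 := bar_bihom h00.
exists (bar (h 0%N)); split=> //.
by rewrite (I_component h0 hab hP (leq0n _) bh0 bh) gt_eqF// (I_bar_gt0 h00).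
Qed.

End InvariantFunctional.

(** * Monomials under the iterated complex Laplacian *)

Section Monomials.
Context (C : numClosedFieldType) (N : nat).
Implicit Types (al be : 'I_N -> nat) (i : 'I_N) (j : nat).

Definition zb_multinom al be : multinom (N + N) :=
  Multinom [tuple match fintype.split v with inl i => al i | inr i => be i end
           | v < N + N].

Lemma zb_multinoml al be i : zb_multinom al be (lshift N i) = al i.
Proof. by rewrite multinomE tnth_mktuple (unsplitK (inl i)). Qed.
Lemma zb_multinomr al be i : zb_multinom al be (rshift N i) = be i.
Proof. by rewrite multinomE tnth_mktuple (unsplitK (inr i)). Qed.

Lemma zb_multinomP (m m' : multinom (N + N)) :
  (forall i, m (lshift N i) = m' (lshift N i)) ->
  (forall i, m (rshift N i) = m' (rshift N i)) -> m = m'.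
Proof.
move=> ml mr; apply/mnmP => v; rewrite -(splitK v).
by case: (fintype.split v) => i /=; [exact: ml|exact: mr].
Qed.

Definition mono al be : mpoly (N + N) C := mpolyX C (zb_multinom al be).

Lemma mono_ext al be al' be' : al =1 al' -> be =1 be' ->
  mono al be = mono al' be'.
Proof.
by move=> ea eb; congr mpolyX; apply: zb_multinomP => i;
  rewrite ?zb_multinoml ?zb_multinomr ?ea ?eb.
Qed.

Lemma monoM al be al' be' : mono al be * mono al' be' =
  mono (fun i => al i + al' i)%N (fun i => be i + be' i)%N.
Proof.
rewrite /mono -mpolyXD; congr mpolyX; apply: zb_multinomP => i;
  by rewrite mnmDE ?zb_multinoml ?zb_multinomr.
Qed.

Lemma bihom_mono al be : bihom (\sum_i al i) (\sum_i be i) (mono al be).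
Proof.
apply/bihomP => m; rewrite /mono msuppX inE => /eqP ->.
by split; apply: eq_bigr => i _; rewrite ?zb_multinoml ?zb_multinomr.
Qed.

Definition lower al i : 'I_N -> nat := fun k => (al k - (k == i))%N.

Lemma box_mono al be : box (mono al be) =
  \sum_i (al i * be i)%:R *: mono (lower al i) (lower be i).
Proof.
apply: eq_bigr => i _; rewrite /mono /db mderivX zb_multinomr linearZ /=.
rewrite /dz mderivX scalerA mulrC mnmBE zb_multinoml mnm1E eq_rlshift subn0.
rewrite -natrM; congr (_ *: mpolyX _ _); apply: zb_multinomP => k.
  rewrite !mnmBE !mnm1E eq_rlshift (inj_eq (@lshift_inj _ _)) subn0.
  by rewrite !zb_multinoml /lower eq_sym.
rewrite !mnmBE !mnm1E eq_lrshift (inj_eq (@rshift_inj _ _)) subn0.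
by rewrite !zb_multinomr /lower eq_sym.
Qed.

(* The number of factors z_i conj(z_i), i.e. the largest power of [box] that
   does not kill the monomial. *)
Definition top al be := (\sum_i minn (al i) (be i))%N.

Lemma top_lower al be i : (0 < al i)%N -> (0 < be i)%N ->
  top al be = (top (lower al i) (lower be i)).+1.
Proof.
move=> ai bi; rewrite /top [in LHS](bigD1 i)//= [in RHS](bigD1 i)//=.
rewrite -addSn /lower eqxx; congr addn; first by lia.
by apply: eq_bigr => k ki; rewrite (negbTE ki) !subn0.
Qed.

Lemma iter_box_sum k (r : seq 'I_N) (F : 'I_N -> mpoly (N + N) C) :
  iter k box (\sum_(i <- r) F i) = \sum_(i <- r) iter k box (F i).
Proof. by elim: k => //= k ->; rewrite linear_sum. Qed.

Lemma iter_boxZ k c (P : mpoly (N + N) C) : iter k box (c *: P) = c *: iter k box P.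
Proof. by elim: k => //= k ->; rewrite linearZ. Qed.

Lemma iter_box_mono0 al be j : (top al be < j)%N -> iter j box (mono al be) = 0.
Proof.
elim: j al be => // j IH al be; rewrite ltnS => le_j.
rewrite iterSr box_mono iter_box_sum; apply: big1 => i _; rewrite iter_boxZ.
have [ai|ai] := posnP (al i); first by rewrite ai mul0n scale0r.
have [bi|bi] := posnP (be i); first by rewrite bi muln0 scale0r.
by rewrite IH ?scaler0//; move: le_j; rewrite (top_lower ai bi).
Qed.

(** Iterating [box] on a monomial creates no negative coefficient, so evaluation with all variables
    equal to 1 sees no cancellation. *)
Lemma iter_box_mono_neq0 al be : iter (top al be) box (mono al be) != 0.
Proof.
pose ev (P : mpoly (N + N) C) := meval (fun=> 1) P.
suff ev_gt0 : 0 < ev (iter (top al be) box (mono al be)).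
  by apply: contraTneq ev_gt0 => ->; rewrite /ev meval0 ltxx.
move: (erefl (top al be)); move: {2 3}(top al be) => j.
elim: j al be => [|j IH] al be topj.
  rewrite /= /ev /mono mevalX; apply: prodr_gt0 => i _.
  by rewrite expr1n ltr01.
rewrite iterSr box_mono iter_box_sum /ev raddf_sum /=.
have [i /andP[ai bi]] : exists i, (0 < al i)%N && (0 < be i)%N.
  apply/existsP; rewrite -[X in is_true X]negbK negb_exists; apply/negP => /forallP ab0.
  by move: topj; rewrite /top big1// => i _; have := ab0 i; rewrite negb_and; lia.
have ev_gt0 k : (0 < al k)%N -> (0 < be k)%N -> 0 < meval (fun=> 1)
    (iter j box ((al k * be k)%:R *: mono (lower al k) (lower be k))) :> C.
  move=> ak bk; rewrite iter_boxZ mevalZ mulr_gt0 ?ltr0n ?muln_gt0 ?ak//.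
  by rewrite IH//; move: topj; rewrite (top_lower ak bk) => -[].
rewrite (bigD1 i)//= ltr_wpDr ?ev_gt0//; apply: sumr_ge0 => k _.
have [ak|ak] := posnP (al k); first by rewrite ak iter_boxZ scale0r meval0.
have [bk|bk] := posnP (be k); first by rewrite bk muln0 iter_boxZ scale0r meval0.
exact/ltW/ev_gt0.
Qed.
End Monomials.

(** * Harmonic components of products *)

Section Coupling.
Context (C : numClosedFieldType) (N : nat) (I : {linear mpoly (N + N) C -> C^o}).
Implicit Types (P Q h g f : mpoly (N + N) C) (a b c d j p q r s : nat).
Hypothesis N0 : (0 < N)%N.
Hypothesis I_inv : forall i (j : 'I_N) P,
  I (zvar C i * dz j P - bvar C j * db i P) = 0.
Hypothesis I_r2 : forall P, I (r2 C N * P) = I P.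
Hypothesis I1 : I 1 = 1.

Definition hbihom a b P := bihom a b P /\ box P = 0.

Definition coupled a b c d j := exists f g,
  [/\ hbihom a b f, hbihom c d g & has_component I (a + c) (b + d) j (f * g)].

Lemma hbihom_mono (al be : 'I_N -> nat) a b :
  (\sum_i al i = a)%N -> (\sum_i be i = b)%N -> top al be = 0%N ->
  hbihom a b (mono C al be).
Proof.
move=> <- <- t0; split; first exact: bihom_mono.
by have /= := @iter_box_mono0 C N al be 1; apply; rewrite t0.
Qed.

Lemma coupled_mono (al be al' be' : 'I_N -> nat) a b c d j :
  (\sum_i al i = a)%N -> (\sum_i be i = b)%N -> top al be = 0%N ->
  (\sum_i al' i = c)%N -> (\sum_i be' i = d)%N -> top al' be' = 0%N ->
  top (fun i => al i + al' i)%N (fun i => be i + be' i)%N = j ->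
  coupled a b c d j.
Proof.
move=> ala beb t0 alc bed t0' tj.
have hf := hbihom_mono ala beb t0; have hg := hbihom_mono alc bed t0'.
exists (mono C al be), (mono C al' be'); split=> //; rewrite monoM.
apply: (has_top_component N0 I_inv I_r2 I1).
- by rewrite -monoM; apply: bihomM; [exact: hf.1|exact: hg.1].
- by rewrite -tj; exact: iter_box_mono_neq0.
- by rewrite -iterS; apply: iter_box_mono0; rewrite tj.
Qed.

Definition at1 (i : 'I_N) a : 'I_N -> nat := fun k => if k == i then a else 0%N.

Lemma sum_at1 i a : (\sum_k at1 i a k = a)%N.
Proof.
by rewrite (bigD1 i)//= /at1 eqxx big1 ?addn0// => k /negbTE ->.
Qed.

Lemma sum_at2 i k a b : (\sum_l (at1 i a l + at1 k b l) = a + b)%N.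
Proof. by rewrite big_split /= !sum_at1. Qed.

(** The first factor is always z_0^r conj(z_1)^s. Up to [minn r q] pairs are formed at [i0] with
    conj(z_0) from the second factor, the others at [i1] with z_1 from it; its powers of z_2 take up
    the remaining degree in z without forming pairs. *)
Lemma coupled_dim3 (i0 i1 i2 : 'I_N) r s p q j :
  i0 != i1 -> i1 != i2 -> i0 != i2 ->
  (j <= minn r q + minn p s)%N -> coupled r s p q j.
Proof.
move=> i01 i12 i02 jrs.
have [jrq|jrq] := leqP j (minn r q).
  apply: (@coupled_mono (at1 i0 r) (at1 i1 s) (at1 i2 p)
    (fun l => at1 i0 j l + at1 i1 (q - j) l)%N);
    rewrite ?sum_at1 ?sum_at2//; [|by lia| |].
  - by rewrite /top big1// => k _; rewrite /at1;
      do !(case: eqP => ?; subst); rewrite ?eqxx in i01 i12 i02 *; lia.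
  - by rewrite /top big1// => k _; rewrite /at1;
      do !(case: eqP => ?; subst); rewrite ?eqxx in i01 i12 i02 *; lia.
  - rewrite /top -[RHS](sum_at1 i0 j); apply: eq_bigr => k _; rewrite /at1;
      do !(case: eqP => ?; subst); rewrite ?eqxx in i01 i12 i02 *; lia.
pose b := (j - minn r q)%N.
apply: (@coupled_mono (at1 i0 r) (at1 i1 s)
    (fun l => at1 i1 b l + at1 i2 (p - b) l)%N (at1 i0 q));
    rewrite ?sum_at1 ?sum_at2//; [|by lia| |].
- by rewrite /top big1// => k _; rewrite /at1;
    do !(case: eqP => ?; subst); rewrite ?eqxx in i01 i12 i02 *; lia.
- by rewrite /top big1// => k _; rewrite /at1;
    do !(case: eqP => ?; subst); rewrite ?eqxx in i01 i12 i02 *; lia.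
- have -> : j = (minn r q + b)%N by lia.
  rewrite /top -[RHS](sum_at2 i0 i1); apply: eq_bigr => k _; rewrite /at1;
    do !(case: eqP => ?; subst); rewrite ?eqxx in i01 i12 i02 *; lia.
Qed.

End Coupling.

(** * Components of products in dimension two *)

Section DimensionTwo.
Context (C : numClosedFieldType) (I : {linear mpoly (2 + 2) C -> C^o}).
Implicit Types (P Q h g f : mpoly (2 + 2) C) (a b c d j p q r s : nat).
Hypothesis I_inv : forall i (j : 'I_2) P,
  I (zvar C i * dz j P - bvar C j * db i P) = 0.
Hypothesis I_r2 : forall P, I (r2 C 2 * P) = I P.
Hypothesis I1 : I 1 = 1.

Definition pair2 a b : 'I_2 -> nat := fun i => if i == ord0 then a else b.

(* z_1^a z_2^b conj(z_1)^c conj(z_2)^d *)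
Definition mono2 a b c d : mpoly (2 + 2) C := mono C (pair2 a b) (pair2 c d).

Lemma sum_pair2 a b : (\sum_i pair2 a b i = a + b)%N.
Proof. by rewrite !big_ord_recl big_ord0 addn0. Qed.

Lemma top_pair2 a b c d : top (pair2 a b) (pair2 c d) = (minn a c + minn b d)%N.
Proof. by rewrite /top !big_ord_recl big_ord0 addn0. Qed.

Lemma mono2M a b c d a' b' c' d' : mono2 a b c d * mono2 a' b' c' d' =
  mono2 (a + a') (b + b') (c + c') (d + d').
Proof.
by rewrite /mono2 monoM; apply: mono_ext => i; rewrite /pair2; case: eqP.
Qed.

Lemma box_mono2 a b c d : box (mono2 a b c d) =
  (a * c)%:R *: mono2 a.-1 b c.-1 d + (b * d)%:R *: mono2 a b.-1 c d.-1.
Proof.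
rewrite /mono2 box_mono !big_ord_recl big_ord0 addr0 /=.
by congr (_ *: _ + _ *: _); apply: mono_ext => i; rewrite /lower /pair2;
  case: (unliftP ord0 i) => [k|] ->; rewrite ?ord1 //= ?subn0 ?subn1.
Qed.

Lemma bihom_mono2 a b c d : bihom (a + b) (c + d) (mono2 a b c d).
Proof. by rewrite -!sum_pair2; exact: bihom_mono. Qed.

Lemma r2_mono2 : r2 C 2 = mono2 1 0 1 0 + mono2 0 1 0 1.
Proof.
rewrite /r2 !big_ord_recl big_ord0 addr0 /zvar /bvar /mono2 /mono -!mpolyXD.
by congr (mpolyX _ _ + mpolyX _ _); apply: zb_multinomP => i;
  rewrite mnmDE !mnm1E ?zb_multinoml ?zb_multinomr ?eq_rlshift ?eq_lrshift
    ?(inj_eq (@lshift_inj _ _)) ?(inj_eq (@rshift_inj _ _)) /pair2;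
  case: (unliftP ord0 i) => [k|] ->; rewrite ?ord1.
Qed.

Lemma r2M_mono2 a b c d : r2 C 2 * mono2 a b c d =
  mono2 a.+1 b c.+1 d + mono2 a b.+1 c d.+1.
Proof. by rewrite r2_mono2 mulrDl !mono2M. Qed.

Lemma coupled_mono2 a b c d a' b' c' d' r s p q j :
  (a + b = r)%N -> (c + d = s)%N -> (minn a c + minn b d = 0)%N ->
  (a' + b' = p)%N -> (c' + d' = q)%N -> (minn a' c' + minn b' d' = 0)%N ->
  (minn (a + a') (c + c') + minn (b + b') (d + d') = j)%N ->
  coupled I r s p q j.
Proof.
move=> *; apply: (@coupled_mono C 2 I isT I_inv I_r2 I1 (pair2 a b) (pair2 c d)
  (pair2 a' b') (pair2 c' d')) => //; rewrite ?sum_pair2 ?top_pair2//.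
by rewrite /top !big_ord_recl big_ord0 addn0.
Qed.

Lemma coupled_zero r s p q : coupled I r s p q 0.
Proof.
by apply: (@coupled_mono2 r 0 0 s p 0 0 q) => //; lia.
Qed.

(** Take z_1^j z_2^(r-j) and z_2^p conj(z_1)^q: as the first factor contains no conjugates, the
    number of pairs can be chosen freely. *)
Lemma coupled_holomorphic r p q j : (j <= minn r q)%N -> coupled I r 0 p q j.
Proof.
by move=> jrq; apply: (@coupled_mono2 j (r - j) 0 0 0 p q 0) => //; lia.
Qed.

Lemma coupled_max r s p q : coupled I r s p q (minn r q + minn p s).
Proof.
by apply: (@coupled_mono2 r 0 0 s 0 p q 0) => //; lia.
Qed.

(* The image of z_1^p conj(z_2)^q under the lowering operator of sl_2. *)
Definition lowered p q : mpoly (2 + 2) C :=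
  p%:R *: mono2 p.-1 1 0 q - q%:R *: mono2 p 0 1 q.-1.

Lemma hbihom_lowered p q : hbihom p q (lowered p q).
Proof.
split.
  have hp : bihom p q (p%:R *: mono2 p.-1 1 0 q).
    case: (p) => [|p']; first by rewrite scale0r; exact: bihom0.
    by apply: bihomZ; have := bihom_mono2 p' 1 0 q; rewrite addn1.
  have hq : bihom p q (q%:R *: mono2 p 0 1 q.-1).
    case: (q) => [|q']; first by rewrite scale0r; exact: bihom0.
    by apply: bihomZ; have := bihom_mono2 p 0 1 q'; rewrite addn0.
  exact: bihomB.
rewrite /lowered boxB !boxZ !box_mono2 /=.
rewrite !(muln0, mul0n, mul1n, muln1, scale0r, add0r, addr0).
by rewrite !scalerA mulrC subrr.
Qed.

Lemma hbihom_corner p q : hbihom p q (mono2 p 0 0 q).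
Proof.
split; first by have := bihom_mono2 p 0 0 q; rewrite addn0.
by rewrite box_mono2 muln0 mul0n !scale0r addr0.
Qed.

Lemma hbihom_corner' p q : hbihom p q (mono2 0 p q 0).
Proof.
split; first by have := bihom_mono2 0 p q 0; rewrite addn0.
by rewrite box_mono2 muln0 mul0n !scale0r addr0.
Qed.

Lemma mono2_neq0 a b c d : mono2 a b c d != 0.
Proof.
apply/eqP => /(congr1 (mcoeff (zb_multinom (pair2 a b) (pair2 c d)))).
by move/eqP; rewrite mcoeffX eqxx mcoeff0 oner_eq0.
Qed.

Lemma coupled_one r s p q : (r * q != p * s)%N -> coupled I r s p q 1.
Proof.
move=> rqps; exists (mono2 r 0 0 s), (lowered p q).
have hf := hbihom_corner r s; have hg := hbihom_lowered p q; split=> //.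
(* The terms [p q] cancel, so [D] is [p s - q r], nonzero by hypothesis. *)
pose D : C := (p * (s + q))%:R - (q * (r + p))%:R.
have E : box (mono2 r 0 0 s * lowered p q) = D *: mono2 (r + p).-1 0 0 (s + q).-1.
  rewrite /lowered mulrBr -!scalerAr !mono2M !addn0 !add0n boxB !boxZ.
  rewrite !box_mono2 !(muln0, mul0n, mul1n, muln1, scale0r, add0r, addr0).
  rewrite !scalerA -!natrM.
  rewrite /D scalerBl; congr (_ - _).
    case: (p) => [|p']; first by rewrite mul0n !scale0r.
    by congr (_ *: mono2 _ _ _ _); lia.
  case: (q) => [|q']; first by rewrite mul0n !scale0r.
  by congr (_ *: mono2 _ _ _ _); lia.
apply: (@has_top_component C 2 I isT I_inv I_r2 I1).
- by apply: bihomM; [exact: hf.1|exact: hg.1].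
- rewrite /= E scaler_eq0 (negbTE (mono2_neq0 _ _ _ _)) orbF subr_eq0 eqr_nat.
  by lia.
- by rewrite /= E boxZ box_mono2 muln0 mul0n !scale0r addr0 scaler0.
Qed.

(** One term survives in the binomial expansion of a power of two commuting operators: dz_1 db_1
    taken [a] times and dz_2 db_2 taken [d] times. The derivatives of z_1^a and conj(z_2)^d give
    [a!] and [d!], which cancel the denominator of the binomial coefficient. *)
Lemma iter_box_mono2 a b c d : (a <= c)%N -> (d <= b)%N ->
  iter (a + d) box (mono2 a b c d) =
  ((a + d)`! * c ^_ a * b ^_ d)%:R *: mono2 0 (b - d) (c - a) 0.
Proof.
move: {1 3}(a + d)%N (erefl (a + d)%N) => k.
elim: k a b c d => [|k IH] a b c d kad ac db.
  have [-> ->] : a = 0%N /\ d = 0%N by lia.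
  by rewrite /= !subn0 !ffactn0 scale1r.
rewrite iterSr box_mono2.
have iterDZ x y P Q : iter k (@box C 2) (x *: P + y *: Q) =
    x *: iter k box P + y *: iter k box Q.
  by elim: (k) => //= k' ->; rewrite linearP linearZ.
rewrite iterDZ.
case: a ac kad => [|a] ac kad.
  case: d db kad => [|d] db kad //; case: b db => [//|b] db.
  rewrite mul0n scale0r add0r /= IH//; last by lia.
  rewrite !ffactn0 !muln1 !subn0 subSS scalerA -natrM ffactSS.
  by rewrite !add0n factS; congr (_%:R *: _); nia.
case: c ac => [//|c] ac; rewrite /= IH//; last by lia.
case: d db kad => [|d] db kad.
  rewrite !muln0 scale0r addr0 !ffactn0 !muln1 subSS scalerA -natrM ffactSS.
  by rewrite !addn0 factS; congr (_%:R *: _); nia.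
case: b db => [//|b] db; rewrite /= IH//; last by lia.
rewrite !scalerA -!natrM !subSS -scalerDl -natrD.
rewrite !ffactSS; congr (_%:R *: _); rewrite !addSn !addnS.
have -> : ((a + d).+2`! = (a + d).+2 * (a + d).+1`!)%N by [].
by set F := ((a + d).+1`!)%N; nia.
Qed.

(** This is the index just below that of [coupled_max], reached by lowering one factor. After
    [r + s + 1] applications of [box] both terms of the product are multiples of the same monomial,
    with coefficients in the ratio of [(r + 1) (p + 1)] to [(s + 1) (q + 1)]; the strict inequality
    prevents cancellation. *)
Lemma coupled_max_pred r s p q : (r.+1 <= q)%N -> (s.+1 <= p)%N ->
  (s.+1 * q.+1 < r.+1 * p.+1)%N -> coupled I r.+1 s.+1 p q (r + s).+1.
Proof.
move=> rq sp srpq; exists (lowered r.+1 s.+1), (mono2 0 p q 0).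
have hf := hbihom_lowered r.+1 s.+1; have hg := hbihom_corner' p q; split=> //.
pose c1 := ((r + s.+1)`! * q ^_ r * p.+1 ^_ s.+1)%N.
pose c2 := ((r.+1 + s)`! * q.+1 ^_ r.+1 * p ^_ s)%N.
pose D : C := (r.+1 * c1)%:R - (s.+1 * c2)%:R.
have D0 : D != 0.
  rewrite subr_eq0 eqr_nat /c1 /c2 !ffactSS addSnnS.
  have : (0 < (r + s.+1)`!)%N by exact: fact_gt0.
  have : (0 < q ^_ r)%N by rewrite ffact_gt0; lia.
  have : (0 < p ^_ s)%N by rewrite ffact_gt0; lia.
  set F := ((r + s.+1)`!)%N; set X := (q ^_ r)%N; set Y := (p ^_ s)%N => X0 Y0 F0.
  have FXY : (0 < F * X * Y)%N by rewrite !muln_gt0 X0 Y0 F0.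
  have -> : (r.+1 * (F * X * (p.+1 * Y)) = (r.+1 * p.+1) * (F * X * Y))%N by nia.
  have -> : (s.+1 * (F * (q.+1 * X) * Y) = (s.+1 * q.+1) * (F * X * Y))%N by nia.
  by rewrite eqn_pmul2r// neq_ltn srpq orbT.
have E : iter (r + s).+1 box (lowered r.+1 s.+1 * mono2 0 p q 0) =
    D *: mono2 0 (p - s) (q - r) 0.
  rewrite /lowered mulrBl -!scalerAl !mono2M !addn0 !add0n !succnK add1n.
  have iterB k P Q : iter k (@box C 2) (P - Q) = iter k box P - iter k box Q.
    by elim: k => //= k ->; rewrite boxB.
  rewrite iterB !iter_boxZ /D scalerBl (natrM _ r.+1) (natrM _ s.+1) -!scalerA; congr (_ *: _ - _ *: _).
    have -> : (r + s).+1 = (r + s.+1)%N by lia.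
    by rewrite iter_box_mono2 ?subSS//; lia.
  have -> : (r + s).+1 = (r.+1 + s)%N by lia.
  by rewrite iter_box_mono2 ?subSS//; lia.
apply: (@has_top_component C 2 I isT I_inv I_r2 I1).
- by apply: bihomM; [exact: hf.1|exact: hg.1].
- by rewrite E scaler_eq0 (negbTE D0) (negbTE (mono2_neq0 _ _ _ _)).
- by rewrite E boxZ box_mono2 muln0 mul0n !scale0r addr0 scaler0.
Qed.

(** As [I] ignores [r2], this reduces the component of index [j] to that of index [j - 2] for
    [p - 1] and [q - 1]; the even and the odd case both rest on it. *)
Lemma box_mono2_ppqq p q : box (mono2 p p q q) =
  (p * q)%:R *: (r2 C 2 * mono2 p.-1 p.-1 q.-1 q.-1).
Proof.
case: p => [|p]; first by rewrite box_mono2 mul0n !scale0r addr0.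
case: q => [|q]; first by rewrite box_mono2 muln0 !scale0r addr0.
by rewrite box_mono2 r2M_mono2 -scalerDr addrC.
Qed.

Lemma has_even_component p q j : (q <= p)%N -> (j <= q)%N ->
  has_component I (p + p) (q + q) j.*2 (mono2 p p q q).
Proof.
elim: j p q => [|j IH] p q qp jq.
  (* A zero of [r2]: the variables z are set to (1, 1) and the variables conj(z) to (1, -1), so that
     the monomial does not vanish. *)
  pose v (k : 'I_(2 + 2)) : C := if k == rshift 2 1 then -1 else 1.
  apply: (@has_zeroth_component C 2 I isT I_inv I_r2 I1 _ _ _ v).
  - exact: bihom_mono2.
  - rewrite /r2 !big_ord_recl big_ord0 addr0 /zvar /bvar mevalD !mevalM !mevalXU.
    rewrite /v !eq_lrshift !(inj_eq (@rshift_inj _ _)) /=.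
    by rewrite !mul1r subrr.
  - rewrite /mono2 /mono mevalX; apply/prodf_neq0 => i _; rewrite expf_neq0//.
    by rewrite /v; case: ifP; rewrite ?oppr_eq0 oner_eq0.
case: q qp jq => // q qp jq; case: p qp => // p qp.
have [_ _ [g [gab g0 Ig]]] := IH p q qp jq.
split; [lia|lia|exists g; split=> //].
  by move: gab; congr bihom; lia.
have gab' : bihom (q.+1 + q.+1 - j.+1.*2) (p.+1 + p.+1 - j.+1.*2) g.
  by move: gab; congr bihom; lia.
apply: contra Ig => /eqP Pg0.
have := @I_box C 2 I isT I_inv I_r2 _ _ _ _ _ _ (bihom_mono2 p.+1 p.+1 q.+1 q.+1) gab' g0.
rewrite Pg0 mulr0 box_mono2_ppqq -scalerAl -(mulrA (r2 C 2)) I_scale I_r2 /= => E.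
have /eqP := E ltac:(lia).
by rewrite mulf_eq0 pnatr_eq0.
Qed.

Lemma coupled_even p q j : (q <= p)%N -> (j <= q)%N -> coupled I p q p q j.*2.
Proof.
move=> qp jq; exists (mono2 p 0 0 q), (mono2 0 p q 0); split.
- exact: hbihom_corner.
- exact: hbihom_corner'.
- by rewrite mono2M !addn0; exact: has_even_component.
Qed.

Lemma odd_component_eq0 p q j h : odd j -> (j <= q + q)%N -> (q <= p)%N ->
  hbihom (q + q - j) (p + p - j) h -> I (mono2 p p q q * h) = 0.
Proof.
elim: q p j h => [|q IH] p j h oj jq qp [hh h0]; first by case: j oj jq hh.
case: p qp hh => // p qp hh.
have := @I_box C 2 I isT I_inv I_r2 _ _ _ _ _ _ (bihom_mono2 p.+1 p.+1 q.+1 q.+1) hh h0.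
rewrite box_mono2_ppqq -scalerAl -(mulrA (r2 C 2)) I_scale I_r2 /=.
suff -> : I (mono2 p p q q * h) = 0.
  rewrite mulr0 => /(_ ltac:(lia))/esym/eqP.
  rewrite !mulf_eq0 subr_eq0 pnatr_eq0 eqr_nat => /orP[/orP[|]|] /eqP // E; exfalso;
    by have := odd_gt0 oj; lia.
case: j oj jq hh => [//|[_ jq hh|j oj jq hh]].
  (* For [j = 1] the lowered monomial has degree [2 p] in z, one less than the degree of [h] in
     conj(z). *)
  by apply: (@I_low_degree C 2 I isT I_inv I_r2 _ _ _ _ _ _ (bihom_mono2 p p q q) hh h0); lia.
apply: (IH p j); rewrite ?negbK//; [by move: oj; rewrite /= negbK|lia|].
by split=> //; move: hh; congr bihom; lia.
Qed.

(** Proportionality gives the two terms of [box] the same coefficient, so they combine into a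
    multiple of [r2] times a monomial whose degree is too low for [h]. *)
Lemma first_component_eq0 p1 q1 p2 q2 h : (p1 * q2 = p2 * q1)%N ->
  (0 < q1 + q2)%N -> (0 < p1 + p2)%N ->
  hbihom (q1 + q2 - 1) (p1 + p2 - 1) h -> I (mono2 p1 p2 q2 q1 * h) = 0.
Proof.
move=> E q0 p0 [hh h0].
have cond : (p1 + p2 + (q1 + q2 - 1) = q2 + q1 + (p1 + p2 - 1))%N by lia.
have := @I_box C 2 I isT I_inv I_r2 _ _ _ _ _ _ (bihom_mono2 p1 p2 q2 q1) hh h0 cond.
suff -> : I (box (mono2 p1 p2 q2 q1) * h) = 0.
  move=> /esym/eqP; rewrite !mulf_eq0 subr_eq0 pnatr_eq0 eqr_nat.
  by move=> /orP[/orP[|]|] /eqP // ?; exfalso; lia.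
rewrite box_mono2 E {cond}; case: p2 E p0 hh => [|p2] E p0 hh.
  by rewrite mul0n !scale0r addr0 mul0r linear0.
case: q1 E q0 hh => [|q1] E q0 hh.
  by rewrite muln0 !scale0r addr0 mul0r linear0.
case: p1 E p0 hh => [|p1] E p0 hh; first by exfalso; nia.
case: q2 E q0 hh => [|q2] E q0 hh; first by exfalso; nia.
rewrite /= -scalerDr [_ + mono2 _ _ _ _]addrC -r2M_mono2 -scalerAl -(mulrA (r2 C 2)) I_scale I_r2.
rewrite (@I_low_degree C 2 I isT I_inv I_r2 _ _ _ _ _ _ (bihom_mono2 p1 p2 q2 q1) hh h0) ?mulr0//; lia.
Qed.

End DimensionTwo.

(** * Vanishing components in dimension two *)

Section Weights.
Context (C : numFieldType) (k : nat).
Implicit Types (P : mpoly k C) (w : 'I_k -> nat) (a : nat).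

Definition weight_part w a P : mpoly k C :=
  \sum_(m <- msupp P | weight w m == a) mcoeff m P *: mpolyX C m.

Lemma mcoeff_weight_part w a P m :
  mcoeff m (weight_part w a P) = (weight w m == a)%:R * mcoeff m P.
Proof.
rewrite /weight_part (raddf_sum (mcoeff m)) /=.
rewrite (eq_bigr (fun m' => mcoeff m' P * (m' == m)%:R)); last first.
  by move=> m' _; rewrite mcoeffZ mcoeffX.
have [mP|mP] := boolP (m \in msupp P); last first.
  rewrite (memN_msupp_eq0 mP) mulr0 big_seq_cond; apply: big1 => m' /andP[m'P _].
  by case: eqP m'P => [->|_]; rewrite ?(negbTE mP)// mulr0.
rewrite big_mkcond (bigD1_seq m) ?msupp_uniq//= eqxx mulr1 big1_seq ?addr0.
  by case: eqP; rewrite ?mul1r ?mul0r.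
by move=> m' /andP[m'm _]; rewrite (negbTE m'm) mulr0 if_same.
Qed.

Lemma whom_weight_part w a P : whom w a (weight_part w a P).
Proof.
apply/mpolyP => m; rewrite mcoeff_euler mcoeffZ mcoeff_weight_part.
by case: eqP => [->//|_]; rewrite mul0r !mulr0.
Qed.

Lemma whom_weight_part2 w w' a b P : whom w b P -> whom w b (weight_part w' a P).
Proof.
rewrite /whom => Pb; apply/mpolyP => m; have := congr1 (mcoeff m) Pb.
rewrite !mcoeff_euler !mcoeffZ mcoeff_weight_part => E.
by rewrite mulrCA E mulrCA.
Qed.

Lemma sum_weight_part w P :
  P = \sum_(a < (\max_(m <- msupp P) weight w m).+1) weight_part w a P.
Proof.
apply/mpolyP => m; rewrite (raddf_sum (mcoeff m)) /=.
rewrite (eq_bigr (fun a : 'I__ => (weight w m == a)%:R * mcoeff m P)); last first.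
  by move=> a _; rewrite mcoeff_weight_part.
rewrite -mulr_suml; have [mP|/memN_msupp_eq0->] := boolP (m \in msupp P); last first.
  by rewrite mulr0.
have mlt : (weight w m < (\max_(m <- msupp P) weight w m).+1)%N.
  by rewrite ltnS (big_rem m mP) /= leq_maxl.
rewrite (bigD1 (Ordinal mlt))//= eqxx big1 ?addr0 ?mul1r// => i.
by rewrite -val_eqE /= eq_sym => /negbTE ->.
Qed.

End Weights.

Section DimensionTwoVanishing.
Context (C : numClosedFieldType).
Implicit Types (P Q h g f : mpoly (2 + 2) C) (i j : 'I_2) (a b c d p q r s : nat).

Definition rot i j P := zvar C i * dz j P - bvar C j * db i P.

Lemma rotM i j P Q : rot i j (P * Q) = rot i j P * Q + P * rot i j Q.
Proof. by rewrite /rot dzM dbM; ring. Qed.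

Lemma box_rot i j P : box (rot i j P) = rot i j (box P).
Proof.
rewrite /rot boxB box_zvarM box_bvarM -dz_box -db_box -(dz_db j i).
by rewrite opprD addrACA subrr addr0.
Qed.

Lemma bihom_rot i j a b P : bihom a b P -> bihom a b (rot i j P).
Proof.
move=> Pab; apply: bihomB.
  case: a Pab => [|a] Pab; first by rewrite (bihom_dz0 _ Pab) mulr0; exact: bihom0.
  exact: (bihomM (bihom_zvar C i) (bihom_dz j Pab)).
case: b Pab => [|b] Pab; first by rewrite (bihom_db0 _ Pab) mulr0; exact: bihom0.
exact: (bihomM (bihom_bvar C j) (bihom_db i Pab)).
Qed.

Lemma hbihom_rot i j a b P : hbihom a b P -> hbihom a b (rot i j P).
Proof. by move=> [Pab P0]; split; [exact: bihom_rot|rewrite box_rot P0 /rot !linear0 !mulr0 subrr]. Qed.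

(* The weight of the torus acting on the [i]-th basis vector of C^2, for which
   conj(z_j), [j != i], transforms like z_i. *)
Definition wi i (v : 'I_(2 + 2)) : nat :=
  match fintype.split v with inl k => (k == i) | inr k => (k != i) end.

Lemma wil i k : wi i (lshift 2 k) = (k == i).
Proof. by rewrite /wi (unsplitK (inl k)). Qed.
Lemma wir i k : wi i (rshift 2 k) = (k != i).
Proof. by rewrite /wi (unsplitK (inr k)). Qed.

Lemma sum_I2 (V : nmodType) i j (F : 'I_2 -> V) : i != j -> \sum_k F k = F i + F j.
Proof.
move=> ij; rewrite (bigD1 i)//= (bigD1 j) ?[j == i]eq_sym//= big1 ?addr0//.
move=> k /andP[ki kj]; exfalso; move: ij ki kj.
by rewrite -!val_eqE /=; case: i j k => [[|[]]//= ?] [[|[]]//= ?] [[|[]]//= ?].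
Qed.

Lemma sum_I2n i j (F : 'I_2 -> nat) : i != j -> (\sum_k F k)%N = (F i + F j)%N.
Proof. exact: sum_I2. Qed.

Lemma euler_wi i j P : i != j ->
  euler (wi i) P = zvar C i * dz i P + bvar C j * db j P.
Proof.
move=> ij; rewrite /euler big_split_ord /= !(sum_I2 _ ij) !wil !wir !eqxx /=.
by rewrite eq_sym (negbTE ij) /= !scale0r !scale1r addr0 add0r.
Qed.

(** The product z_k conj(z_k) has weight 1 for both values of [k], so [box] lowers every weight by
    exactly 1 and keeps the weight parts apart. *)
Lemma box_weight_part i a P : box P = 0 -> box (weight_part (wi i) a P) = 0.
Proof.
move=> P0; apply/mpolyP => m; rewrite mcoeff0.
have E Q : mcoeff m (box Q) = \sum_k mcoeff
    (mnm_add (mnm_add m (mnm1 (lshift 2 k))) (mnm1 (rshift 2 k))) Q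
    *+ ((mnm_add m (mnm1 (lshift 2 k)) (rshift 2 k)).+1 * (m (lshift 2 k)).+1).
  rewrite /box (raddf_sum (mcoeff m)) /=; apply: eq_bigr => k _.
  by rewrite /dz /db !mcoeff_mderiv mulrnA.
have wk k : weight (wi i) (mnm_add (mnm_add m (mnm1 (lshift 2 k))) (mnm1 (rshift 2 k)))
    = (weight (wi i) m).+1.
  have wD m1 m2 : weight (wi i) (mnm_add m1 m2) = (weight (wi i) m1 + weight (wi i) m2)%N.
    rewrite /weight -big_split /=; apply: eq_bigr => v _.
    by rewrite mnmDE mulnDr.
  by rewrite !wD !weightU wil wir; case: (k == i); rewrite /= ?addn0 ?addn1.
rewrite E; under eq_bigr do rewrite mcoeff_weight_part wk -mulrnAr.
by rewrite -mulr_sumr -E P0 mcoeff0 mulr0.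
Qed.

(* Capelli's identity for the matrix with columns (z_i, z_j) and
   (conj(z_j), - conj(z_i)), whose determinant is |z|^2 up to sign. *)
Lemma capelli i j P : i != j -> rot i j (rot j i P) =
  euler (wi i) (euler (wi j) P) + euler (wi i) P - r2 C 2 * box P.
Proof.
move=> ij; have ji : j != i by rewrite eq_sym.
rewrite !(euler_wi _ ij) !(euler_wi _ ji) /rot /r2 /box !(sum_I2 _ ij).
rewrite dzB dbB dzD dbD !dzM !dbM.
rewrite !(dz_zvar, dz_bvar, db_zvar, db_bvar) !eqxx (negbTE ij) (negbTE ji).
rewrite (dz_dz i j P) (db_db i j P) -(dz_db i i P) -(dz_db j j P).
move: (dz j (dz i P)) (db j (db i P)) (dz i (db i P)) (dz j (db j P)).
move: (dz i P) (db i P) (dz j P) (db j P) => a b c d x y z t.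
by rewrite !(mul0r, mul1r); ring.
Qed.

Lemma euler_wi_add i j a b P : i != j -> bihom a b P ->
  euler (wi i) P + euler (wi j) P = (a + b)%:R *: P.
Proof.
move=> ij [Pa Pb]; rewrite natrD scalerDl -(sum_zdz Pa) -(sum_bdb Pb).
rewrite (euler_wi _ ij) (@euler_wi j i) 1?eq_sym// !(sum_I2 _ ij).
by rewrite addrACA [bvar C j * _ + _]addrC.
Qed.

Lemma weight_wi i j (m : multinom (2 + 2)) : i != j ->
  weight (wi i) m = (m (lshift 2 i) + m (rshift 2 j))%N.
Proof.
move=> ij; rewrite /weight big_split_ord /= !(sum_I2n _ ij) !wil !wir !eqxx /=.
by rewrite eq_sym (negbTE ij) /= !mul0n !mul1n addn0 add0n.
Qed.

(** Weight 0 excludes z_i and conj(z_j); the bidegree fixes the other two exponents. *)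
Lemma lowest_weight i j a b P : i != j -> bihom a b P -> whom (wi i) 0 P ->
  exists c : C, P = c *: mono C (at1 j a) (at1 i b).
Proof.
move=> ij /bihomP Pab /whomP Pi.
pose m0 := zb_multinom (at1 j a) (at1 i b).
exists (mcoeff m0 P); apply/mpolyP => m; rewrite mcoeffZ mcoeffX.
case: eqP => [<-|mm0]; first by rewrite mulr1.
rewrite mulr0; apply: memN_msupp_eq0; apply/negP => mP; apply: mm0.
have [ma mb] := Pab _ mP; have := Pi _ mP.
rewrite (weight_wi _ ij) => /eqP; rewrite addn_eq0 => /andP[/eqP mi /eqP mj].
move: ma mb; rewrite !(sum_I2n _ ij) mi mj add0n addn0 => ma mb.
have two (k : 'I_2) : k = i \/ k = j.
  by move: ij; case: i j k {Pi mi mj ma mb m0} => [[|[]]//= ?] [[|[]]//= ?] [[|[]]//= ?] _;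
    ((left; exact: val_inj) || (right; exact: val_inj)).
apply: zb_multinomP => k; rewrite ?zb_multinoml ?zb_multinomr /at1;
  by case: (two k) => ->; rewrite ?eqxx ?(negbTE ij) 1?eq_sym ?(negbTE ij).
Qed.

Lemma whom_rot i j a P : i != j -> whom (wi i) a.+1 P -> whom (wi i) a (rot j i P).
Proof.
move=> ij Pa; rewrite /rot; apply: whomB; rewrite -[a]add0n; apply: whomM.
- by have := whomXU C (wi i) (lshift 2 j); rewrite wil eq_sym (negbTE ij).
- by have := whom_mderiv (lshift 2 i) Pa; rewrite wil eqxx subn1.
- by have := whomXU C (wi i) (rshift 2 i); rewrite wir eqxx.
- by have := whom_mderiv (rshift 2 j) Pa; rewrite wir eq_sym ij subn1.
Qed.

(* The harmonic polynomials form an irreducible representation of sl_2: they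
   are generated from the lowest weight vector by the raising operator. *)
Lemma hbihom_ind i j a b (V : mpoly (2 + 2) C -> Prop) : i != j ->
  V (mono C (at1 j a) (at1 i b)) ->
  (forall (c : C) P, V P -> V (c *: P)) ->
  (forall P Q, V P -> V Q -> V (P + Q)) ->
  (forall P, hbihom a b P -> V P -> V (rot i j P)) ->
  forall P, hbihom a b P -> V P.
Proof.
move=> ij V0 VZ VD Vrot.
have V00 : V 0 by rewrite -(scale0r (mono C (at1 j a) (at1 i b))); exact: VZ.
have Vk k P : hbihom a b P -> whom (wi i) k P -> V P.
  elim: k P => [|k IH] P [Pab P0] Pk.
    by have [c ->] := lowest_weight ij Pab Pk; exact: VZ.
  have [->//|Pn0] := eqVneq P 0.
  have kab : (k.+1 <= a + b)%N.
    have : exists m, m \in msupp P.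
      move: Pn0; rewrite -msupp_eq0; case: (msupp P) => // m s _.
      by exists m; rewrite mem_head.
    move=> [m mP]; move/whomP: (Pk) => /(_ m mP) <-.
    have [<- <-] := (proj1 (bihomP _ _ _) Pab) m mP.
    by rewrite (weight_wi _ ij) !(sum_I2n _ ij); lia.
  have := capelli P ij; rewrite P0 mulr0 subr0.
  have := euler_wi_add ij Pab; rewrite Pk => /(canRL (addKr _)) ->.
  rewrite -scaleNr -scalerDl eulerZ Pk scalerA -scalerDl; set x := (_ + _ : C) => E.
  (* By Capelli's identity, lowering and then raising multiplies a harmonic vector of weight [k + 1]
     by [(k + 1) (a + b - k)], and no weight exceeds [a + b]. *)
  have x0 : x != 0.
    have -> : x = (k.+1 * (a + b - k.+1).+1)%:R.
      by rewrite /x natrM -[(a + b - k.+1).+1]addn1 (natrD _ (a + b - _)) natrB//; ring.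
    by rewrite pnatr_eq0 muln_eq0.
  have -> : P = x^-1 *: rot i j (rot j i P) by rewrite E scalerA mulVf ?scale1r.
  apply/VZ/Vrot; first exact: hbihom_rot.
  by apply: IH; [exact: hbihom_rot|exact: whom_rot].
move=> P [[Pa Pb] P0]; rewrite (sum_weight_part (wi i) P).
apply: big_ind => // k _; apply: (Vk k); last exact: whom_weight_part.
by split; [split; exact: whom_weight_part2|exact: box_weight_part].
Qed.

Section Trilinear.
Variable I : {linear mpoly (2 + 2) C -> C^o}.
Hypothesis I_rot : forall i j P, I (rot i j P) = 0.

Lemma I_rot3 i j P Q h :
  I (rot i j P * Q * h) = - (I (P * rot i j Q * h) + I (P * Q * rot i j h)).
Proof.
have := I_rot i j (P * Q * h); rewrite !rotM mulrDl !linearD /= => /eqP.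
by rewrite -addrA addr_eq0 => /eqP ->; rewrite opprD.
Qed.

(** The operator [rot i0 i1] kills z_1^a conj(z_2)^b and generates all [Q] from the opposite corner;
    by invariance it passes to [h], which is arbitrary in [gen]. Once [Q] and [h] are both
    arbitrary, [rot i1 i0] generates all [P]. *)
Lemma trilinear_eq0 a b a' b' c d :
  (forall h, hbihom c d h -> I (mono2 C a 0 0 b * mono2 C 0 a' b' 0 * h) = 0) ->
  forall P Q h, hbihom a b P -> hbihom a' b' Q -> hbihom c d h ->
  I (P * Q * h) = 0.
Proof.
move=> gen; pose i0 : 'I_2 := ord0; pose i1 : 'I_2 := lift ord0 ord0.
have i01 : i0 != i1 by []. have i10 : i1 != i0 by [].
have corner0 x y : mono2 C x 0 0 y = mono C (at1 i0 x) (at1 i1 y).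
  by apply: mono_ext => k; rewrite /pair2 /at1; case: (unliftP ord0 k) => [l|] ->;
    rewrite ?ord1.
have corner1 x y : mono2 C 0 x y 0 = mono C (at1 i1 x) (at1 i0 y).
  by apply: mono_ext => k; rewrite /pair2 /at1; case: (unliftP ord0 k) => [l|] ->;
    rewrite ?ord1.
have step1 Q : hbihom a' b' Q ->
    forall h, hbihom c d h -> I (mono2 C a 0 0 b * Q * h) = 0.
  move: Q; apply: (hbihom_ind i01).
  - by rewrite -corner1.
  - by move=> x Q IH h hh; rewrite -scalerAr -scalerAl linearZ /= IH// scaler0.
  - by move=> P Q IP IQ h hh; rewrite mulrDr mulrDl linearD /= IP// IQ// addr0.
  - move=> Q Qh IH h hh; have := I_rot3 i0 i1 (mono2 C a 0 0 b) Q h.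
    have -> : rot i0 i1 (mono2 C a 0 0 b) = 0.
      rewrite /rot (_ : dz i1 _ = 0); last first.
        by rewrite /dz /mono2 /mono mderivX zb_multinoml scale0r.
      rewrite (_ : db i0 _ = 0) ?mulr0 ?subrr//.
      by rewrite /db /mono2 /mono mderivX zb_multinomr scale0r.
    rewrite !mul0r linear0 IH ?addr0; last exact: hbihom_rot.
    by move/eqP; rewrite eq_sym oppr_eq0 => /eqP.
move=> P Q h Ph; move: Q h; move: P Ph; apply: (hbihom_ind i10).
- by move=> Q h Qh hh; rewrite -corner0; exact: step1.
- by move=> x P IH Q h Qh hh; rewrite -!scalerAl linearZ /= IH// scaler0.
- by move=> P P' IP IP' Q h Qh hh; rewrite !mulrDl linearD /= IP// IP'// addr0.
- move=> P Ph IH Q h Qh hh; rewrite I_rot3 !IH ?addr0 ?oppr0//; exact: hbihom_rot.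
Qed.

End Trilinear.

End DimensionTwoVanishing.

(** * Patterns closed under products *)

Section Patterns.
Context (C : numClosedFieldType) (N : nat) (I : {linear mpoly (N + N) C -> C^o}).
Variables p q : nat.
Hypothesis ltqp : (q < p)%N.

(** The condition that an algebra pattern must satisfy. [coupled] bounds [j] by both total degrees,
    so the subtractions are exact. *)
Definition product_closed (Om : nat -> nat -> Prop) := forall a b c d j,
  Om a b -> Om c d -> coupled I a b c d j -> Om (a + c - j)%N (b + d - j)%N.

(** The condition that suffices for an algebra pattern, phrased with test polynomials [h] so that no
    decomposition of [f * g] has to be chosen. *)
Definition vanishing (Om : nat -> nat -> Prop) := forall a b c d j f g h,
  Om a b -> Om c d -> hbihom a b f -> hbihom c d g ->
  (j <= minn (a + c) (b + d))%N -> hbihom (b + d - j) (a + c - j) h ->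
  ~ Om (a + c - j)%N (b + d - j)%N -> I (f * g * h) = 0.

Definition G (x y : nat) := (x = p /\ y = q) \/ exists m j,
  [/\ (2 <= m)%N, (j <= m * q)%N, (x + j = m * p)%N & (y + j = m * q)%N].

Definition G_deleted (x y : nat) :=
  (exists m, [/\ (2 <= m)%N, (x + 1 = m * p)%N & (y + 1 = m * q)%N]) \/
  (exists j, [/\ odd j, (x + j = 2 * p)%N & (y + j = 2 * q)%N]).

Lemma G_level x y : G x y -> exists m k,
  [/\ (0 < m)%N, (x + k = m * p)%N, (y + k = m * q)%N & (m = 1 -> k = 0)%N].
Proof.
case=> [[-> ->]|[m [k [m2 _ xk yk]]]]; first by exists 1%N, 0%N; split; lia.
by exists m, k; split=> //; lia.
Qed.

(** Nothing has to vanish: levels and shifts add up, so [G] contains every bidegree that a component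
    of the product can have. *)
Lemma vanishing_G : vanishing G.
Proof.
move=> a b c d j f g h /G_level[m [k [m0 ak bk _]]] /G_level[m' [k' [m'0 ck dk _]]].
move=> _ _ jab _ []; right; exists (m + m')%N, (j + k + k')%N.
by split; rewrite ?mulnDl; lia.
Qed.

Lemma product_closed_G (Om : nat -> nat -> Prop) (i0 i1 i2 : 'I_N) :
  (0 < N)%N ->
  (forall i (j : 'I_N) P, I (zvar C i * dz j P - bvar C j * db i P) = 0) ->
  (forall P, I (r2 C N * P) = I P) -> I 1 = 1 ->
  i0 != i1 -> i1 != i2 -> i0 != i2 ->
  product_closed Om -> Om p q -> forall x y, G x y -> Om x y.
Proof.
move=> N0 I_inv I_r2 I1 i01 i12 i02 clOm Opq.
have step r s j x y : Om r s -> (j <= minn r q + minn p s)%N ->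
    (x + j = r + p)%N -> (y + j = s + q)%N -> Om x y.
  move=> Ors jrs xj yj; have -> : x = (r + p - j)%N by lia.
  have -> : y = (s + q - j)%N by lia.
  apply: clOm => //; exact: (@coupled_dim3 C N I N0 I_inv I_r2 I1 i0 i1 i2).
suff main m t : (t <= m.+2 * q)%N -> Om (m.+2 * p - t)%N (m.+2 * q - t)%N.
  move=> x y [[-> ->//]|[[|[|m]] [j [m2 jm xj yj]]]] //.
  have -> : x = (m.+2 * p - j)%N by lia.
  have -> : y = (m.+2 * q - j)%N by lia.
  exact: main.
elim: m t => [|m IH] t tm.
  by apply: (step p q t) => //; lia.
have [tm2|tm2] := leqP t (m.+2 * q).
  by apply: (step _ _ 0%N _ _ (IH t tm2)); nia.
(* For a shift exceeding all those of the previous level by [u], start from its point with second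
   coordinate [u] and take the component of index [2 u]; since [u <= q], both terms of the bound in
   [coupled_dim3] are at least [u]. *)
pose u := (t - m.+2 * q)%N.
have uq : (u <= q)%N by rewrite /u; nia.
have := IH (m.+2 * q - u)%N (leq_subr _ _).
have -> : (m.+2 * q - (m.+2 * q - u) = u)%N by nia.
have mp : (m.+2 * q + m.+2 <= m.+2 * p)%N by nia.
move=> Ou; apply: (step _ _ (u + u)%N _ _ Ou); [|by rewrite /u; nia|by rewrite /u; nia].
by rewrite /u in uq *; lia.
Qed.

End Patterns.

(** * The pattern in dimension two *)

Section PatternsTwo.
Context (C : numClosedFieldType) (I : {linear mpoly (2 + 2) C -> C^o}).
Variables p q : nat.
Hypothesis ltqp : (q < p)%N.
Hypothesis I_inv : forall i (j : 'I_2) P,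
  I (zvar C i * dz j P - bvar C j * db i P) = 0.
Hypothesis I_r2 : forall P, I (r2 C 2 * P) = I P.
Hypothesis I1 : I 1 = 1.

Lemma vanishing_G2 :
  vanishing I (fun x y => G p q x y /\ ~ G_deleted p q x y).
Proof.
move=> a b c d j f g h [Gab Dab] [Gcd Dcd] hf hg jab hh nG.
have [m [k [m0 ak bk m1]]] := G_level ltqp Gab.
have [m' [k' [m'0 ck dk m1']]] := G_level ltqp Gcd.
have Gj : G p q (a + c - j) (b + d - j).
  by right; exists (m + m')%N, (j + k + k')%N; split; rewrite ?mulnDl; lia.
have {nG} Dj : G_deleted p q (a + c - j) (b + d - j) by apply: contrapT => nD; apply: nG.
(* As [p - q > 0], a point determines its level and its shift. *)
have lvl M u : (a + c - j + u = M * p)%N -> (b + d - j + u = M * q)%N ->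
    M = (m + m')%N /\ u = (j + k + k')%N.
  move=> Mp Mq; have E : (M * (p - q) = (m + m') * (p - q))%N.
    by rewrite !mulnBr !mulnDl; lia.
  have ME : M = (m + m')%N.
    by apply/eqP; rewrite -(@eqn_pmul2r (p - q)) ?subn_gt0// E.
  by split=> //; move: Mp; rewrite ME mulnDl; lia.
case: Dj => [[M [M2 Mp Mq]]|[u [ou Mp Mq]]].
  have [ME jE] := lvl M 1%N Mp Mq.
  (* Here [j + k + k' = 1]. A factor of shift 1 would itself be a deleted point, so [j = 1] and both
     bidegrees are multiples of [(p, q)], hence proportional. *)
  have [k0|k0] := posnP k; last first.
    exfalso; apply: Dab; left; exists m; have -> : 1%N = k by lia.
    by split=> //; case: (m) m0 m1 k0 => [|[|]] //; lia.
  have [k0'|k0'] := posnP k'; last first.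
    exfalso; apply: Dcd; left; exists m'; have -> : 1%N = k' by lia.
    by split=> //; case: (m') m'0 m1' k0' => [|[|]] //; lia.
  have j1 : j = 1%N by lia.
  move: f g h hf hg hh; rewrite j1 => f g h hf hg hh.
  apply: (trilinear_eq0 I_inv _ hf hg hh) => h' hh'.
  rewrite mono2M !addn0 !add0n; apply: (first_component_eq0 I_inv I_r2) => //.
  - by nia.
  - by lia.
  - by lia.
have [ME jE] := lvl 2%N u Mp Mq.
(* A point of level 2 can only arise from two factors of bidegree [(p, q)]. *)
have [mE mE'] : m = 1%N /\ m' = 1%N by lia.
have [k0 k0'] : k = 0%N /\ k' = 0%N by split; [exact: m1|exact: m1'].
have [aE bE] : a = p /\ b = q by lia.
have [cE dE] : c = p /\ d = q by lia.
rewrite aE bE cE dE in hf hg hh jab.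
apply: (trilinear_eq0 I_inv _ hf hg hh) => h' hh'.
rewrite mono2M !addn0 !add0n.
apply: (odd_component_eq0 I_inv I_r2 (j := j)) => //; [|lia|lia].
by have -> : j = u by lia.
Qed.

Lemma product_closed_G2 (Om : nat -> nat -> Prop) :
  product_closed I Om -> Om p q ->
  forall x y, G p q x y -> ~ G_deleted p q x y -> Om x y.
Proof.
move=> clOm Opq.
have step r s j x y : Om r s -> coupled I r s p q j ->
    (x + j = r + p)%N -> (y + j = s + q)%N -> Om x y.
  move=> Ors crs xj yj; have -> : x = (r + p - j)%N by lia.
  (have -> : y = (s + q - j)%N by lia); exact: clOm.
have zero := @coupled_zero C I I_inv I_r2 I1.
have holo := @coupled_holomorphic C I I_inv I_r2 I1.
have maxi := @coupled_max C I I_inv I_r2 I1.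
have lvl2 t : (t <= q)%N -> Om (2 * p - t.*2)%N (2 * q - t.*2)%N.
  move=> tq; apply: (step p q t.*2) => //; [|by lia|by lia].
  by apply: coupled_even => //; exact: ltnW.
have lvl2' s : ~~ odd s -> (s <= 2 * q)%N -> Om (2 * (p - q) + s)%N s.
  move=> es sq; have := lvl2 (q - s./2)%N (leq_subr _ _).
  have sE : s = s./2.*2 by have := odd_double_half s; rewrite (negbTE es).
  have -> : (2 * p - (q - s./2).*2 = 2 * (p - q) + s)%N by lia.
  by have -> : (2 * q - (q - s./2).*2 = s)%N by lia.
(* This reaches the points of level [k + 1] whose shift exceeds [k * q] by [i]. The starting points
   have second coordinate [s <= q]; at level 2 those with odd [s] are deleted. *)
have next k i : (2 <= k)%N -> (0 < i <= q)%N ->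
    (forall s, (s <= q)%N -> (k = 2 -> ~~ odd s)%N -> Om (k * (p - q) + s)%N s) ->
    Om (k.+1 * (p - q) + (q - i))%N (q - i)%N.
  move=> k2 /andP[i0 iq] av.
  have [ikd|ikd] := leqP i (k * (p - q)).
    have := av 0%N (leq0n _) (fun=> isT); rewrite addn0 => O0.
    apply: (step _ _ i _ _ O0); first by apply: holo; rewrite leq_min ikd.
      by rewrite mulSn; lia.
    by lia.
  pose s := (i - k * (p - q))%N.
  have rE : (k * (p - q) + s = i)%N by rewrite /s; lia.
  have sq : (s.+1 <= q)%N by have : (0 < k * (p - q))%N by [nia]; lia.
  (* The natural start is the point [(i, s)], whose largest component has index [i + s]. If it is a
     deleted point of level 2, [(i + 1, s + 1)] replaces it, with index [i + s + 1]: the largest one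
     if [i = q], and otherwise one below the largest. *)
  have [so|se] := boolP ((k == 2) && odd s); last first.
    have := av s (ltnW sq); rewrite rE => /(_ _)/step; apply.
    - by move=> k2'; move: se; rewrite k2' eqxx.
    - exact: maxi.
    - by rewrite mulSn; lia.
    - by lia.
  have /andP[/eqP kE os] := so.
  have Os : Om i.+1 s.+1.
    by have := av s.+1 sq; rewrite addnS rE; apply => _; rewrite /= os.
  have [iq'|iq'] := eqVneq i q.
    apply: (step _ _ _ _ _ Os (maxi _ _ _ _)); rewrite ?mulSn; lia.
  apply: (step _ _ (i + s).+1 _ _ Os).
  - apply: (@coupled_max_pred C I I_inv I_r2 I1); [lia|lia|].
    have : (s <= i)%N by lia.
    by have : (s.+1 * q.+1 <= i.+1 * q.+1)%N by [nia]; nia.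
  - by rewrite mulSn; lia.
  - by lia.
have lvl3 m t : (t != 1)%N -> (t <= m.+3 * q)%N ->
    Om (m.+3 * p - t)%N (m.+3 * q - t)%N.
  elim: m t => [|m IH] t t1 tm.
    have [t2|t2] := leqP t (2 * q).
      have [ot|et] := boolP (odd t); last first.
        have := lvl2' (2 * q - t)%N; rewrite oddB// oddM /= => /(_ et (leq_subr _ _)) O2.
        by apply: (step _ _ 0%N _ _ O2 (zero _ _ _ _)); lia.
      have t0 : (0 < t)%N by case: (t) ot.
      have tlt : (t < 2 * q)%N.
        rewrite ltn_neqAle t2 andbT; apply: contraL ot => /eqP ->.
        by rewrite oddM.
      have := lvl2' (2 * q - t.-1)%N; rewrite oddB ?oddM /=; last by lia.
      have -> : odd t.-1 = false by move: ot; rewrite -[in odd t](prednK t0) /= => /negbTE.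
      move=> /(_ isT (leq_subr _ _)) O2.
      apply: (step _ _ 1%N _ _ O2); [|by lia|by lia].
      (* Proportionality would mean [(t - 1) (p - q) = 0], which happens only at the deleted shift
         [t = 1]. *)
      apply: (@coupled_one C I I_inv I_r2 I1).
      have [d dE] : exists d, p = (q + d.+1)%N by exists (p - q).-1; lia.
      have [e eE] : exists e, t = e.+3 by exists (t - 3)%N; move: ot t1 t0; case: (t) => [|[|[|?]]] //; lia.
      rewrite dE eE /=; apply/eqP => E.
      have : (2 * (q + d.+1 - q) + (2 * q - e.+2) = 2 * d.+1 + (2 * q - e.+2))%N by lia.
      set w := (2 * q - e.+2)%N in E *; have wE : (w + e.+2 = 2 * q)%N by rewrite /w; lia.
      move=> E'; rewrite E' in E; nia.
    have := next 2 (t - 2 * q)%N isT.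
    have -> : (3 * (p - q) + (q - (t - 2 * q)) = 3 * p - t)%N by lia.
    have -> : (q - (t - 2 * q) = 3 * q - t)%N by lia.
    by apply; [lia|move=> s sq /(_ erefl) es; apply: lvl2' => //; lia].
  have [tm2|tm2] := leqP t (m.+3 * q).
    by apply: (step _ _ 0%N _ _ (IH t t1 tm2) (zero _ _ _ _)); nia.
  have := next m.+3 (t - m.+3 * q)%N isT.
  have mp : (m.+4 * q <= m.+4 * p)%N by nia.
  have -> : (m.+4 * (p - q) + (q - (t - m.+3 * q)) = m.+4 * p - t)%N.
    by rewrite mulnBr; nia.
  have -> : (q - (t - m.+3 * q) = m.+4 * q - t)%N by nia.
  apply; first by nia.
  move=> s sq _; have := IH (m.+3 * q - s)%N.
  have -> : (m.+3 * p - (m.+3 * q - s) = m.+3 * (p - q) + s)%N.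
    by rewrite mulnBr; nia.
  have -> : (m.+3 * q - (m.+3 * q - s) = s)%N by nia.
  by apply; [apply/eqP; nia|exact: leq_subr].
move=> x y [[-> ->//]|[m [j [m2 jm xj yj]]]] nD.
have -> : x = (m * p - j)%N by lia.
have -> : y = (m * q - j)%N by lia.
case: m m2 jm xj yj => [|[|[|m]]] // _ jm xj yj.
  have ej : ~~ odd j by apply/negP => oj; apply: nD; right; exists j.
  have := lvl2' (2 * q - j)%N; rewrite oddB// oddM /= => /(_ ej (leq_subr _ _)).
  by have -> : (2 * (p - q) + (2 * q - j) = 2 * p - j)%N by lia.
apply: lvl3 => //; apply/eqP => j1; apply: nD; left; exists m.+3.
by split=> //; lia.
Qed.

End PatternsTwo.

(** * Rotations in real coordinates *)

Section RealCoordinates.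
Context (C : numClosedFieldType) (N : nat) (ii : C).
Hypothesis ii2 : ii * ii = -1.
Implicit Types (P Q : mpoly (N + N) C) (y : 'rV[C]_(N + N)) (A : 'M[C]_(N + N)).

(* [dx k] is the derivative along the [k]-th real coordinate [xvar k]. *)
Definition dx (k : 'I_(N + N)) P : mpoly (N + N) C :=
  match fintype.split k with
  | inl j => dz j P + db j P
  | inr j => ii *: (dz j P - db j P)
  end.

Lemma dxl j P : dx (lshift N j) P = dz j P + db j P.
Proof. by rewrite /dx (unsplitK (inl j)). Qed.
Lemma dxr j P : dx (rshift N j) P = ii *: (dz j P - db j P).
Proof. by rewrite /dx (unsplitK (inr j)). Qed.

Lemma dxD k P Q : dx k (P + Q) = dx k P + dx k Q.
Proof.
rewrite /dx; case: (fintype.split k) => j; rewrite dzD dbD; first by rewrite addrACA.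
by rewrite opprD addrACA scalerDr.
Qed.

Lemma dxZ k c P : dx k (c *: P) = c *: dx k P.
Proof.
rewrite /dx; case: (fintype.split k) => j; rewrite dzZ dbZ; first by rewrite scalerDr.
by rewrite -scalerBr !scalerA mulrC.
Qed.

Lemma dxM k P Q : dx k (P * Q) = dx k P * Q + P * dx k Q.
Proof.
rewrite /dx; case: (fintype.split k) => j; rewrite dzM dbM.
  by ring.
by rewrite -scalerAl -scalerAr -scalerDr; congr (_ *: _); ring.
Qed.

Lemma dx1 k : dx k 1 = 0.
Proof.
rewrite /dx; case: (fintype.split k) => j; rewrite /dz /db -mpolyC1 !mderivC.
  by rewrite addr0.
by rewrite subr0 scaler0.
Qed.

Lemma sum_dx_dx P : \sum_k dx k (dx k P) = 4%:R *: box P.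
Proof.
rewrite big_split_ord /= /box scaler_sumr -big_split /=; apply: eq_bigr => j _.
rewrite !dxl !dxr dzD dbD dzZ dbZ dzB dbB -!(dz_db j j).
move: (dz j (dz j P)) (db j (db j P)) (dz j (db j P)) => a b c.
by rewrite -scalerBr scalerA ii2 scaleN1r scaler_nat; ring.
Qed.

Definition xvar (k : 'I_(N + N)) : mpoly (N + N) C :=
  match fintype.split k with
  | inl j => 2%:R^-1 *: (zvar C j + bvar C j)
  | inr j => (2%:R * ii)^-1 *: (zvar C j - bvar C j)
  end.

Lemma ii_neq0 : ii != 0.
Proof.
by apply: contra_eqN ii2 => /eqP ->; rewrite mul0r eq_sym oppr_eq0 oner_eq0.
Qed.

Lemma zvar_xvar j : zvar C j = xvar (lshift N j) + ii *: xvar (rshift N j).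
Proof.
rewrite /xvar (unsplitK (inl j)) (unsplitK (inr j)) scalerA invfM.
rewrite mulrCA divff ?ii_neq0// mulr1 -scalerDr addrACA subrr addr0 -mulr2n -scaler_nat.
by rewrite scalerA mulVf ?scale1r// pnatr_eq0.
Qed.

Lemma bvar_xvar j : bvar C j = xvar (lshift N j) - ii *: xvar (rshift N j).
Proof.
rewrite /xvar (unsplitK (inl j)) (unsplitK (inr j)) scalerA invfM.
rewrite mulrCA divff ?ii_neq0// mulr1 -scalerBr opprB [bvar C j - _]addrC addrACA subrr add0r.
by rewrite -mulr2n -scaler_nat scalerA mulVf ?scale1r// pnatr_eq0.
Qed.

Definition zpoint y (v : 'I_(N + N)) : C :=
  match fintype.split v with
  | inl j => y 0 (lshift N j) + ii * y 0 (rshift N j)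
  | inr j => y 0 (lshift N j) - ii * y 0 (rshift N j)
  end.

Lemma meval_zvar y j :
  meval (zpoint y) (zvar C j) = y 0 (lshift N j) + ii * y 0 (rshift N j).
Proof. by rewrite mevalXU /zpoint (unsplitK (inl j)). Qed.

Lemma meval_bvar y j :
  meval (zpoint y) (bvar C j) = y 0 (lshift N j) - ii * y 0 (rshift N j).
Proof. by rewrite mevalXU /zpoint (unsplitK (inr j)). Qed.

Lemma meval_xvar y k : meval (zpoint y) (xvar k) = y 0 k.
Proof.
have t0 : 2%:R != 0 :> C by rewrite pnatr_eq0.
rewrite /xvar -{2}(splitK k); case: (fintype.split k) => j /=; rewrite mevalZ.
  by rewrite mevalD meval_zvar meval_bvar addrACA subrr addr0 -mulr2n -(mulr_natl (y 0 _)) mulKf.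
rewrite mevalB meval_zvar meval_bvar opprB addrC addrA addrNK -mulr2n.
by rewrite -(mulr_natl (ii * _)) mulrA mulKf// mulf_neq0 ?ii_neq0.
Qed.

(* The [m]-th coordinate of [x *m A], as a polynomial in [x]. *)
Definition lin A (m : 'I_(N + N)) : mpoly (N + N) C := \sum_k A k m *: xvar k.

Definition zlin A (v : 'I_(N + N)) : mpoly (N + N) C :=
  match fintype.split v with
  | inl j => lin A (lshift N j) + ii *: lin A (rshift N j)
  | inr j => lin A (lshift N j) - ii *: lin A (rshift N j)
  end.

Lemma meval_lin y A m : meval (zpoint y) (lin A m) = (y *m A) 0 m.
Proof.
rewrite /lin (raddf_sum (meval _)) mxE /=; apply: eq_bigr => k _.
by rewrite mevalZ meval_xvar mulrC.
Qed.

Lemma meval_zlin y A v : meval (zpoint y) (zlin A v) = zpoint (y *m A) v.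
Proof.
rewrite /zlin /zpoint; case: (fintype.split v) => j.
  by rewrite mevalD mevalZ !meval_lin.
by rewrite mevalB mevalZ !meval_lin.
Qed.

Lemma linD A B m : lin (A + B) m = lin A m + lin B m.
Proof.
by rewrite /lin -big_split /=; apply: eq_bigr => k _; rewrite mxE scalerDl.
Qed.

Lemma linZ c A m : lin (c *: A) m = c *: lin A m.
Proof.
by rewrite /lin scaler_sumr; apply: eq_bigr => k _; rewrite mxE scalerA.
Qed.

Lemma zlinD A B v : zlin (A + B) v = zlin A v + zlin B v.
Proof.
rewrite /zlin; case: (fintype.split v) => j; rewrite !linD scalerDr ?opprD; exact: addrACA.
Qed.

Lemma zlinZ c A v : zlin (c *: A) v = c *: zlin A v.
Proof.
rewrite /zlin; case: (fintype.split v) => j; rewrite !linZ.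
  by rewrite scalerDr !scalerA mulrC.
by rewrite scalerBr !scalerA mulrC.
Qed.

Lemma lin1 m : lin 1%:M m = xvar m.
Proof.
rewrite /lin (bigD1 m)//= mxE eqxx scale1r big1 ?addr0// => k km.
by rewrite mxE (negbTE km) scale0r.
Qed.

Lemma zlin1 v : zlin 1%:M v = mpolyX C (mnm1 v).
Proof.
rewrite /zlin -{2}(splitK v); case: (fintype.split v) => j; rewrite !lin1.
  by rewrite -zvar_xvar.
by rewrite -bvar_xvar.
Qed.

Definition subst A P : mpoly (N + N) C := mmap (@mpolyC (N + N) C) (zlin A) P.

Lemma subst1 A : subst A 1 = 1. Proof. exact: (mmap_is_multiplicative _ _).2. Qed.
Lemma substD A P Q : subst A (P + Q) = subst A P + subst A Q.
Proof. exact: mmapD. Qed.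
Lemma substM A P Q : subst A (P * Q) = subst A P * subst A Q.
Proof. exact: (mmap_is_multiplicative _ _).1. Qed.

Lemma substZ A c P : subst A (c *: P) = c *: subst A P.
Proof. by rewrite /subst mmapZ mul_mpolyC. Qed.

Lemma substX A v : subst A (mpolyX C (mnm1 v)) = zlin A v.
Proof. by rewrite /subst mmapX mmap1U. Qed.

Lemma meval_subst y A P : meval (zpoint y) (subst A P) = meval (zpoint (y *m A)) P.
Proof.
elim/mpoly_ring_ind: P => [|P Q IP IQ|c P IP|v P IP].
- by rewrite subst1 !meval1.
- by rewrite substD !mevalD IP IQ.
- by rewrite substZ !mevalZ IP.
- by rewrite substM substX !mevalM IP meval_zlin mevalXU.
Qed.

Definition tangent A P := \sum_m lin A m * dx m P.

Lemma tangentD A P Q : tangent A (P + Q) = tangent A P + tangent A Q.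
Proof.
by rewrite /tangent -big_split /=; apply: eq_bigr => m _; rewrite dxD mulrDr.
Qed.

Lemma tangentZ A c P : tangent A (c *: P) = c *: tangent A P.
Proof.
by rewrite /tangent scaler_sumr; apply: eq_bigr => m _; rewrite dxZ scalerAr.
Qed.

Lemma tangentM A P Q : tangent A (P * Q) = tangent A P * Q + P * tangent A Q.
Proof.
rewrite /tangent mulr_suml mulr_sumr -big_split /=; apply: eq_bigr => m _.
by rewrite dxM; ring.
Qed.

Lemma tangentX A v : tangent A (mpolyX C (mnm1 v)) = zlin A v.
Proof.
rewrite /tangent big_split_ord /= /zlin -{1 2}(splitK v).
case: (fintype.split v) => j /=; rewrite -/(zvar C j) -/(bvar C j).
  congr (_ + _).
    rewrite (bigD1 j)//= big1 ?addr0 => [|k kj].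
      by rewrite dxl dz_zvar db_zvar eqxx addr0 mulr1.
    by rewrite dxl dz_zvar db_zvar eq_sym (negbTE kj) addr0 mulr0.
  rewrite (bigD1 j)//= big1 ?addr0 => [|k kj].
    by rewrite dxr dz_zvar db_zvar eqxx subr0 -scalerAr mulr1.
  by rewrite dxr dz_zvar db_zvar eq_sym (negbTE kj) subr0 scaler0 mulr0.
congr (_ + _).
  rewrite (bigD1 j)//= big1 ?addr0 => [|k kj].
    by rewrite dxl dz_bvar db_bvar eqxx add0r mulr1.
  by rewrite dxl dz_bvar db_bvar eq_sym (negbTE kj) add0r mulr0.
rewrite (bigD1 j)//= big1 ?addr0 => [|k kj].
  by rewrite dxr dz_bvar db_bvar eqxx sub0r scalerN -scaleNr -scalerAr mulr1 scaleNr.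
by rewrite dxr dz_bvar db_bvar eq_sym (negbTE kj) sub0r oppr0 scaler0 mulr0.
Qed.

Lemma tangent1 A : tangent A 1 = 0.
Proof. by apply: big1 => m _; rewrite dx1 mulr0. Qed.

(* For a skew matrix [A] with [A^3 = - A], the curve [cayley A t / (1 + t^2)]
   runs through orthogonal matrices. *)
Definition cayley A (t : C) : 'M[C]_(N + N) :=
  (1 + t ^+ 2)%:M + (2%:R * t) *: A + (2%:R * t ^+ 2) *: (A *m A).

(** Substitution of [cayley A t] into [P] with [t] kept as a formal variable, so that the
    coefficient of degree 1 can be extracted. *)
Definition curve A P : {poly mpoly (N + N) C} :=
  mmap (polyC \o @mpolyC (N + N) C)
    (fun v => (mpolyX C (mnm1 v))%:P + (2%:R *: zlin A v)%:P * 'X +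
       (mpolyX C (mnm1 v) + 2%:R *: zlin (A *m A) v)%:P * 'X^2) P.

Lemma curve1 A : curve A 1 = 1. Proof. exact: (mmap_is_multiplicative _ _).2. Qed.
Lemma curveD A P Q : curve A (P + Q) = curve A P + curve A Q.
Proof. exact: mmapD. Qed.
Lemma curveM A P Q : curve A (P * Q) = curve A P * curve A Q.
Proof. exact: (mmap_is_multiplicative _ _).1. Qed.
Lemma curveZ A c P : curve A (c *: P) = (mpolyC _ c)%:P * curve A P.
Proof. by rewrite /curve mmapZ. Qed.

Lemma curveX A v : curve A (mpolyX C (mnm1 v)) =
  (mpolyX C (mnm1 v))%:P + (2%:R *: zlin A v)%:P * 'X +
       (mpolyX C (mnm1 v) + 2%:R *: zlin (A *m A) v)%:P * 'X^2.
Proof. by rewrite /curve mmapX mmap1U. Qed.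

Lemma coef_curve A P : (curve A P)`_0 = P /\ (curve A P)`_1 = 2%:R *: tangent A P.
Proof.
elim/mpoly_ring_ind: P => [|P Q [P0 P1] [Q0 Q1]|c P [P0 P1]|v P [P0 P1]].
- by rewrite curve1 !coef1 tangent1 scaler0.
- rewrite curveD; move: (curve A P) (curve A Q) P0 P1 Q0 Q1 => cP cQ P0 P1 Q0 Q1.
  by rewrite !coefD P0 P1 Q0 Q1 tangentD scalerDr.
- rewrite curveZ; move: (curve A P) P0 P1 => cP P0 P1.
  by rewrite !coefCM P0 P1 tangentZ !mul_mpolyC !scalerA mulrC.
have [X0 X1] : (curve A (mpolyX C (mnm1 v)))`_0 = mpolyX C (mnm1 v) /\
    (curve A (mpolyX C (mnm1 v)))`_1 = 2%:R *: zlin A v.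
  rewrite curveX !coefD !coefC !coefCM !coefX !coefXn /=.
  by rewrite !mulr0 mulr1 !addr0 add0r.
rewrite curveM; move: (curve A P) (curve A _) P0 P1 X0 X1 => cP cX P0 P1 X0 X1.
split; first by rewrite coef0M X0 P0.
rewrite coefM big_ord_recl big_ord1 /= X0 X1 P0 P1 tangentM tangentX.
by rewrite scalerDr -scalerAr -scalerAl addrC.
Qed.

Lemma horner_curve A P t : (curve A P).[mpolyC _ t] = subst (cayley A t) P.
Proof.
elim/mpoly_ring_ind: P => [|P Q IP IQ|c P IP|v P IP].
- by rewrite curve1 subst1 hornerC.
- by rewrite curveD substD -IP -IQ; exact: hornerD.
- by rewrite curveZ substZ -IP hornerM hornerC mul_mpolyC.
rewrite curveM substM -IP hornerM substX curveX; congr (_ * _).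
rewrite 2!hornerD 2!hornerM !hornerC hornerX hornerXn.
rewrite (_ : mpolyC _ t ^+ 2 = mpolyC _ (t ^+ 2)); last by rewrite rmorphXn.
rewrite /cayley !zlinD !zlinZ -scalemx1 zlinZ zlin1 ![_ * mpolyC _ _]mulrC !mul_mpolyC.
rewrite scalerDr !scalerA scalerDl scale1r [t * _]mulrC [t ^+ 2 * _]mulrC.
by rewrite addrA; congr (_ + _); exact: addrAC.
Qed.

(* Both sides are polynomials in the parameter of the curve that agree at all
   natural numbers: compare the coefficients of degree 1. *)
Lemma tangent_invariant (I : {linear mpoly (N + N) C -> C^o}) A P (d : nat) :
  (forall k : nat, I (subst (cayley A k%:R) P) = (1 + k%:R ^+ 2) ^+ d * I P) ->
  I (tangent A P) = 0.
Proof.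
move=> inv; pose F : {poly C} := \poly_(i < size (curve A P)) I (curve A P)`_i.
pose G := F - I P *: (1 + 'X^2) ^+ d.
have Fk t : F.[t] = I (curve A P).[mpolyC _ t].
  rewrite horner_poly horner_coef raddf_sum; apply: eq_bigr => i _ /=.
  have -> : mpolyC (N + N) t ^+ i = mpolyC _ (t ^+ i) by rewrite rmorphXn.
  by rewrite [_ * mpolyC _ _]mulrC mul_mpolyC linearZ /= mulrC.
have Gk k : root G k%:R.
  rewrite /root /G hornerD hornerN hornerZ horner_exp hornerD hornerC hornerXn.
  by rewrite Fk horner_curve inv mulrC subrr.
have G0 : G = 0.
  apply/eqP; apply/negPn/negP => Gn0.
  have := @max_poly_roots _ G [seq k%:R | k <- iota 0 (size G)] Gn0.
  rewrite size_map size_iota ltnn => /(_ _ _)/negP; apply => //.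
    by apply/allP => _ /mapP[k _ ->].
  by rewrite map_inj_uniq ?iota_uniq// => k l /eqP; rewrite eqr_nat => /eqP.
have F1 : F`_1 = 2%:R * I (tangent A P).
  rewrite coef_poly; case: ltnP => [_|le1].
    by rewrite (coef_curve A P).2 linearZ.
  have := (coef_curve A P).2; rewrite nth_default// => /eqP.
  by rewrite eq_sym scaler_eq0 pnatr_eq0 /= => /eqP ->; rewrite linear0 mulr0.
(* This polynomial is even in the parameter. *)
have E1 : ((1 + 'X^2) ^+ d : {poly C})`_1 = 0.
  rewrite -[LHS]mulr1n -coef_deriv -horner_coef0 deriv_exp derivD derivXn derivC add0r.
  by rewrite hornerMn hornerM /= hornerMn hornerXn expr1 /= mul0rn mul0r mul0rn.
have := congr1 (fun p : {poly C} => p`_1) G0.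
rewrite /G coefB coefZ E1 mulr0 subr0 F1 coef0 => /eqP.
by rewrite mulf_eq0 pnatr_eq0 => /eqP.
Qed.

(** Each [L k l] is the real rotation x_k dx_l - x_l dx_k, and the unitary rotations are complex
    combinations of these. *)
Lemma rot_tangent i j P (L := fun k l : 'I_(N + N) => tangent (delta_mx k l - delta_mx l k) P) :
  2%:R *: (zvar C i * dz j P - bvar C j * db i P) =
  L (lshift N i) (lshift N j) + L (rshift N i) (rshift N j) +
  ii *: (L (rshift N i) (lshift N j) - L (lshift N i) (rshift N j)).
Proof.
have LE k l : L k l = xvar k * dx l P - xvar l * dx k P.
  have linE m : lin (delta_mx k l - delta_mx l k) m =
      (m == l)%:R *: xvar k - (m == k)%:R *: xvar l.
    have linZ1 a b : lin (delta_mx a b) m = (m == b)%:R *: xvar a.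
      rewrite /lin (bigD1 a)//= mxE eqxx big1 ?addr0// => r ra.
      by rewrite mxE (negbTE ra) scale0r.
    by rewrite linD -scaleN1r linZ !linZ1 scaleN1r.
  rewrite /L /tangent; under eq_bigr do rewrite linE mulrBl -!scalerAl.
  rewrite sumrB (bigD1 l)//= [in X in _ - X](bigD1 k)//= !eqxx !scale1r.
  rewrite !big1 ?addr0// => m /negbTE ->; by rewrite scale0r.
rewrite !LE !dxl !dxr zvar_xvar bvar_xvar -!mul_mpolyC.
set w := mpolyC _ ii; set t := mpolyC _ 2%:R.
have w2 : w * w + 1 = 0 by rewrite -mpolyCM ii2 -mpolyC1 -mpolyCD addNr.
have tE : t = 1 + 1 by rewrite /t -mpolyC1 -mpolyCD.
rewrite tE; move: (dz i P) (db i P) (dz j P) (db j P) => c e a b.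
move: (xvar (lshift N i)) (xvar (rshift N i)) (xvar (lshift N j)) (xvar (rshift N j)).
move=> xi yi xj yj; apply/eqP; rewrite -subr_eq0.
(* The difference of the two sides is a multiple of [ii ^+ 2 + 1]; the cofactor is given explicitly
   for [ring]. *)
rewrite [X in X == _](_ : _ = (w * w + 1) * (xi * (a - b) + xj * (c - e))).
  by rewrite w2 mul0r.
by ring.
Qed.

End RealCoordinates.

Import numFieldNormedType.Exports.
Local Open Scope classical_set_scope.
Local Open Scope complex_scope.

(** * Complex functions and the weak* topology *)

Section ComplexFunctions.
Context (d : measure_display) (T : measurableType d) (R : realType).
Variable mu : probability T R.
Implicit Types (f g h : T -> R[i]).

Local Notation normc := Normc.normc.

Lemma cReD (x y : R[i]) : complex.Re (x + y) = complex.Re x + complex.Re y.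
Proof. by case: x y => [a b] [c e]. Qed.
Lemma cImD (x y : R[i]) : complex.Im (x + y) = complex.Im x + complex.Im y.
Proof. by case: x y => [a b] [c e]. Qed.
Lemma cReM (x y : R[i]) : complex.Re (x * y) =
  complex.Re x * complex.Re y - complex.Im x * complex.Im y.
Proof. by case: x y => [a b] [c e]. Qed.
Lemma cImM (x y : R[i]) : complex.Im (x * y) =
  complex.Re x * complex.Im y + complex.Im x * complex.Re y.
Proof. by case: x y => [a b] [c e]. Qed.

Lemma normc_ge0 (x : R[i]) : 0 <= normc x.
Proof. by case: x => a b; exact: sqrtr_ge0. Qed.

Lemma normr_Re_le (x : R[i]) : `|complex.Re x| <= normc x.
Proof.
by case: x => a b /=; rewrite -sqrtr_sqr ler_wsqrtr// lerDl sqr_ge0.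
Qed.

Lemma normr_Im_le (x : R[i]) : `|complex.Im x| <= normc x.
Proof.
by case: x => a b /=; rewrite -sqrtr_sqr ler_wsqrtr// lerDr sqr_ge0.
Qed.

Lemma normc_le_ReIm (x : R[i]) : normc x <= `|complex.Re x| + `|complex.Im x|.
Proof.
case: x => a b /=; rewrite -(@ger0_norm _ (`|a| + `|b|)) ?addr_ge0//.
rewrite -sqrtr_sqr ler_wsqrtr// sqrrD !real_normK ?num_real//.
by rewrite addrAC lerDl mulrn_wge0// mulr_ge0.
Qed.

Lemma cmeasurableD f g : cmeasurable f -> cmeasurable g ->
  cmeasurable (fun x => f x + g x).
Proof.
move=> [f1 f2] [g1 g2]; split.
  by under eq_fun do rewrite cReD; exact: measurable_funD.
by under eq_fun do rewrite cImD; exact: measurable_funD.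
Qed.

Lemma cmeasurableM f g : cmeasurable f -> cmeasurable g ->
  cmeasurable (fun x => f x * g x).
Proof.
move=> [f1 f2] [g1 g2]; split.
  under eq_fun do rewrite cReM.
  by apply: measurable_funB; exact: measurable_funM.
under eq_fun do rewrite cImM.
by apply: measurable_funD; exact: measurable_funM.
Qed.

Lemma cmeasurable_cst (c : R[i]) : cmeasurable (fun _ : T => c).
Proof. by split; exact: measurable_cst. Qed.

Lemma measurable_normc f : cmeasurable f -> measurable_fun setT (fun x => normc (f x)).
Proof.
move=> [f1 f2].
have -> : (fun x => normc (f x)) =
    (fun x => Num.sqrt (complex.Re (f x) ^+ 2 + complex.Im (f x) ^+ 2)).
  by apply/funext => x; case: (f x).
have mRI : measurable_fun setT (fun x => complex.Re (f x) ^+ 2 + complex.Im (f x) ^+ 2).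
  by apply: measurable_funD; exact: measurable_funX.
exact: (measurableT_comp (continuous_measurable_fun (@sqrt_continuous R)) mRI).
Qed.

Lemma cLp_ooP f : cLp mu +oo%E f <->
  cmeasurable f /\ exists M : R, {ae mu, forall x, normc (f x) <= M}.
Proof.
(* Total mass 1 selects the essential supremum in the definition of the norm. *)
rewrite /cLp /finite_norm unlock /= probability_setT lte01.
split=> -[mf bf]; split=> //.
  have [M Mf] : exists M : R, (ess_sup mu (abse \o (EFin \o (fun x => normc (f x)))) <= M%:E)%E.
    move: bf; case: (ess_sup _ _) => [r _|//|_]; first by exists r.
    by exists 0; rewrite leNye.
  exists M; move/ess_supP: Mf; apply: filterS => x /=.
  by rewrite lee_fin ger0_norm// normc_ge0.
have [M Mf] := bf; apply: (@le_lt_trans _ _ M%:E); last exact: ltry.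
by apply/ess_supP; move: Mf; apply: filterS => x /=; rewrite lee_fin ger0_norm// normc_ge0.
Qed.

Definition cintegrable f := mu.-integrable setT (EFin \o (fun x => complex.Re (f x))) /\
  mu.-integrable setT (EFin \o (fun x => complex.Im (f x))).

Lemma cintegrable_measurable f : cintegrable f -> cmeasurable f.
Proof.
by move=> [f1 f2]; split; apply/measurable_EFinP; [exact: measurable_int f1|
  exact: measurable_int f2].
Qed.

Lemma cLp_1P f : cLp mu 1%E f <-> cintegrable f.
Proof.
rewrite /cLp /finite_norm Lnorm1; split=> [[mf intf]|intf].
  have nf : mu.-integrable setT (EFin \o (fun x => normc (f x))).
    by apply/integrableP; split=> //; apply/measurable_EFinP; exact: measurable_normc.
  split; apply: (le_integrable _ _ _ nf) => //.
  - by apply/measurable_EFinP; case: mf.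
  - by move=> x _ /=; rewrite lee_fin (ger0_norm (normc_ge0 _)) normr_Re_le.
  - by apply/measurable_EFinP; case: mf.
  - by move=> x _ /=; rewrite lee_fin (ger0_norm (normc_ge0 _)) normr_Im_le.
have mf := cintegrable_measurable intf; split=> //.
have [f1 f2] := intf.
have := integrableD measurableT (integrable_abse f1) (integrable_abse f2).
move/(@le_integrable _ _ _ _ _ measurableT (EFin \o (fun x => normc (f x)))).
case/(_ _ _)/integrableP => //.
- by apply/measurable_EFinP; exact: measurable_normc.
- move=> x _ /=; rewrite lee_fin (ger0_norm (normc_ge0 _)) ger0_norm ?addr_ge0//.
  exact: normc_le_ReIm.
Qed.

Lemma cintegrableM_bounded f g : cLp mu +oo%E f -> cintegrable g ->
  cintegrable (fun x => f x * g x).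
Proof.
move=> /cLp_ooP[mf [M fM]] intg.
have mg := cintegrable_measurable intg; have [g1 g2] := intg.
apply/cLp_1P; rewrite /cLp /finite_norm Lnorm1; split; first exact: cmeasurableM.
have /cLp_1P[_] := intg; rewrite /finite_norm Lnorm1 => intng.
pose M' := Num.max M 0.
apply: (@le_lt_trans _ _ (\int[mu]_x (M'%:E * `|(normc (g x))%:E|)))%E.
  apply: ae_ge0_le_integral => //.
  - apply: measurableT_comp => //; apply/measurable_EFinP/measurable_normc.
    exact: cmeasurableM.
  - by move=> x _; rewrite mule_ge0// lee_fin le_max lexx orbT.
  - apply: measurable_funeM; apply: measurableT_comp => //.
    by apply/measurable_EFinP/measurable_normc.
  move: fM; apply: filterS => x fxM _ /=.
  rewrite Normc.normcM !normrM -EFinM lee_fin ler_wpM2r//.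
  by rewrite (ger0_norm (normc_ge0 _)) le_max fxM.
rewrite ge0_integralZl//.
- by rewrite lte_mul_pinfty// lee_fin le_max lexx orbT.
- apply: measurableT_comp => //.
  by apply/measurable_EFinP/measurable_normc.
- by rewrite lee_fin le_max lexx orbT.
Qed.

Lemma cLp_oo_integrable f : cLp mu +oo%E f -> cintegrable f.
Proof.
move=> foo; have := @cintegrableM_bounded f (fun=> 1) foo.
rewrite (_ : (fun x => f x * _) = f); last by apply/funext => x; rewrite mulr1.
by apply; split; apply: finite_measure_integrable_cst.
Qed.

Lemma cLp_ooD f g : cLp mu +oo%E f -> cLp mu +oo%E g ->
  cLp mu +oo%E (fun x => f x + g x).
Proof.
move=> /cLp_ooP[mf [M fM]] /cLp_ooP[mg [M' gM]]; apply/cLp_ooP.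
split; first exact: cmeasurableD.
exists (M + M'); move: fM gM; apply: filterS2 => x fM gM.
by apply: (le_trans (le_normcD _ _)); exact: lerD.
Qed.

Lemma cLp_ooM f g : cLp mu +oo%E f -> cLp mu +oo%E g ->
  cLp mu +oo%E (fun x => f x * g x).
Proof.
move=> /cLp_ooP[mf [M fM]] /cLp_ooP[mg [M' gM]]; apply/cLp_ooP.
split; first exact: cmeasurableM.
exists (M * M'); move: fM gM; apply: filterS2 => x fM gM.
by rewrite Normc.normcM ler_pM// normc_ge0.
Qed.

Lemma cLp_oo_cst (c : R[i]) : cLp mu +oo%E (fun _ : T => c).
Proof.
apply/cLp_ooP; split; first exact: cmeasurable_cst.
by exists (normc c); apply: aeW.
Qed.

Lemma cLp_oo_bounded f M : cmeasurable f -> (forall x, normc (f x) <= M) ->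
  cLp mu +oo%E f.
Proof. by move=> mf fM; apply/cLp_ooP; split=> //; exists M; apply: aeW. Qed.

Lemma cintegralD f g : cintegrable f -> cintegrable g ->
  cintegral mu (fun x => f x + g x) = cintegral mu f + cintegral mu g.
Proof.
move=> [f1 f2] [g1 g2]; rewrite /cintegral.
under eq_Rintegral do rewrite cReD.
under [X in _ +i* X = _]eq_Rintegral do rewrite cImD.
by rewrite !RintegralD.
Qed.

Lemma cintegralZ (c : R[i]) f : cintegrable f ->
  cintegral mu (fun x => c * f x) = c * cintegral mu f.
Proof.
move=> [f1 f2]; rewrite /cintegral.
have Z (a : R) (u : T -> R) : mu.-integrable setT (EFin \o u) ->
    mu.-integrable setT (EFin \o (fun x => a * u x)).
  move=> /(integrableZl measurableT a); apply: eq_integrable => // x _ /=.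
under eq_Rintegral do rewrite cReM.
under [X in _ +i* X = _]eq_Rintegral do rewrite cImM.
rewrite RintegralB ?RintegralD ?RintegralZl//; try exact: Z.
by case: c.
Qed.

Lemma weakstar_subset (A : set (T -> R[i])) f : cLp mu +oo%E f -> A f ->
  weakstar_closure mu A f.
Proof.
move=> foo Af; split=> // k g e _ e0; exists f => // i.
by rewrite subrr Normc.normc0.
Qed.

(** Neighbourhoods for the single functional [g] suffice: the integral is within every [e] of 0. *)
Lemma weakstar_annihilator (A : set (T -> R[i])) g f : cintegrable g ->
  (forall h, A h -> cintegral mu (fun x => h x * g x) = 0) ->
  weakstar_closure mu A f -> cintegral mu (fun x => f x * g x) = 0.
Proof.
move=> intg Ag [foo clf]; apply: Normc.eq0_normc; apply/eqP.
rewrite eq_le normc_ge0 andbT; apply/ler_addgt0Pr => e e0; rewrite add0r.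
have [|h Ah /(_ ord0)] := clf 1%N (fun=> g) e _ e0; first by move=> _; apply/cLp_1P.
by rewrite Ag// sub0r normcN => /ltW.
Qed.

(** The bounded factor [h] is moved onto the test functions, which stay integrable. *)
Lemma weakstar_mull (A : set (T -> R[i])) h f :
  (forall h, A h -> cLp mu +oo%E h) ->
  (forall f g, A f -> A g -> A (fun x => f x * g x)) ->
  A h -> weakstar_closure mu A f -> weakstar_closure mu A (fun x => h x * f x).
Proof.
move=> Aoo AM Ah [foo clf]; split; first by apply: cLp_ooM => //; exact: Aoo.
move=> k g e g1 e0.
have [|h' Ah' hh'] := clf k (fun i x => h x * g i x) e _ e0.
  by move=> i; apply/cLp_1P/cintegrableM_bounded; [exact: Aoo|apply/cLp_1P].
exists (fun x => h x * h' x); first exact: AM.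
have E u i : (fun x => h x * u x * g i x) = (fun x => u x * (h x * g i x)).
  by apply/funext => x; rewrite mulrCA mulrA.
by move=> i; rewrite !E; exact: hh'.
Qed.

(* Multiplication is separately weak*-continuous on L^oo. *)
Lemma weakstar_closure_algebra (A : set (T -> R[i])) :
  (forall h, A h -> cLp mu +oo%E h) -> is_algebra A ->
  is_algebra (weakstar_closure mu A).
Proof.
move=> Aoo [A0 AD AZ AM]; split.
- by apply: weakstar_subset => //; exact: Aoo.
- move=> f f' [foo clf] [foo' clf']; split; first exact: cLp_ooD.
  move=> k g e g1 e0; have e2 : 0 < e / 2 by rewrite divr_gt0.
  have [h Ah hf] := clf k g _ g1 e2; have [h' Ah' hf'] := clf' k g _ g1 e2.
  exists (fun x => h x + h' x); first exact: AD.
  move=> i; have gi : cintegrable (g i) by apply/cLp_1P.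
  have D u v : cLp mu +oo%E u -> cLp mu +oo%E v -> cintegral mu (fun x => (u x + v x) * g i x) =
      cintegral mu (fun x => u x * g i x) + cintegral mu (fun x => v x * g i x).
    move=> uoo voo; rewrite -cintegralD; try exact: cintegrableM_bounded.
    by congr cintegral; apply/funext => x; rewrite mulrDl.
  rewrite !D//; try exact: Aoo.
  rewrite opprD addrACA; apply: (le_lt_trans (le_normcD _ _)).
  by rewrite [e]splitr ltrD.
- move=> c f [foo clf]; split; first by apply: cLp_ooM => //; exact: cLp_oo_cst.
  move=> k g e g1 e0.
  have c0 : 0 < normc c + 1 by rewrite ltr_wpDl// normc_ge0.
  have [h Ah hf] := clf k g _ g1 (divr_gt0 e0 c0).
  exists (fun x => c * h x); first exact: AZ.
  move=> i; have gi : cintegrable (g i) by apply/cLp_1P.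
  have Z u : cLp mu +oo%E u -> cintegral mu (fun x => c * u x * g i x) =
      c * cintegral mu (fun x => u x * g i x).
    move=> uoo; rewrite -cintegralZ; last exact: cintegrableM_bounded.
    by congr cintegral; apply/funext => x; rewrite mulrA.
  rewrite !Z//; try exact: Aoo.
  rewrite -mulrBr Normc.normcM; have := hf i; rewrite ltr_pdivlMr//.
  apply: le_lt_trans; rewrite mulrC ler_wpM2l ?normc_ge0//.
  by rewrite lerDl.
- move=> f f' clf [foo' clf']; have [foo cl] := clf.
  split; first exact: cLp_ooM.
  move=> k g e g1 e0; have e2 : 0 < e / 2 by rewrite divr_gt0.
  (* The approximations are nested: [h] replaces [f'] against the test functions [f * g i]; then
     [weakstar_mull] puts [h * f] in the closure, and [h'] approximates it. *)
  have [|h Ah hf] := clf' k (fun i x => f x * g i x) _ _ e2.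
    by move=> i; apply/cLp_1P/cintegrableM_bounded => //; apply/cLp_1P.
  have [_ clhf] := weakstar_mull Aoo AM Ah clf.
  have [h' Ah' hh'] := clhf k g _ g1 e2.
  exists h' => // i; rewrite [e]splitr.
  rewrite -(subrKA (cintegral mu (fun x => h x * f x * g i x))).
  apply: (le_lt_trans (le_normcD _ _)); apply: ltrD; first exact: hh'.
  have E u : (fun x => u x * f x * g i x) = (fun x => u x * (f x * g i x)).
    by apply/funext => x; rewrite mulrA.
  rewrite E (_ : (fun x => f x * f' x * g i x) = (fun x => f' x * (f x * g i x))).
    exact: hf.
  by apply/funext => x; rewrite mulrCA mulrA.
Qed.

End ComplexFunctions.

(** * Polynomials as functions of the real coordinates *)

Section Evaluation.
Context (R : realType) (N : nat).
Local Notation C := R[i].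
Implicit Types (P Q : mpoly (N + N) C) (x y : 'rV[R]_(N + N)).

Lemma zevalD P Q x : zeval (P + Q) x = zeval P x + zeval Q x.
Proof. exact: mevalD. Qed.
Lemma zevalM P Q x : zeval (P * Q) x = zeval P x * zeval Q x.
Proof. exact: mevalM. Qed.
Lemma zevalZ c P x : zeval (c *: P) x = c * zeval P x.
Proof. exact: mevalZ. Qed.
Lemma zeval1 x : zeval (1 : mpoly (N + N) C) x = 1.
Proof. exact: meval1. Qed.
Lemma zeval0 x : zeval (0 : mpoly (N + N) C) x = 0.
Proof. exact: meval0. Qed.
Lemma zeval_sum (J : Type) (r : seq J) (B : pred J) (F : J -> mpoly (N + N) C) x :
  zeval (\sum_(i <- r | B i) F i) x = \sum_(i <- r | B i) zeval (F i) x.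
Proof. exact: (raddf_sum (meval _)). Qed.
Lemma zeval_zvar (j : 'I_N) x : zeval (zvar C j) x = zcoord x j.
Proof. by rewrite /zeval mevalXU (unsplitK (inl j)). Qed.
Lemma zeval_bvar (j : 'I_N) x : zeval (bvar C j) x = conjc (zcoord x j).
Proof. by rewrite /zeval mevalXU (unsplitK (inr j)). Qed.

Lemma imag2 : 'i * 'i = -1 :> C.
Proof. by rewrite -expr2 sqr_i. Qed.

Lemma zeval_zpoint P x :
  zeval P x = meval (zpoint 'i (map_mx (real_complex R) x)) P.
Proof.
apply: meval_eq => v; rewrite /zpoint; case: (fintype.split v) => j; rewrite !mxE /zcoord /=;
  simpc => //; by rewrite mulr1.
Qed.

Lemma is_derive_coord k l x : is_derive x (delta_mx 0 k : 'rV[R]_(N + N))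
  (fun y : 'rV[R]_(N + N) => y 0 l) (l == k)%:R.
Proof.
have E : (fun h : R => h^-1 *: ((h *: (delta_mx 0 k : 'rV[R]_(N + N)) + x) 0 l - x 0 l))
    @ 0^' --> ((l == k)%:R : R).
  apply: (@cvg_trans _ ((fun=> (l == k)%:R : R) @ (0 : R)^')); last exact: cvg_cst.
  apply: near_eq_cvg; near=> h; rewrite !mxE eqxx /= addrK /= scalerA mulVf ?scale1r//.
  by near: h; exact: nbhs_dnbhs_neq.
by split; [apply/cvg_ex; exists (l == k)%:R|apply/cvg_lim].
Unshelve. all: by end_near. Qed.

Definition cderive (f : 'rV[R]_(N + N) -> C) (v x : 'rV[R]_(N + N)) (l : C) :=
  is_derive x v (fun y => complex.Re (f y)) (complex.Re l) /\
  is_derive x v (fun y => complex.Im (f y)) (complex.Im l).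

Lemma cderiveD f g v x l m : cderive f v x l -> cderive g v x m ->
  cderive (fun y => f y + g y) v x (l + m).
Proof.
move=> [f1 f2] [g1 g2]; split.
  rewrite cReD; have -> : (fun y => complex.Re (f y + g y)) =
    (fun y => complex.Re (f y)) + (fun y => complex.Re (g y)).
    by apply/funext => y; rewrite cReD.
  exact: is_deriveD.
rewrite cImD; have -> : (fun y => complex.Im (f y + g y)) =
  (fun y => complex.Im (f y)) + (fun y => complex.Im (g y)).
  by apply/funext => y; rewrite cImD.
exact: is_deriveD.
Qed.

Lemma cderive_cst (c : C) v x : cderive (fun=> c) v x 0.
Proof. by split; exact: is_derive_cst. Qed.

Lemma cderiveM f g v x l m : cderive f v x l -> cderive g v x m ->
  cderive (fun y => f y * g y) v x (l * g x + f x * m).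
Proof.
move=> [f1 f2] [g1 g2]; split.
  have -> : (fun y => complex.Re (f y * g y)) =
      (fun y => complex.Re (f y)) * (fun y => complex.Re (g y)) -
      (fun y => complex.Im (f y)) * (fun y => complex.Im (g y)).
    by apply/funext => y; rewrite cReM.
  apply: (is_derive_eq (is_deriveB (is_deriveM f1 g1) (is_deriveM f2 g2))).
  by rewrite cReD !cReM /GRing.scale /=; ring.
have -> : (fun y => complex.Im (f y * g y)) =
    (fun y => complex.Re (f y)) * (fun y => complex.Im (g y)) +
    (fun y => complex.Im (f y)) * (fun y => complex.Re (g y)).
  by apply/funext => y; rewrite cImM.
apply: (is_derive_eq (is_deriveD (is_deriveM f1 g2) (is_deriveM f2 g1))).
by rewrite cImD !cImM /GRing.scale /=; ring.
Qed.

Lemma cderive_zvar j k x : cderive (fun y => zeval (zvar C j) y) (delta_mx 0 k) x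
  (zeval (dx 'i k (zvar C j)) x).
Proof.
have -> : zeval (dx 'i k (zvar C j)) x =
    (lshift N j == k)%:R +i* (rshift N j == k)%:R.
  rewrite -(splitK k); case: (fintype.split k) => i /=.
    rewrite dxl dz_zvar db_zvar addr0 eq_rlshift (inj_eq (@lshift_inj _ _)).
    by case: (j == i); rewrite ?zeval1 ?zeval0.
  rewrite dxr dz_zvar db_zvar subr0 eq_lrshift (inj_eq (@rshift_inj _ _)) zevalZ.
  by case: (j == i); rewrite ?zeval1 ?zeval0 ?mulr1 ?mulr0.
split.
  under eq_fun do rewrite zeval_zvar; exact: is_derive_coord.
by under eq_fun do rewrite zeval_zvar; exact: is_derive_coord.
Qed.

Lemma cderive_bvar j k x : cderive (fun y => zeval (bvar C j) y) (delta_mx 0 k) x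
  (zeval (dx 'i k (bvar C j)) x).
Proof.
have -> : zeval (dx 'i k (bvar C j)) x =
    (lshift N j == k)%:R -i* (rshift N j == k)%:R.
  rewrite -(splitK k); case: (fintype.split k) => i /=.
    rewrite dxl dz_bvar db_bvar add0r eq_rlshift (inj_eq (@lshift_inj _ _)) oppr0.
    by case: (j == i); rewrite ?zeval1 ?zeval0.
  rewrite dxr dz_bvar db_bvar sub0r eq_lrshift (inj_eq (@rshift_inj _ _)) zevalZ.
  case: (j == i); last by rewrite oppr0 zeval0 mulr0 /= oppr0.
  by rewrite -scaleN1r zevalZ zeval1 mulr1 mulrN1 /=; simpc.
split.
  under eq_fun do rewrite zeval_bvar; exact: is_derive_coord.
under eq_fun do rewrite zeval_bvar.
exact: (is_deriveN (is_derive_coord k (rshift N j) x)).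
Qed.

Lemma cderive_zeval P k x :
  cderive (fun y => zeval P y) (delta_mx 0 k) x (zeval (dx 'i k P) x).
Proof.
move: P; apply: mpolyX_zb_ind => [|P Q DP DQ|c P DP|i P DP|i P DP].
- rewrite dx1 zeval0; have -> : (fun y => zeval (1 : mpoly (N + N) C) y) = fun=> 1.
    by apply/funext => y; rewrite zeval1.
  exact: cderive_cst.
- rewrite dxD zevalD; have -> : (fun y => zeval (P + Q) y) = fun y => zeval P y + zeval Q y.
    by apply/funext => y; rewrite zevalD.
  exact: (cderiveD DP DQ).
- rewrite dxZ zevalZ; have -> : (fun y => zeval (c *: P) y) = fun y => c * zeval P y.
    by apply/funext => y; rewrite zevalZ.
  by have := cderiveM (cderive_cst c (delta_mx 0 k) x) DP; rewrite mul0r add0r.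
- rewrite dxM zevalD !zevalM.
  have -> : (fun y => zeval (zvar C i * P) y) = fun y => zeval (zvar C i) y * zeval P y.
    by apply/funext => y; rewrite zevalM.
  exact: cderiveM (cderive_zvar i k x) DP.
- rewrite dxM zevalD !zevalM.
  have -> : (fun y => zeval (bvar C i * P) y) = fun y => zeval (bvar C i) y * zeval P y.
    by apply/funext => y; rewrite zevalM.
  exact: cderiveM (cderive_bvar i k x) DP.
Qed.

Lemma derive_Re_zeval P k :
  'D_(delta_mx 0 k) (fun y => complex.Re (zeval P y)) =
  (fun y => complex.Re (zeval (dx 'i k P) y)).
Proof.
by apply/funext => x; have [D _] := cderive_zeval P k x; rewrite derive_val.
Qed.

Lemma derive_Im_zeval P k :
  'D_(delta_mx 0 k) (fun y => complex.Im (zeval P y)) =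
  (fun y => complex.Im (zeval (dx 'i k P) y)).
Proof.
by apply/funext => x; have [_ D] := cderive_zeval P k x; rewrite derive_val.
Qed.

Lemma zeval_dx_eq0 P k : (forall x, zeval P x = 0) -> forall x, zeval (dx 'i k P) x = 0.
Proof.
move=> P0 x; apply/eqP; rewrite eq_complex.
have := congr1 (fun F => F x) (derive_Re_zeval P k).
have := congr1 (fun F => F x) (derive_Im_zeval P k).
rewrite (_ : (fun y => complex.Im (zeval P y)) = cst 0); last first.
  by apply/funext => y; rewrite P0.
rewrite (_ : (fun y => complex.Re (zeval P y)) = cst 0); last first.
  by apply/funext => y; rewrite P0.
by rewrite !derive_cst => <- <-; rewrite eqxx.
Qed.

Lemma zeval_dz_db_eq0 P j : (forall x, zeval P x = 0) ->
  forall x, zeval (dz j P) x = 0 /\ zeval (db j P) x = 0.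
Proof.
move=> P0 x; have i0 : 'i != 0 :> C by exact: ii_neq0 imag2.
have := zeval_dx_eq0 (lshift N j) P0 x; rewrite dxl zevalD => D1.
have := zeval_dx_eq0 (rshift N j) P0 x; rewrite dxr zevalZ => /eqP.
rewrite mulf_eq0 (negbTE i0) /= -scaleN1r zevalD zevalZ mulN1r subr_eq0 => /eqP D2.
move: D1; rewrite D2 -mulr2n => /eqP; rewrite mulrn_eq0 /= => /eqP D3.
by split; exact: D3.
Qed.

(** Vanishing at all real points is inherited by the formal derivatives, so each coefficient reduces
    to a constant term, read off at the origin. This turns harmonicity of a function into an
    identity of polynomials. *)
Lemma zeval_inj P : (forall x, zeval P x = 0) -> P = 0.
Proof.
move=> P0; apply/mpolyP => m; rewrite mcoeff0.
move: {2}(mdeg m) (erefl (mdeg m)) => e; elim: e m P P0 => [|e IH] m P P0 em.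
  move: em => /eqP; rewrite mdeg_eq0 => /eqP ->.
  rewrite -(P0 0) /zeval mevalE (eq_bigr (fun m => (m == mnm0)%:R * mcoeff m P)).
    have [mP|/memN_msupp_eq0 m0] := boolP (mnm0 \in msupp P).
      rewrite (bigD1_seq mnm0) ?msupp_uniq//= eqxx mul1r big1 ?addr0// => i /negbTE ->.
      by rewrite mul0r.
    rewrite m0 big_seq big1// => i iP; case: eqP => [->|_]; rewrite ?m0 ?mulr0 ?mul0r//.
  move=> i _; case: eqP => [->|/eqP i0].
    by rewrite mul1r big1 ?mulr1// => k _; rewrite mnm0E expr0.
  rewrite mul0r; move: i0; rewrite -mdeg_eq0 mdegE sum_nat_eq0 => /forallPn[v /= vi].
  rewrite (bigD1 v)//= (_ : _ ^+ _ = 0) ?mul0r ?mulr0//.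
  rewrite (_ : (match fintype.split v with inl j => _ | inr j => _ end) = 0) ?expr0n ?(negbTE vi)//.
  by case: (fintype.split v) => j; rewrite /zcoord !mxE /= ?oppr0.
have [v mv] : exists v, m v != 0%N.
  apply/existsP; rewrite -negb_forall; apply/negP => /forallP m0; move: em.
  by rewrite mdegE big1// => i _; apply/eqP/m0.
have mE : m = mnm_add (mnm_sub m (mnm1 v)) (mnm1 v) by rewrite submK// lep1mP.
have em' : mdeg (mnm_sub m (mnm1 v)) = e.
  by apply/eqP; rewrite -eqSS -em [in X in _ == X]mE mdegD mdeg1 addn1.
have : mcoeff (mnm_sub m (mnm1 v)) (mderiv v P) = 0.
  apply: (IH _ _ _ em') => x; rewrite -(splitK v).
  by case: (fintype.split v) => j; [exact: (zeval_dz_db_eq0 j P0 x).1|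
    exact: (zeval_dz_db_eq0 j P0 x).2].
by rewrite mcoeff_mderiv -mE => /eqP; rewrite mulrn_eq0 /= => /eqP.
Qed.

Lemma laplacian_Re P x :
  laplacian (fun y => complex.Re (zeval P y)) x = complex.Re (zeval (4%:R *: box P) x).
Proof.
rewrite -(sum_dx_dx imag2) zeval_sum /laplacian.
transitivity (\sum_k complex.Re (zeval (dx 'i k (dx 'i k P)) x)).
  by apply: eq_bigr => k _; rewrite derive_Re_zeval; exact: (congr1 (fun F => F x) (derive_Re_zeval _ k)).
by rewrite (big_morph (@complex.Re R) (@cReD R) (erefl _)).
Qed.

Lemma laplacian_Im P x :
  laplacian (fun y => complex.Im (zeval P y)) x = complex.Im (zeval (4%:R *: box P) x).
Proof.
rewrite -(sum_dx_dx imag2) zeval_sum /laplacian.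
transitivity (\sum_k complex.Im (zeval (dx 'i k (dx 'i k P)) x)).
  by apply: eq_bigr => k _; rewrite derive_Im_zeval; exact: (congr1 (fun F => F x) (derive_Im_zeval _ k)).
by rewrite (big_morph (@complex.Im R) (@cImD R) (erefl _)).
Qed.

Lemma harmonicP P : Defs.harmonic (zeval P) <-> box P = 0.
Proof.
split=> [hP|P0 x]; last by rewrite laplacian_Re laplacian_Im P0 scaler0 zeval0.
have : 4%:R *: box P = 0.
  apply: zeval_inj => x; apply/eqP; rewrite eq_complex.
  by have [] := hP x; rewrite laplacian_Re laplacian_Im => -> ->; rewrite eqxx.
by move/eqP; rewrite scaler_eq0 pnatr_eq0 /= => /eqP.
Qed.

End Evaluation.

(** * Integration over the sphere *)

Section SphereFunctional.
Context (R : realType) (n : nat) (sigma : probability (borel_sphere R n) R).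
Hypothesis sigma_inv : rotation_invariant sigma.
Local Notation C := R[i].
Local Notation N := n.+1.
Local Notation S := (borel_sphere R n).
Implicit Types (P Q : mpoly (N + N) C) (U : 'M[R]_(N + N)).

Lemma sphere_valP (x : S) : \sum_k sphere_val x 0 k ^+ 2 = 1.
Proof. by have := set_valP x. Qed.

Lemma sphere_val_inj : injective (@sphere_val R n).
Proof. exact: val_inj. Qed.

Lemma measurable_sphere_open (A : set 'rV[R]_(N + N)) : open A ->
  measurable ((@sphere_val R n) @^-1` A : set S).
Proof. by move=> oA; apply: sub_sigma_algebra; exists A. Qed.

Lemma measurable_coord k : measurable_fun setT (fun x : S => sphere_val x 0 k).
Proof.
apply: (measurability _ (RGenOInfty.measurableE R)) => //.
move=> _ [_ [a ->] <-]; rewrite setTI.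
rewrite [X in measurable X](_ : _ =
    (@sphere_val R n) @^-1` [set y : 'rV[R]_(N + N) | a < y 0 k]); last first.
  by apply/seteqP; split=> x /=; rewrite in_itv /= andbT.
apply: measurable_sphere_open.
apply: (@open_comp _ _ (fun y : 'rV[R]_(N + N) => y 0 k) [set r | a < r]).
  by move=> y _; exact: coord_continuous.
exact: open_gt.
Qed.

Lemma row_mulmx_continuous U : continuous (fun y : 'rV[R]_(N + N) => y *m U).
Proof.
move=> y A [P Py PA]; suff : \forall y' \near y, forall i j, P i j ((y' *m U) i j).
  by apply: filterS => y' Py'; apply: PA.
suff near_ij i j : nbhs y (fun y' => P i j ((y' *m U) i j)).
  apply: (@filter_forall _ _ (fun i y' => forall j, P i j ((y' *m U) i j)) (nbhs y)) => i.
  by apply: (@filter_forall _ _ (fun j y' => P i j ((y' *m U) i j)) (nbhs y)) => j; exact: near_ij.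
have cj : continuous (fun y' : 'rV[R]_(N + N) => (y' *m U) i j).
  have -> : (fun y' : 'rV[R]_(N + N) => (y' *m U) i j) =
      (fun y' : 'rV[R]_(N + N) => \sum_k y' i k * U k j).
    by apply/funext => y'; rewrite mxE.
  apply: (@continuous_big R _ +%R 0 xpredT (@add_continuous R^o)
    _ (index_enum _) (fun k (y' : 'rV[R]_(N + N)) => y' i k * U k j)) => k _ z.
  exact: (cvgM (@coord_continuous R 1 (N + N) i k z) (cvg_cst (U k j))).
exact: (cj y _ (Py i j)).
Qed.

Lemma sphere_rotated U (hU : U *m U^T = 1%:M) (x : S) :
  sphere_val x *m U \in @sphere_set R n.
Proof.
rewrite inE /sphere_set /=.
have E (z : 'rV[R]_(N + N)) : (z *m z^T) 0 0 = \sum_k z 0 k ^+ 2.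
  by rewrite mxE; apply: eq_bigr => k _; rewrite mxE expr2.
by rewrite -E trmx_mul mulmxA -(mulmxA _ U) hU mulmx1 E sphere_valP.
Qed.

Definition rotate U (hU : U *m U^T = 1%:M) (x : S) : S :=
  SigSub (sphere_rotated hU x).

Lemma sphere_val_rotate U (hU : U *m U^T = 1%:M) x :
  sphere_val (rotate hU x) = sphere_val x *m U.
Proof. by []. Qed.

Lemma measurable_rotate U (hU : U *m U^T = 1%:M) : measurable_fun setT (rotate hU).
Proof.
apply: (@measurability _ _ S S setT _ (@open (sphere R n))) => //.
move=> _ [B [A oA <-] <-]; rewrite setTI.
apply: (@measurable_sphere_open ((fun y : 'rV[R]_(N + N) => y *m U) @^-1` A)).
by apply: open_comp => // y _; exact: row_mulmx_continuous.
Qed.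

(** Since [sphere_val] is injective, the set in [rotation_invariant] is the preimage under
    [rotate hU]; so [sigma] is its own pushforward, and the variable can be changed. *)
Lemma Rintegral_rotate U (hU : U *m U^T = 1%:M) (f : S -> R) :
  measurable_fun setT f ->
  sigma.-integrable setT (EFin \o (f \o rotate hU)) ->
  \int[sigma]_x f (rotate hU x) = \int[sigma]_x f x.
Proof.
move=> mf intf; rewrite /Rintegral; congr fine.
transitivity (\int[pushforward sigma (rotate hU)]_x (f x)%:E)%E; last first.
  apply: eq_measure_integral => [|? A mA _]; first exact: measurable_rotate.
  apply: etrans (sigma_inv hU mA); rewrite /pushforward; congr (sigma _); apply/seteqP; split=> x /=.
    by move=> Ax; exists (rotate hU x).
  by move=> [y Ay]; rewrite -(sphere_val_rotate hU) => /sphere_val_inj <-.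
rewrite (@integral_pushforward _ _ _ _ _ _ (measurable_rotate hU) sigma setT (EFin \o f)) ?preimage_setT//.
exact/measurable_EFinP.
Qed.

Definition zfun P : S -> C := fun x => zeval P (sphere_val x).

Lemma normr_coord_le1 (x : S) k : `|sphere_val x 0 k| <= 1.
Proof.
rewrite -(@ler_pXn2r _ 2)// ?nnegrE// expr1n real_normK ?num_real//.
rewrite -(sphere_valP x) (bigD1 k)//= lerDl; apply: sumr_ge0 => i _.
exact: sqr_ge0.
Qed.

Lemma cLp_oo_zfun P : cLp sigma +oo%E (zfun P).
Proof.
have bounded j (f : S -> C) : (forall x, complex.Re (f x) = sphere_val x 0 (lshift N j)) ->
    (forall x, `|complex.Im (f x)| = `|sphere_val x 0 (rshift N j)|) ->
    measurable_fun setT (fun x => complex.Im (f x)) -> cLp sigma +oo%E f.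
  move=> fRe fIm mIm; apply: (@cLp_oo_bounded _ _ _ sigma _ 2).
    split=> //; under eq_fun do rewrite fRe; exact: measurable_coord.
  move=> x; apply: (le_trans (normc_le_ReIm _)).
  by rewrite fRe fIm (_ : 2 = 1 + 1)// lerD// normr_coord_le1.
rewrite /zfun; move: P; apply: mpolyX_zb_ind => [|P Q IP IQ|c P IP|j P IP|j P IP].
- by under eq_fun do rewrite zeval1; exact: cLp_oo_cst.
- by under eq_fun do rewrite zevalD; exact: cLp_ooD.
- by under eq_fun do rewrite zevalZ; apply: cLp_ooM => //; exact: cLp_oo_cst.
- under eq_fun do rewrite zevalM zeval_zvar; apply: cLp_ooM => //.
  by apply: (bounded j) => //; exact: measurable_coord.
- under eq_fun do rewrite zevalM zeval_bvar; apply: cLp_ooM => //.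
  apply: (bounded j) => // [x|]; first by rewrite /= normrN.
  exact: (measurable_funN (measurable_coord (rshift N j))).
Qed.

Lemma cintegrable_zfun P : cintegrable sigma (zfun P).
Proof. exact/cLp_oo_integrable/cLp_oo_zfun. Qed.

Definition sphere_int P : C^o := cintegral sigma (zfun P).

Lemma sphere_int_is_linear : linear sphere_int.
Proof.
move=> c P Q; rewrite /sphere_int.
have -> : zfun (c *: P + Q) = (fun x => (c * zfun P x) + zfun Q x).
  by apply/funext => x; rewrite /zfun zevalD zevalZ.
rewrite cintegralD ?cintegralZ//; try exact: cintegrable_zfun.
have := cintegrable_zfun (c *: P); congr cintegrable; apply/funext => x.
by rewrite /zfun zevalZ.
Qed.
HB.instance Definition _ := GRing.isLinear.Build C (mpoly (N + N) C) C^o *:%R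
  sphere_int sphere_int_is_linear.

Definition sphere_linear : {linear mpoly (N + N) C -> C^o} := sphere_int.

Lemma sphere_intD P Q : sphere_int (P + Q) = sphere_int P + sphere_int Q.
Proof. exact: linearD. Qed.
Lemma sphere_intB P Q : sphere_int (P - Q) = sphere_int P - sphere_int Q.
Proof. exact: linearB. Qed.
Lemma sphere_intZ c P : sphere_int (c *: P) = c * sphere_int P.
Proof. exact: linearZ. Qed.

Lemma sphere_int1 : sphere_int 1 = 1.
Proof.
rewrite /sphere_int /cintegral /zfun.
under eq_Rintegral do rewrite zeval1.
under [X in _ +i* X]eq_Rintegral do rewrite zeval1.
rewrite !Rintegral_cst//.
have -> : fine (sigma setT) = 1 by rewrite [X in fine X](@probability_setT _ _ _ sigma).
by rewrite mulr1 mul0r.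
Qed.

Lemma zeval_r2 (x : S) : zeval (r2 C N) (sphere_val x) = 1.
Proof.
rewrite /r2 zeval_sum.
have := congr1 (real_complex R) (sphere_valP x); rewrite big_split_ord /= => E.
apply: etrans E; rewrite rmorphD !rmorph_sum -big_split /=; apply: eq_bigr => j _.
rewrite zevalM zeval_zvar zeval_bvar; apply/eqP; rewrite eq_complex /zcoord /=.
by apply/andP; split; apply/eqP; ring.
Qed.

Lemma sphere_int_r2 P : sphere_int (r2 C N * P) = sphere_int P.
Proof.
rewrite /sphere_int; congr cintegral; apply/funext => x.
by rewrite /zfun zevalM zeval_r2 mul1r.
Qed.

Lemma sphere_int_rotate U (hU : U *m U^T = 1%:M) P Q :
  (forall x, zeval Q x = zeval P (x *m U)) -> sphere_int Q = sphere_int P.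
Proof.
move=> PQ; have QE : zfun Q = zfun P \o rotate hU.
  by apply/funext => x; rewrite /zfun /= PQ.
have [mP1 mP2] := cintegrable_measurable (cintegrable_zfun P).
have := cintegrable_zfun Q; rewrite /sphere_int /cintegral QE => -[i1 i2].
have E1 := @Rintegral_rotate U hU (fun x => complex.Re (zfun P x)) mP1 i1.
have E2 := @Rintegral_rotate U hU (fun x => complex.Im (zfun P x)) mP2 i2.
exact: (congr2 (@Complex R) E1 E2).
Qed.

Definition skew (k l : 'I_(N + N)) : 'M[R]_(N + N) := delta_mx k l - delta_mx l k.

Lemma trmx_skew k l : (skew k l)^T = - skew k l.
Proof. by rewrite /skew linearB /= !trmx_delta opprB. Qed.

Lemma skew_cube k l : skew k l *m (skew k l *m skew k l) = - skew k l.
Proof.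
have [->|kl] := eqVneq k l; first by rewrite /skew subrr mul0mx oppr0.
have lk : l != k by rewrite eq_sym.
have -> : skew k l *m skew k l = - (delta_mx k k + delta_mx l l).
  rewrite /skew !mulmxBl !mulmxBr !mul_delta_mx !mul_delta_mx_0//.
  by rewrite sub0r subr0 opprD.
rewrite mulmxN; congr (- _); rewrite /skew mulmxDr !mulmxBl !mul_delta_mx !mul_delta_mx_0//.
by rewrite sub0r subr0 addrC.
Qed.

Definition real_cayley (B : 'M[R]_(N + N)) (t : R) : 'M[R]_(N + N) :=
  (1 + t ^+ 2)%:M + (2%:R * t) *: B + (2%:R * t ^+ 2) *: (B *m B).

(** Divided by [1 + t ^+ 2], this matrix is the Cayley transform (1 + tB)(1 - tB)^-1, simplified
    with B^3 = -B. *)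
Lemma real_cayley_orthogonal (B : 'M[R]_(N + N)) t :
  B^T = - B -> B *m (B *m B) = - B ->
  real_cayley B t *m (real_cayley B t)^T = ((1 + t ^+ 2) ^+ 2)%:M.
Proof.
move=> BT B3; have -> : (real_cayley B t)^T =
    (1 + t ^+ 2)%:M - (2%:R * t) *: B + (2%:R * t ^+ 2) *: (B *m B).
  have B2T : (B *m B)^T = B *m B by rewrite trmx_mul BT mulmxN mulNmx opprK.
  apply/matrixP => i j; rewrite /real_cayley mxE mxE mxE mxE [in RHS]mxE [in RHS]mxE.
  have := congr1 (fun M : 'M[R]_(N + N) => M i j) BT.
  have := congr1 (fun M : 'M[R]_(N + N) => M i j) B2T.
  rewrite !mxE => -> ->; rewrite eq_sym mulrN; congr (_ + _).
rewrite /real_cayley; set B2 := B *m B.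
have B21 : B2 *m B = - B by rewrite -mulmxA.
have B22 : B2 *m B2 = - B2 by rewrite -mulmxA B3 mulmxN.
rewrite !mulmxDl !mulmxDr !mulmxN -!scalemxAl -!scalemxAr !mul_scalar_mx !mul_mx_scalar.
rewrite -/B2 B21 B22 B3 scale_scalar_mx; clear; move: B2 => B2.
apply/matrixP => i j; rewrite !mxE; case: (i == j); rewrite ?mulr1n ?mulr0n; ring.
Qed.

Lemma zeval_monomial_scale m (c : R) (x : 'rV[R]_(N + N)) :
  zeval (mpolyX C m) (c *: x) = c%:C ^+ mdeg m * zeval (mpolyX C m) x.
Proof.
rewrite !zeval_zpoint !mevalX mdegE -prodrXr -big_split /=; apply: eq_bigr => i _.
rewrite -exprMn; congr (_ ^+ _); rewrite /zpoint.
by case: (fintype.split i) => j; rewrite !mxE rmorphM /=; ring.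
Qed.

(** By linearity [P] may be a monomial [m]; its homogeneity turns the scalar [1 + t ^+ 2] between
    the Cayley matrix and an orthogonal one into the power of exponent [mdeg m] required by
    [tangent_invariant]. *)
Lemma sphere_int_tangent k l P :
  sphere_int (tangent 'i (delta_mx k l - delta_mx l k) P) = 0.
Proof.
rewrite [P]mpolyE; apply: (big_ind (fun P => sphere_int (tangent 'i _ P) = 0)).
- by rewrite -(scale0r 0) tangentZ sphere_intZ mul0r.
- move=> P1 P2 I1 I2; rewrite tangentD sphere_intD -[RHS]addr0.
  exact: (congr2 +%R I1 I2).
move=> m _; rewrite tangentZ sphere_intZ.
rewrite (@tangent_invariant _ _ _ (imag2 R) sphere_int _ _ (mdeg m)) ?mulr0// => t.
set T : R := t%:R; set c := 1 + T ^+ 2.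
have c0 : c != 0 by rewrite gt_eqF// ltr_wpDr// sqr_ge0.
have cE : 1 + t%:R ^+ 2 = c%:C :> C by rewrite /c rmorphD rmorphXn /= rmorph1 rmorph_nat.
set M := real_cayley (skew k l) T.
have hU : (c^-1 *: M) *m (c^-1 *: M)^T = 1%:M.
  rewrite linearZ /= -scalemxAl -scalemxAr real_cayley_orthogonal ?trmx_skew ?skew_cube//.
  by rewrite scalerA scale_scalar_mx -/c -expr2 exprVn mulVf// expf_neq0.
have MC : cayley (delta_mx k l - delta_mx l k) t%:R = map_mx (real_complex R) M.
  rewrite /M /real_cayley /cayley !map_mxD !map_mxZ map_scalar_mx map_mxM map_mxB.
  have T1 : real_complex R (2%:R * T) = 2%:R * t%:R by rewrite rmorphM !rmorph_nat.
  have T2 : real_complex R (2%:R * T ^+ 2) = 2%:R * t%:R ^+ 2.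
    by rewrite rmorphM rmorphXn !rmorph_nat.
  rewrite !map_delta_mx -/c. by rewrite /= T1 T2 -cE.
have a0 : c%:C ^+ mdeg m != 0.
  by apply: expf_neq0; rewrite eq_complex /= eqxx andbT.
rewrite cE; set Q := subst _ _ _.
suff E : sphere_int ((c%:C ^+ mdeg m)^-1 *: Q) = sphere_int (mpolyX C m).
  move: (_ ^+ _) a0 E => a a0 E; rewrite /= -E sphere_intZ.
  by move: (sphere_int Q) => b; rewrite mulVKf.
apply: (sphere_int_rotate hU) => x.
rewrite zevalZ zeval_zpoint /Q (meval_subst (imag2 R)) MC -map_mxM -zeval_zpoint.
have -> : x *m M = c *: (x *m (c^-1 *: M)).
  by rewrite -scalemxAr scalerA divff// scale1r.
by rewrite zeval_monomial_scale; move: (zeval _ _) => b; rewrite mulKf.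
Qed.

Lemma sphere_int_invariant i j P :
  sphere_int (zvar C i * dz j P - bvar C j * db i P) = 0.
Proof.
have L0 k l : sphere_int (tangent 'i (delta_mx k l - delta_mx l k) P) = 0.
  exact: sphere_int_tangent.
have vanish T1 T2 T3 T4 Q : sphere_int T1 = 0 -> sphere_int T2 = 0 ->
    sphere_int T3 = 0 -> sphere_int T4 = 0 ->
    2%:R *: Q = T1 + T2 + 'i *: (T3 - T4) -> sphere_int Q = 0.
  move=> I1 I2 I3 I4 E; apply: (@mulfI _ (2%:R : C)); first by rewrite pnatr_eq0.
  rewrite mulr0 -sphere_intZ E 2!sphere_intD sphere_intZ sphere_intB I1 I2 I3 I4.
  by rewrite subrr mulr0 !addr0.
exact: (vanish _ _ _ _ _ (L0 _ _) (L0 _ _) (L0 _ _) (L0 _ _) (rot_tangent (imag2 R) i j P)).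
Qed.

End SphereFunctional.

(** * Algebra patterns *)

Section AlgebraPatterns.
Context (R : realType) (n : nat) (sigma : probability (borel_sphere R n) R).
Hypothesis sigma_inv : rotation_invariant sigma.
Local Notation C := R[i].
Local Notation N := n.+1.
Local Notation S := (borel_sphere R n).
Local Notation I := (sphere_linear sigma).
Implicit Types (P Q : mpoly (N + N) C) (Om : set (nat * nat)).

Lemma zfunD P Q : zfun (P + Q) = (fun x : S => zfun P x + zfun Q x).
Proof. by apply/funext => x; exact: zevalD. Qed.
Lemma zfunM P Q : zfun (P * Q) = (fun x : S => zfun P x * zfun Q x).
Proof. by apply/funext => x; exact: zevalM. Qed.
Lemma zfunZ c P : zfun (c *: P) = (fun x : S => c * zfun P x).
Proof. by apply/funext => x; exact: zevalZ. Qed.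
Lemma zfun0 : zfun 0 = (fun _ : S => 0).
Proof. by apply/funext => x; exact: zeval0. Qed.

Lemma zeval_r2X j (x : S) : zeval (r2 C N ^+ j) (sphere_val x) = 1.
Proof.
elim: j => [|j IH]; first by rewrite expr0 zeval1.
by rewrite exprS zevalM zeval_r2 mul1r IH.
Qed.

Lemma HspaceP a b (h : S -> C) :
  Hspace a b h <-> exists2 P, hbihom a b P & h = zfun P.
Proof.
split=> [[P [Pab /harmonicP P0 hP]]|[P [Pab P0] ->]].
  by exists P; [split=> //; exact/bihomP|exact/funext].
by exists P; split=> //; [exact/bihomP|exact/harmonicP].
Qed.

Lemma Espace_zfun Om a b P : Om (a, b) -> hbihom a b P -> Espace Om (zfun P : S -> C).
Proof.
move=> Oab hP; exists 1%N, (fun=> zfun P); split=> [i|x]; last by rewrite big_ord1.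
by exists (a, b) => //; apply/HspaceP; exists P.
Qed.

Lemma Espace0 Om : Espace Om (fun _ : S => 0).
Proof.
by exists 0%N, (fun _ _ => 0); split=> [[]//|x]; rewrite big_ord0.
Qed.

Lemma EspaceD Om (f g : S -> C) : Espace Om f -> Espace Om g ->
  Espace Om (fun x => f x + g x).
Proof.
move=> [k [h [hO fh]]] [l [h' [h'O gh']]].
exists (k + l)%N, (fun i => match fintype.split i with inl j => h j | inr j => h' j end).
split=> [i|x]; first by case: (fintype.split i).
rewrite fh gh' big_split_ord /=; congr (_ + _); apply: eq_bigr => i _.
  by rewrite (unsplitK (inl i)).
by rewrite (unsplitK (inr i)).
Qed.

Lemma Espace_sum Om (T : Type) (s : seq T) (F : T -> S -> C) :
  (forall t, Espace Om (F t)) -> Espace Om (fun x => \sum_(t <- s) F t x).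
Proof.
move=> FE; elim: s => [|t s IH].
  by rewrite (_ : (fun x => _) = fun=> 0); [exact: Espace0|
    apply/funext => x; rewrite big_nil].
rewrite (_ : (fun x => _) = fun x => F t x + \sum_(t <- s) F t x); first exact: EspaceD.
by apply/funext => x; rewrite big_cons.
Qed.

Lemma Espace_ind Om (K : (S -> C) -> Prop) : K (fun=> 0) ->
  (forall f g, K f -> K g -> K (fun x => f x + g x)) ->
  (forall a b P, Om (a, b) -> hbihom a b P -> K (zfun P)) ->
  forall f, Espace Om f -> K f.
Proof.
move=> K0 KD Kz f [k [h [hO fh]]].
have -> : f = (fun x => \sum_(i <- index_enum 'I_k) h i x) by exact/funext.
elim: (index_enum _) => [|i s IH].
  by rewrite (_ : (fun x => _) = fun=> 0)//; apply/funext => x; rewrite big_nil.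
have -> : (fun x => \sum_(j <- i :: s) h j x) = (fun x => h i x + \sum_(j <- s) h j x).
  by apply/funext => x; rewrite big_cons.
apply: KD IH; have [[a b] Oab /HspaceP[P hP ->]] := hO i; exact: Kz hP.
Qed.

Lemma Espace_cLp_oo Om (f : S -> C) : Espace Om f -> cLp sigma +oo%E f.
Proof.
elim/Espace_ind => [|f1 f2 I1 I2|a b P _ _].
- exact: cLp_oo_cst.
- exact: cLp_ooD.
- exact: cLp_oo_zfun.
Qed.

Lemma EspaceZ Om c (f : S -> C) : Espace Om f -> Espace Om (fun x => c * f x).
Proof.
elim/Espace_ind => [|f1 f2 I1 I2|a b P Oab [Pab P0]].
- rewrite (_ : (fun x => _) = fun=> 0); first exact: Espace0.
  by apply/funext => x; rewrite mulr0.
- rewrite (_ : (fun x => _) = fun x => c * f1 x + c * f2 x); first exact: EspaceD.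
  by apply/funext => x; rewrite mulrDr.
- rewrite -zfunZ; apply: (Espace_zfun Oab); split; first exact: bihomZ.
  by rewrite boxZ P0 scaler0.
Qed.

(** Powers of [r2] are 1 on the sphere, so a product is the sum of its harmonic components. Those of
    bidegree outside [Om] pair to 0 with all test polynomials, hence are 0. *)
Lemma EspaceM Om (f g : S -> C) :
  vanishing I (fun a b => Om (a, b)) ->
  Espace Om f -> Espace Om g -> Espace Om (fun x => f x * g x).
Proof.
move=> van fE gE; elim/Espace_ind: fE => [|f1 f2 I1 I2|a b P Oab hP].
- rewrite (_ : (fun x => _) = fun=> 0); first exact: Espace0.
  by apply/funext => x; rewrite mul0r.
- rewrite (_ : (fun x => _) = fun x => f1 x * g x + f2 x * g x); first exact: EspaceD.
  by apply/funext => x; rewrite mulrDl.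
elim/Espace_ind: gE => [|f1 f2 I1 I2|c d Q Ocd hQ].
- rewrite (_ : (fun x => _) = fun=> 0); first exact: Espace0.
  by apply/funext => x; rewrite mulr0.
- rewrite (_ : (fun x => _) = fun x => zfun P x * f1 x + zfun P x * f2 x); first exact: EspaceD.
  by apply/funext => x; rewrite mulrDr.
have [h [h0 hh PQ]] := harmonic_decomposition (isT : (0 < N)%N) (bihomM hP.1 hQ.1).
set k := minn _ _ in PQ.
have -> : (fun x : S => zfun P x * zfun Q x) = (fun x => \sum_(j < k.+1) zfun (h j) x).
  apply/funext => x; rewrite -[LHS]zevalM PQ zeval_sum; apply: eq_bigr => j _.
  by rewrite zevalM zeval_r2X mul1r.
apply: Espace_sum => j; have jk : (j <= k)%N by rewrite -ltnS.
have [Oj|nOj] := pselect (Om ((a + c - j)%N, (b + d - j)%N)).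
  by apply: (Espace_zfun Oj); split; [exact: hh|exact: h0].
rewrite (_ : h j = 0); first by rewrite zfun0; exact: Espace0.
apply: (component_eq0 (isT : (0 < N)%N) (sphere_int_invariant sigma_inv)
  (sphere_int_r2 sigma) (sphere_int1 sigma) h0 hh PQ jk) => u hu u0.
exact: (van _ _ _ _ _ _ _ _ Oab Ocd hP hQ jk (conj hu u0)).
Qed.

Lemma vanishing_algebra_pattern Om :
  vanishing I (fun a b => Om (a, b)) -> algebra_pattern sigma Om.
Proof.
move=> van; apply: weakstar_closure_algebra; first exact: Espace_cLp_oo.
split; [exact: Espace0|exact: EspaceD|exact: EspaceZ|].
by move=> f g; exact: EspaceM.
Qed.

(** If the new bidegree were not in [Om], the test polynomial [h] would annihilate [Espace Om] by
    orthogonality, hence its closure; but [f * g] lies in that closure and pairs with [h] to a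
    nonzero number. *)
Lemma algebra_pattern_product_closed Om :
  algebra_pattern sigma Om -> product_closed I (fun a b => Om (a, b)).
Proof.
move=> [_ _ _ algM] a b c d j Oab Ocd [f [g [hf hg [ja jb [h [hh h0 Ifgh]]]]]].
apply: contrapT => nO; move/eqP: Ifgh; apply.
have closed P e k : Om (e, k) -> hbihom e k P ->
    weakstar_closure sigma (Espace Om) (zfun P).
  by move=> Oek hP; apply: weakstar_subset; [exact: cLp_oo_zfun|exact: Espace_zfun hP].
have := algM _ _ (closed _ _ _ Oab hf) (closed _ _ _ Ocd hg).
move=> /(weakstar_annihilator (cintegrable_zfun sigma h)) ann.
suff : cintegral sigma (zfun (f * g * h)) = 0 by [].
rewrite zfunM zfunM; apply: ann => u uE.
suff [P -> IP] : exists2 P, u = zfun P & I (P * h) = 0.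
  by have := IP; rewrite /= /sphere_int zfunM.
elim/Espace_ind: uE => [|u1 u2 [P1 -> I1] [P2 -> I2]|e k P Oek hP].
- by exists 0; rewrite ?zfun0// mul0r linear0.
- exists (P1 + P2); first exact/esym/zfunD.
  rewrite mulrDl -[RHS]addr0.
  exact: (etrans (sphere_intD sigma (P1 * h) (P2 * h)) (congr2 +%R I1 I2)).
exists P => //; apply: (I_orthogonal (isT : (0 < N)%N) (sphere_int_invariant sigma_inv)
  (sphere_int_r2 sigma) hP.1 hh hP.2 h0).
by apply/eqP => -[e_ k_]; apply: nO; rewrite -e_ -k_.
Qed.

End AlgebraPatterns.

Lemma GsetE p q x y : Gset p q (x, y) = G p q x y.
Proof.
by apply/propext; split=> -[E|E]; [left; case: E|right|left; case: E => -> ->|right].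
Qed.

Lemma smallest_algebra_patternP (R : realType) (n p q : nat)
    (sigma : probability (borel_sphere R n) R) (Om : set (nat * nat)) :
  rotation_invariant sigma -> Om (p, q) ->
  vanishing (sphere_linear sigma) (fun a b => Om (a, b)) ->
  (forall Om' : nat -> nat -> Prop, product_closed (sphere_linear sigma) Om' ->
     Om' p q -> forall x y, Om (x, y) -> Om' x y) ->
  smallest_algebra_pattern sigma (p, q) Om.
Proof.
move=> sigma_inv Opq van small; split=> //.
  exact: vanishing_algebra_pattern.
move=> Om' algO O'pq [x y] Oxy.
apply: (small (fun a b => Om' (a, b))) => //.
exact: algebra_pattern_product_closed.
Qed.

Theorem theorem4p12 (R : realType) (n p q : nat)
    (sigma : probability (borel_sphere R n) R)
    (sigma_inv : rotation_invariant sigma) (ltqp : (q < p)%N) :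
  ((3 <= n.+1)%N -> smallest_algebra_pattern sigma (p, q) (Gset p q)) /\
  (n.+1 = 2%N ->
   smallest_algebra_pattern sigma (p, q) (Gset p q `\` Gset_deleted p q)).
Proof.
split=> [n3|n2].
  apply: (smallest_algebra_patternP sigma_inv); first by left.
    have -> : (fun a b => Gset p q (a, b)) = G p q.
      by apply/funext => a; apply/funext => b; exact: GsetE.
    exact: vanishing_G.
  move=> Om closed Opq x y; rewrite GsetE.
  have n1 : (1 < n.+1)%N by lia.
  exact: (@product_closed_G _ _ (sphere_linear sigma) p q ltqp Om ord0 (Ordinal n1)
    (Ordinal n3) isT (sphere_int_invariant sigma_inv) (sphere_int_r2 sigma)
    (sphere_int1 sigma) isT isT isT closed Opq).
have n1 : n = 1%N by lia.
subst n.
have GE : (fun a b => (Gset p q `\` Gset_deleted p q) (a, b)) =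
    (fun a b => G p q a b /\ ~ G_deleted p q a b).
  by apply/funext => a; apply/funext => b; rewrite /setD /= GsetE.
apply: (smallest_algebra_patternP sigma_inv).
- split; first by left.
  (* If [(p, q)] were deleted, then [(m - 1) p = 1 = (m - 1) q] or [p = j = q], against [q < p]. *)
  by move=> [[m [_ /= E1 E2]]|[j [oj /= E1 E2]]]; nia.
- rewrite GE.
  exact: (@vanishing_G2 _ (sphere_linear sigma) p q ltqp (sphere_int_invariant sigma_inv)
    (sphere_int_r2 sigma)).
move=> Om closed Opq x y [Gxy nD]; rewrite GsetE in Gxy.
exact: (@product_closed_G2 _ (sphere_linear sigma) p q ltqp (sphere_int_invariant sigma_inv)
  (sphere_int_r2 sigma) (sphere_int1 sigma) Om closed Opq x y Gxy nD).
Qed.
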